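(* Let $k$ be an algebraically closed field and let $A=k^{[2]}$. For $F\in A$, the following are equivalent: (a) $F$ is a generally rational polynomial in $A$; (b) $F$ is a pseudo field generator in $A$ and, if $\operatorname{char}k=p>0$, then $F\notin A^p=\{a^p: a\in A\}$.
   Context: $k^{[2]}$ denotes a polynomial ring in two variables over $k$; $k^{(1)}$ denotes a purely transcendental extension of $k$ of transcendence degree $1$. For $F\in A$, ''$A/(F)$ is $k$-rational'' means: $F$ is irreducible in $A$ and the field of fractions of $A/(F)$ is $k$-isomorphic to $k^{(1)}$. $F$ is a generally rational polynomial in $A$ if $A/(F-\lambda)$ is $k$-rational for all but finitely many $\lambda\in k$. $F$ is a pseudo field generator in $A$ if there exists $G\in\operatorname{Frac}A$ such that $\operatorname{Frac}A$ is a purely inseparable field extension of $k(F,G)$. *)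

(* Defs.v *)
From HB Require Import structures.
From mathcomp Require Import all_boot all_order all_algebra.
From mathcomp Require Export fraction.
Set Implicit Arguments. Unset Strict Implicit. Unset Printing Implicit Defensive.
Import GRing.Theory.
Local Open Scope ring_scope.

Notation tofrac R := (@FracField.tofrac R).

(* A = k^[2] is modelled as {poly {poly k}} (inner variable X, outer Y). *)
Notation poly2 k := {poly {poly k}}.

Definition eval2 (k : nzRingType) (L : comNzRingType) (iota : k -> L)
  (P : poly2 k) (x y : L) : L :=
  (map_poly (fun q : {poly k} => (map_poly iota q).[x]) P).[y].

Definition dvdA (k : nzRingType) (F P : poly2 k) : Prop := exists Q, P = Q * F.

Definition irreducibleA (k : idomainType) (F : poly2 k) : Prop :=
  F != 0 /\ F \isn't a GRing.unit /\
  forall a b : poly2 k, F = a * b -> a \is a GRing.unit \/ b \is a GRing.unit.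

Notation ratfun k := {fraction {poly k}}.
Definition kt_emb (k : idomainType) (c : k) : ratfun k := tofrac {poly k} (c%:P).

(* A/(F) is k-rational: F irreducible and Frac(A/(F)) is k-isomorphic to k(t).
   A k-algebra isomorphism Frac(A/(F)) ~ k(t) is given (universal property of
   A = k[X,Y] and of fraction fields) by x = image of X, y = image of Y such
   that the k-algebra map A -> k(t), P |-> P(x,y), has kernel exactly (F)
   and every element of k(t) is a quotient of images. *)
Definition k_rational_quot (k : idomainType) (F : poly2 k) : Prop :=
  irreducibleA F /\
  exists x y : ratfun k,
    (forall P : poly2 k, eval2 (@kt_emb k) P x y = 0 <-> dvdA F P) /\
    (forall z : ratfun k, exists P Q : poly2 k,
        eval2 (@kt_emb k) Q x y != 0 /\
        z = eval2 (@kt_emb k) P x y / eval2 (@kt_emb k) Q x y).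

Definition generally_rational (k : idomainType) (F : poly2 k) : Prop :=
  exists s : seq k, forall lambda : k, lambda \notin s ->
    k_rational_quot (F - lambda%:P%:P).

Notation fracA k := {fraction poly2 k}.
Definition kA_emb (k : idomainType) (c : k) : fracA k := tofrac (poly2 k) (c%:P%:P).

Definition in_k2 (k : idomainType) (u v z : fracA k) : Prop :=
  exists P Q : poly2 k,
    eval2 (@kA_emb k) Q u v != 0 /\
    z = eval2 (@kA_emb k) P u v / eval2 (@kA_emb k) Q u v.

Definition purely_insep_over (k : idomainType) (K : fracA k -> Prop) : Prop :=
  forall z : fracA k, exists q : nat,
    K (z ^+ q) /\ (q = 1%N \/ exists p e : nat, p \in [pchar k] /\ q = (p ^ e)%N).

Definition pseudo_field_generator (k : idomainType) (F : poly2 k) : Prop :=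
  exists G : fracA k, purely_insep_over (in_k2 (tofrac (poly2 k) F) G).

Definition in_pth_powers (k : idomainType) (p : nat) (F : poly2 k) : Prop :=
  exists a : poly2 k, F = a ^+ p.

(* Main.v *)
(* (a) => (b).  Over an algebraically closed field a relation E(g, e) that is
   first-order definable and defines e uniquely for generic g is given by
   b(g) e^q = a(g) with q a power of the characteristic exponent.  For generic
   lambda the curve F = lambda has a rational parametrisation of bounded degree,
   unique up to a Moebius map.  Its parameter values at the points lying on three
   fixed lines yield binary quadratics (vector fields on P^1) whose discriminant
   form does not depend on the parametrisation, hence is a rational function of
   some S with S^q = lambda.  By Tsen's theorem this form has an isotropic vector
   over k(S); it singles out a point of P^1, and normalising at this pole gives a
   canonical coordinate T on the curve.  So (S, T) and the points of the plane
   determine each other definably, and powers of X and Y lie in k(F, G), where G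
   is a power of T.

   (b) => (a).  Write X^q = P1(F, G) / Q(F, G) and Y^q = P2(F, G) / Q(F, G).
   Specialising F to lambda and G to t^q and taking q-th roots gives x, y in k(t)
   with F(x, y) = lambda.  If P(x, y) = 0 then F - lambda divides c P^q, where c
   is a product of powers of polynomials independent of lambda and P; hence it
   divides P for almost all lambda, because F has a nonzero partial derivative
   when it is not a p-th power.  Finally t^q lies in k(x, y), so k(x, y) is
   k(t^(p^j)) for some j. *)
Require Import Defs.
From HB Require Import structures.
From mathcomp Require Import all_boot all_order all_algebra.
From mathcomp Require Import closed_field.
From mathcomp Require Import ring zify.
From Stdlib Require Import Classical.
Set Implicit Arguments. Unset Strict Implicit. Unset Printing Implicit Defensive.
Import GRing.Theory.
Local Open Scope ring_scope.

(** * Definable predicates over an algebraically closed field *)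

(** The obstacle in (a) => (b) is uniformity: the hypothesis gives one parametrisation for each
    [lambda], chosen independently, with no algebraic dependence on [lambda]. Quantifier elimination
    repairs this, since a definable quantity that is unique is automatically rational up to a power
    of the characteristic exponent. It remains to remove the choice of a parameter, that is, the
    action of PGL2. A priori the generic level curve is only a conic. The Killing form of sl2 lives
    on the vector fields of the line and ignores the parameter; its isotropic vectors are the
    squares of linear forms, that is, the points of the line. A pole can therefore be found by
    solving a quadratic equation whose coefficients are already uniform. Two lines could give only
    proportional fields, three never do. All formulas are arranged so as to survive characteristic
    2, where the form degenerates to a product of linear forms. In the converse the exponent [q] is
    harmless because [k] is perfect. *)

Section TermSubstitution.
Variable k : fieldType.
Implicit Types (t : GRing.term k) (f : GRing.formula k) (e : seq k).

Fixpoint term_subst (s : nat -> GRing.term k) t : GRing.term k :=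
  match t with
  | GRing.Var i => s i
  | GRing.Const x => GRing.Const x
  | GRing.NatConst n => GRing.NatConst _ n
  | GRing.Add t1 t2 => GRing.Add (term_subst s t1) (term_subst s t2)
  | GRing.Opp t1 => GRing.Opp (term_subst s t1)
  | GRing.NatMul t1 n => GRing.NatMul (term_subst s t1) n
  | GRing.Mul t1 t2 => GRing.Mul (term_subst s t1) (term_subst s t2)
  | GRing.Inv t1 => GRing.Inv (term_subst s t1)
  | GRing.Exp t1 n => GRing.Exp (term_subst s t1) n
  end.

Lemma eval_term_subst s e e' t :
  (forall i, nth 0 e' i = GRing.eval e (s i)) ->
  GRing.eval e (term_subst s t) = GRing.eval e' t.
Proof. by move=> H; elim: t => //= [t1 -> t2 ->|t1 ->|t1 -> n|t1 -> t2 ->|t1 ->|t1 -> n]. Qed.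

Lemma holds_exists_iota d n e f : size e = d ->
  (GRing.holds e (foldr (@GRing.Exists k) f (iota d n)) <->
   exists2 v, size v = n & GRing.holds (e ++ v) f).
Proof.
elim: n d e => [|n IH] d e se /=.
  split=> [h|[v /size0nil ->]]; last by rewrite cats0.
  by exists [::]; rewrite ?cats0.
have setE x : set_nth 0 e d x = rcons e x.
  by rewrite -se -cats1; elim: (e) => //= a l ->.
split=> [[x]|[[|x v] //= [sv] h]].
  rewrite setE IH ?size_rcons ?se // => -[v sv h].
  by exists (x :: v); rewrite /= ?sv // -cat_rcons.
exists x; rewrite setE; apply/IH; first by rewrite size_rcons se.
by exists v => //; rewrite cat_rcons.
Qed.

End TermSubstitution.

(** Parameters of every shape are coded as vectors over [k]; by [enc_surj] a quantifier over [T] is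
    a block of [cdim] first-order quantifiers. *)
Class Ctx (k : fieldType) (T : Type) := {
  cdim : nat;
  enc : T -> seq k;
  size_enc : forall g, size (enc g) = cdim;
  enc_surj : forall s, size s = cdim -> exists g, enc g = s }.

Section Definability.
Variable k : closedFieldType.

#[export] Instance ctx_scalar : Ctx k k.
Proof.
exists 1%N (fun x : k => [:: x]) => // -[|x [|]] // _; by exists x.
Defined.

#[export] Instance ctx_prod (T U : Type) `{Ctx k T} `{Ctx k U} : Ctx k (T * U).
Proof.
exists (cdim (T := T) + cdim (T := U))%N (fun g => enc g.1 ++ enc g.2).
  by move=> g; rewrite size_cat !size_enc.
move=> s ss; have [|g hg] := @enc_surj k T _ (take (cdim (T := T)) s).
  by rewrite size_takel // ss leq_addr.
have [|u hu] := @enc_surj k U _ (drop (cdim (T := T)) s).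
  by rewrite size_drop ss addKn.
by exists (g, u); rewrite /= hg hu cat_take_drop.
Defined.

#[export] Instance ctx_ffun (I : finType) : Ctx k {ffun I -> k}.
Proof.
exists #|I| (fun g : {ffun I -> k} => fgraph g) => [g|s ss]; first exact: size_tuple.
by exists (Finfun (Tuple (introT eqP ss))); rewrite FinfunK.
Defined.

(** Inversion is a term operation with [0^-1 = 0], so rational expressions qualify without side
    conditions. *)
Definition cfun {T U} `{Ctx k T} `{Ctx k U} (phi : T -> U) :=
  exists s : nat -> GRing.term k, forall g i,
    nth 0 (enc (phi g)) i = GRing.eval (enc g) (s i).

Definition definable {T} `{Ctx k T} (P : T -> Prop) :=
  exists f : GRing.formula k, forall g, P g <-> GRing.holds (enc g) f.

Section Closure.
Context {T U V : Type} `{Ctx k T} `{Ctx k U} `{Ctx k V}.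

Lemma cfun_comp (psi : U -> V) (phi : T -> U) :
  cfun psi -> cfun phi -> cfun (fun g => psi (phi g)).
Proof.
move=> [s hs] [r hr]; exists (fun i => term_subst r (s i)) => g i.
by rewrite hs (@eval_term_subst _ r _ (enc (phi g))).
Qed.

Lemma cfun_id : cfun (fun g : T => g).
Proof. by exists (fun i => GRing.Var k i). Qed.

Lemma cfun_fst : cfun (@fst T U).
Proof.
exists (fun i => if (i < cdim (T := T))%N then GRing.Var k i else GRing.Const 0).
move=> g i; case: ifP => hi /=; first by rewrite nth_cat size_enc hi.
by rewrite nth_default // size_enc leqNgt hi.
Qed.

Lemma cfun_snd : cfun (@snd T U).
Proof.
exists (fun i => GRing.Var k (cdim (T := T) + i)) => g i /=.
by rewrite nth_cat size_enc ltnNge leq_addr addKn.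
Qed.

Lemma cfun_pair (phi : T -> U) (psi : T -> V) :
  cfun phi -> cfun psi -> cfun (fun g => (phi g, psi g)).
Proof.
move=> [s hs] [r hr].
exists (fun i => if (i < cdim (T := U))%N then s i else r (i - cdim (T := U))%N).
by move=> g i; rewrite /= nth_cat size_enc; case: ifP => _; rewrite ?hs ?hr.
Qed.

Lemma cfun_cst (u : U) : cfun (fun _ : T => u).
Proof. by exists (fun i => GRing.Const (nth 0 (enc u) i)). Qed.

Lemma definable_exists (P : T -> U -> Prop) :
  definable (fun gu : T * U => P gu.1 gu.2) -> definable (fun g => exists u, P g u).
Proof.
move=> [f hf].
exists (foldr (@GRing.Exists k) f (iota (cdim (T := T)) (cdim (T := U)))) => g.
rewrite holds_exists_iota ?size_enc //; split=> [[u /(hf (g, u)) h]|[v sv h]].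
  by exists (enc u); rewrite ?size_enc.
by have [u hu] := enc_surj sv; exists u; apply/(hf (g, u)); rewrite /= hu.
Qed.

Lemma definable_iff (P Q : T -> Prop) :
  (forall g, P g <-> Q g) -> definable P -> definable Q.
Proof. by move=> h [f hf]; exists f => g; rewrite -h hf. Qed.

Lemma definable_and (P Q : T -> Prop) :
  definable P -> definable Q -> definable (fun g => P g /\ Q g).
Proof.
by move=> [f hf] [f' hf']; exists (GRing.And f f') => g; rewrite hf hf'.
Qed.

Lemma definable_imp (P Q : T -> Prop) :
  definable P -> definable Q -> definable (fun g => P g -> Q g).
Proof.
by move=> [f hf] [f' hf']; exists (GRing.Implies f f') => g; rewrite hf hf'.
Qed.

Lemma definable_not (P : T -> Prop) : definable P -> definable (fun g => ~ P g).
Proof. by move=> [f hf]; exists (GRing.Not f) => g; rewrite hf. Qed.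

Lemma definable_const (P : Prop) : definable (fun _ : T => P).
Proof.
by case: (classic P) => h; [exists (GRing.Bool true)|exists (GRing.Bool false)]; split.
Qed.

Lemma definable_iff_fun (P Q : T -> Prop) :
  definable P -> definable Q -> definable (fun g => P g <-> Q g).
Proof. by move=> hP hQ; apply: definable_and; apply: definable_imp. Qed.

End Closure.

Section ScalarClosure.
Context {T : Type} `{Ctx k T}.
Implicit Types f g : T -> k.

Lemma cfun_term (t : GRing.term k) : cfun (fun x : T => GRing.eval (enc x) t).
Proof.
by exists (fun i => if i is 0%N then t else GRing.Const 0) => x [|i] //=; rewrite nth_nil.
Qed.

Lemma cfun_termP f : cfun f -> exists t, forall x, f x = GRing.eval (enc x) t.
Proof. by move=> [s hs]; exists (s 0%N) => x; rewrite -(hs x 0%N). Qed.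

Lemma cfun_of_term f t : (forall x, f x = GRing.eval (enc x) t) -> cfun f.
Proof.
by move=> h; have [s hs] := cfun_term t; exists s => x i; rewrite h hs.
Qed.

Lemma cfunD f g : cfun f -> cfun g -> cfun (fun x => f x + g x).
Proof.
move=> /cfun_termP[t ht] /cfun_termP[u hu].
by apply: (@cfun_of_term _ (GRing.Add t u)) => x; rewrite ht hu.
Qed.

Lemma cfunM f g : cfun f -> cfun g -> cfun (fun x => f x * g x).
Proof.
move=> /cfun_termP[t ht] /cfun_termP[u hu].
by apply: (@cfun_of_term _ (GRing.Mul t u)) => x; rewrite ht hu.
Qed.

Lemma cfunN f : cfun f -> cfun (fun x => - f x).
Proof. by move=> /cfun_termP[t ht]; apply: (@cfun_of_term _ (GRing.Opp t)) => x; rewrite ht. Qed.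

Lemma cfunV f : cfun f -> cfun (fun x => (f x)^-1).
Proof. by move=> /cfun_termP[t ht]; apply: (@cfun_of_term _ (GRing.Inv t)) => x; rewrite ht. Qed.

Lemma cfunX f n : cfun f -> cfun (fun x => f x ^+ n).
Proof. by move=> /cfun_termP[t ht]; apply: (@cfun_of_term _ (GRing.Exp t n)) => x; rewrite ht. Qed.

Lemma cfun_sum (I : Type) (r : seq I) (F : I -> T -> k) :
  (forall i, cfun (F i)) -> cfun (fun x => \sum_(i <- r) F i x).
Proof.
move=> hF; elim: r => [|a r IH].
  by apply: (@cfun_of_term _ (GRing.Const 0)) => x; rewrite big_nil.
have [t ht] := cfun_termP (cfunD (hF a) IH).
by apply: (@cfun_of_term _ t) => x; rewrite big_cons -ht.
Qed.

Lemma cfun_horner (p : {poly k}) f : cfun f -> cfun (fun x => p.[f x]).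
Proof.
move=> hf; have hs : cfun (fun x => \sum_(i < size p) p`_i * f x ^+ i).
  by apply: cfun_sum => i; apply: cfunM; [exact: cfun_cst|exact: cfunX].
by have [t ht] := cfun_termP hs; apply: (@cfun_of_term _ t) => x; rewrite horner_coef ht.
Qed.

Lemma definable_eq f g : cfun f -> cfun g -> definable (fun x => f x = g x).
Proof.
by move=> /cfun_termP[t ht] /cfun_termP[u hu]; exists (GRing.Equal t u) => x; rewrite ht hu.
Qed.

Lemma definable_neq f g : cfun f -> cfun g -> definable (fun x => f x != g x).
Proof.
move=> hf hg; apply: (definable_iff _ (definable_not (definable_eq hf hg))) => x.
by split=> /eqP.
Qed.

End ScalarClosure.

Lemma definable_forall {T U} `{Ctx k T} `{Ctx k U} (P : T -> U -> Prop) :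
  definable (fun gu : T * U => P gu.1 gu.2) -> definable (fun g => forall u, P g u).
Proof.
move=> hP; have hE := definable_exists (P := fun g u => ~ P g u) (definable_not hP).
apply: (definable_iff _ (definable_not hE)) => g; split=> [h u|h [u]]; last by apply; apply: h.
by case: (classic (P g u)) => [//|nP]; case: h; exists u.
Qed.

Lemma definable_forall_fin {T} `{Ctx k T} (I : finType) (P : I -> T -> Prop) :
  (forall i, definable (P i)) -> definable (fun g => forall i, P i g).
Proof.
move=> hP; suff h (r : seq I) : definable (H := H) (fun g => forall i, i \in r -> P i g).
  have X := h (enum I); refine (definable_iff _ X) => g.
  by split=> hg i; [apply: hg; rewrite mem_enum|].
elim: r => [|a r IH]; first by apply: (definable_iff _ (definable_const True)) => g; split.
apply: (definable_iff _ (definable_and (hP a) IH)) => g; split=> [[h1 h2] i|h].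
  by rewrite inE => /orP[/eqP -> //|/h2].
by split=> [|i ir]; apply: h; rewrite inE ?eqxx ?ir ?orbT.
Qed.

Lemma definable_exists_fin {T} `{Ctx k T} (I : finType) (P : I -> T -> Prop) :
  (forall i, definable (P i)) -> definable (fun g => exists i, P i g).
Proof.
move=> hP.
have hn := definable_forall_fin (fun i => definable_not (hP i)).
apply: (definable_iff _ (definable_not hn)) => g.
split=> [h|[i Pi] /(_ i)//].
by case: (classic (exists i, P i g)) => [//|nP]; case: h => i Pi; case: nP; exists i.
Qed.

Lemma cfun_ffun (I : finType) (i : I) : cfun (fun v : {ffun I -> k} => v i).
Proof.
refine (@cfun_of_term _ _ _ (GRing.Var k (enum_rank i)) _) => v /=.
have := tnth_fgraph v (enum_rank i); rewrite enum_rankK => <-.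
by rewrite (tnth_nth 0).
Qed.

End Definability.

(** Besides quantifiers, inverses are removed by [to_rform], so the atoms of the result are
    polynomial equations and can be read in a coordinate ring. *)
Lemma closed_field_QE (k : closedFieldType) (f : GRing.formula k) :
  exists2 f' : GRing.formula k, GRing.qf_form f' && GRing.rformula f' &
  forall e, GRing.holds e f <-> GRing.qf_eval e f'.
Proof.
have kcl := @solve_monicpoly k.
exists (GRing.quantifier_elim (@ClosedFieldQE.ex_elim k) (GRing.to_rform f)).
  apply: GRing.quantifier_elim_wf; last exact: GRing.to_rform_rformula.
  exact: ClosedFieldQE.wf_ex_elim.
move=> e; rewrite -GRing.to_rformP; split.
  by move/(GRing.quantifier_elim_rformP (@ClosedFieldQE.wf_ex_elim _)
    (ClosedFieldQE.holds_ex_elim kcl) e (GRing.to_rform_rformula f)).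
by move/(GRing.quantifier_elim_rformP (@ClosedFieldQE.wf_ex_elim _)
    (ClosedFieldQE.holds_ex_elim kcl) e (GRing.to_rform_rformula f)).
Qed.

(** * Coordinate rings and properties that hold on a nonempty open set *)

Record coord_ring (k : closedFieldType) (T : Type) {H : Ctx k T} := CoordRing {
  cring :> idomainType;
  cev : T -> {rmorphism cring -> k};
  cvar : nat -> cring;
  cconst : k -> cring;
  cev_var : forall g i, cev g (cvar i) = nth 0 (enc g) i;
  cev_const : forall g c, cev g (cconst c) = c;
  cev_inf : forall r : cring, r != 0 -> exists g, cev g r != 0;
  cev_cfun : forall r : cring, cfun (fun g => cev g r) }.

Section Generic.
Context (k : closedFieldType) (T : Type) {H : Ctx k T} (R : @coord_ring k T H).

(** [P] contains a principal open set. Such sets are nonempty by [cev_inf], and any two of them meet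
    because the ring is a domain. *)
Definition generic (P : T -> Prop) :=
  exists2 r : R, r != 0 & forall g, cev R g r != 0 -> P g.

Lemma generic_sub (P Q : T -> Prop) : (forall g, P g -> Q g) -> generic P -> generic Q.
Proof. by move=> PQ [r r0 hr]; exists r => // g /hr /PQ. Qed.

Lemma generic_and (P Q : T -> Prop) : generic P -> generic Q -> generic (fun g => P g /\ Q g).
Proof.
move=> [r r0 hr] [s s0 hs]; exists (r * s); first by rewrite mulf_neq0.
by move=> g; rewrite rmorphM mulf_eq0 negb_or => /andP[/hr ? /hs ?].
Qed.

Lemma generic_all (P : T -> Prop) : (forall g, P g) -> generic P.
Proof. by move=> hP; exists 1 => //; exact: oner_neq0. Qed.

Lemma generic_neq0 (r : R) : r != 0 -> generic (fun g => cev R g r != 0).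
Proof. by exists r. Qed.

Lemma generic_ex (P : T -> Prop) : generic P -> exists g, P g.
Proof. by move=> [r /cev_inf[g hg] hr]; exists g; apply: hr. Qed.

Lemma generic_absurd (P : T -> Prop) : generic P -> ~ generic (fun g => ~ P g).
Proof. by move=> hP hnP; have [g []] := generic_ex (generic_and hP hnP). Qed.

Fixpoint term_cring (t : GRing.term k) : R :=
  match t with
  | GRing.Var i => cvar R i
  | GRing.Const x => cconst R x
  | GRing.NatConst n => n%:R
  | GRing.Add t1 t2 => term_cring t1 + term_cring t2
  | GRing.Opp t1 => - term_cring t1
  | GRing.NatMul t1 n => term_cring t1 *+ n
  | GRing.Mul t1 t2 => term_cring t1 * term_cring t2
  | GRing.Inv t1 => 0
  | GRing.Exp t1 n => term_cring t1 ^+ n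
  end.

Lemma cev_term_cring g t : GRing.rterm t -> cev R g (term_cring t) = GRing.eval (enc g) t.
Proof.
elim: t => //= [i|c|n|t1 IH1 t2 IH2|t IH|t IH n|t1 IH1 t2 IH2|t IH n].
- by rewrite cev_var.
- by rewrite cev_const.
- by rewrite rmorph_nat.
- by move=> /andP[/IH1 h1 /IH2 h2]; rewrite rmorphD h1 h2.
- by move=> /IH h; rewrite rmorphN h.
- by move=> /IH h; rewrite rmorphMn h.
- by move=> /andP[/IH1 h1 /IH2 h2]; rewrite rmorphM h1 h2.
by move=> /IH h; rewrite rmorphXn h.
Qed.

(* The truth value of a quantifier-free formula is eventually constant along any
   notion of largeness [L] deciding the vanishing of each function. *)
Lemma qf_eval_decided (L : (T -> Prop) -> Prop) (f : GRing.formula k) :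
  (forall P Q, L P -> L Q -> L (fun g => P g /\ Q g)) ->
  (forall P Q : T -> Prop, (forall g, P g -> Q g) -> L P -> L Q) ->
  (forall r : R, L (fun g => cev R g r = 0) \/ L (fun g => cev R g r <> 0)) ->
  GRing.qf_form f && GRing.rformula f ->
  L (fun g => GRing.qf_eval (enc g) f) \/ L (fun g => ~ GRing.qf_eval (enc g) f).
Proof.
move=> Land Lsub Ldec.
have LT : L (fun=> True) by case: (Ldec 0); apply: Lsub.
elim: f => //=.
- by case=> _; [left|right]; apply: Lsub LT.
- move=> t1 t2 /andP[r1 r2].
  case: (Ldec (term_cring t1 - term_cring t2)) => h; [left|right]; apply: Lsub h => g;
    rewrite rmorphB !cev_term_cring //; last by move=> + /eqP E; rewrite E subrr.
  by move/eqP; rewrite subr_eq0.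
- move=> f1 IH1 f2 IH2; rewrite andbACA => /andP[/IH1 h1 /IH2 h2].
  case: h1 => h1; last by right; apply: Lsub h1 => g h /andP[].
  case: h2 => h2; last by right; apply: Lsub h2 => g h /andP[].
  by left; apply: Lsub (Land _ _ h1 h2) => g /andP.
- move=> f1 IH1 f2 IH2; rewrite andbACA => /andP[/IH1 h1 /IH2 h2].
  case: h1 => h1; first by left; apply: Lsub h1 => g ->.
  case: h2 => h2; first by left; apply: Lsub h2 => g ->; rewrite orbT.
  by right; apply: Lsub (Land _ _ h1 h2) => g [a b] /orP[].
- move=> f1 IH1 f2 IH2; rewrite andbACA => /andP[/IH1 h1 /IH2 h2].
  case: h2 => h2; first by left; apply: Lsub h2 => g ->; rewrite implybT.
  case: h1 => h1; last by left; apply: Lsub h1 => g /negP/negbTE ->.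
  by right; apply: Lsub (Land _ _ h1 h2) => g [a b] /implyP /(_ a).
move=> f IH /IH [h|h]; [right|left]; apply: Lsub h => g; first by move=> ->.
by move/negP.
Qed.

Lemma definable_qf (P : T -> Prop) : definable P ->
  exists2 f, GRing.qf_form f && GRing.rformula f &
    forall g, P g <-> GRing.qf_eval (enc g) f.
Proof.
move=> [f hf]; have [f' wf hf'] := closed_field_QE f.
by exists f' => // g; rewrite hf hf'.
Qed.

(** Affine space is irreducible: a polynomial is zero or generically nonzero, so a quantifier-free
    condition is generically true or generically false. This dichotomy stands in for dimension
    theory. *)
Lemma generic_dec (P : T -> Prop) : definable P -> generic P \/ generic (fun g => ~ P g).
Proof.
move=> /definable_qf[f wf hf].
case: (@qf_eval_decided generic f); try exact: wf.
- exact: generic_and.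
- exact: generic_sub.
- move=> r; have [->|r0] := eqVneq r 0; first by left; apply: generic_all => g; rewrite rmorph0.
  by right; exists r => // g /eqP.
- by move=> h; left; apply: generic_sub h => g /hf.
by move=> h; right; apply: generic_sub h => g nP /hf.
Qed.

(** It makes a choice among finitely many indices independent of the parameter: if every index
    failed generically, all would fail together at some point. *)
Lemma generic_finite_cover (I : finType) (P : I -> T -> Prop) :
  (forall i, definable (P i)) -> generic (fun g => exists i, P i g) ->
  exists i, generic (P i).
Proof.
move=> dP hP; apply: NNPP => nP.
have: generic (fun g => forall i, i \in enum I -> ~ P i g).
  elim: (enum I) => [|a s IH]; first exact: generic_all.
  have [h|h] := generic_dec (dP a); first by case: nP; exists a.
  apply: generic_sub (generic_and h IH) => g [h1 h2] i.
  by rewrite inE => /orP[/eqP -> //|/h2].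
move=> hn; apply: (generic_absurd hP); apply: generic_sub hn => g h [i].
by apply: h; rewrite mem_enum.
Qed.

End Generic.

Section CoordRings.
Variable k : closedFieldType.

Lemma cfun_ext {T U} `{Ctx k T} `{Ctx k U} (f g : T -> U) :
  (forall x, f x = g x) -> cfun f -> cfun g.
Proof. by move=> fg [s hs]; exists s => x i; rewrite -fg hs. Qed.

Definition coord_base : @coord_ring k k (ctx_scalar k).
Proof.
refine (@CoordRing k k _ {poly k} (fun x => horner_eval x)
  (fun i => if i is 0%N then 'X else 0) polyC _ _ _ _).
- by move=> x [|i] /=; rewrite /horner_eval ?hornerX ?horner0 //= nth_nil.
- by move=> x c; rewrite /= /horner_eval hornerC.
- by move=> r /closed_nonrootP[x hx]; exists x.
- by move=> r; apply: cfun_horner; exact: cfun_id.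
Defined.

Context (T : Type) {H : Ctx k T} (R : @coord_ring k T H).

Definition coord_ext : @coord_ring k (T * k) (@ctx_prod k T k H (ctx_scalar k)).
Proof.
refine (@CoordRing k (T * k) _ {poly R} (fun ge => horner_eval ge.2 \o map_poly (cev R ge.1))
  (fun i => if (i < @cdim k T H)%N then (cvar R i)%:P
            else if i == @cdim k T H then 'X else 0)
  (fun c => (cconst R c)%:P) _ _ _ _).
- move=> [g e] i /=; rewrite /horner_eval nth_cat size_enc; case: ifP => hi.
    by rewrite map_polyC /= hornerC cev_var.
  case: eqP => [->|ne]; first by rewrite map_polyX hornerX subnn.
  rewrite rmorph0 horner0 nth_default //= subn_gt0 ltn_neqAle leqNgt hi andbT.
  by apply/eqP => E; case: ne.
- by move=> [g e] c; rewrite /= /horner_eval map_polyC /= hornerC cev_const.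
- move=> r r0; have [g hg] : exists g, cev R g (lead_coef r) != 0.
    by apply: cev_inf; rewrite lead_coef_eq0.
  have [|e he] := closed_nonrootP (map_poly (cev R g) r) _.
    by apply: contraNneq hg => E; rewrite /lead_coef -coef_map E coef0.
  by exists (g, e).
move=> r.
have hs : cfun (fun ge : T * k => \sum_(i < size r) cev R ge.1 r`_i * ge.2 ^+ i).
  apply: cfun_sum => i; apply: cfunM.
    refine (@cfun_comp k (T * k)%type T k _ _ _ (fun g => cev R g r`_i) fst _ _); [exact: cev_cfun|exact: cfun_fst].
  by apply: cfunX; exact: cfun_snd.
have [t ht] := cfun_termP hs; apply: (@cfun_of_term _ _ _ _ t) => ge.
rewrite -ht /= /horner_eval /= (@horner_coef_wide _ (size r)) ?size_poly //.
by apply: eq_bigr => i _; rewrite coef_map.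
Defined.

Lemma cev_extE g e (P : {poly R}) : cev coord_ext (g, e) P = (map_poly (cev R g) P).[e].
Proof. by []. Qed.

Lemma cev_extC g e r : cev coord_ext (g, e) r%:P = cev R g r.
Proof. by rewrite cev_extE map_polyC /= hornerC. Qed.

Lemma cev_extZ g e r (P : {poly R}) :
  cev coord_ext (g, e) (r *: P) = cev R g r * cev coord_ext (g, e) P.
Proof. by rewrite -mul_polyC rmorphM cev_extC. Qed.

Section UniqueRoot.

(** Frobenius gives [('X - e) ^ (q m) = ('X^q - e ^ q) ^ m]; the binomial term with a single factor
    [- e ^ q] is the only one in degree [q (m - 1)]. *)
Lemma coef_subXexp (e : k) (q m : nat) : (0 < m)%N -> [pchar k].-nat q ->
  (('X - e%:P) ^+ (q * m))`_(q * m.-1) = - e ^+ q *+ m.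
Proof.
move=> m0 qp; have q0 : (0 < q)%N by case/andP: qp.
have qp' : [pchar {poly k}].-nat q by rewrite (eq_pnat _ (pchar_poly k)).
have -> : ('X - e%:P) ^+ (q * m) = ('X^q + (- e ^+ q)%:P) ^+ m.
  by rewrite exprM exprDn_pchar // exprNn_pchar // polyCN polyC_exp.
rewrite exprDn coef_sum; have hm : (1 < m.+1)%N by rewrite ltnS.
rewrite (bigD1 (Ordinal hm)) //= big1 ?addr0 => [|i ne].
  by rewrite bin1 expr1 -exprM subn1 coefMn coefMC coefXn eqxx mul1r.
rewrite coefMn -exprM -polyC_exp coefMC coefXn eqn_pmul2l //.
have [E|] := eqVneq m.-1 (m - i)%N; last by rewrite mul0r mul0rn.
case/eqP: ne; apply: val_inj => /=; have := ltn_ord i; lia.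
Qed.

End UniqueRoot.

(* A relation [M] of minimal degree has no root but [e] for generic [g], so it is a
   multiple of [('X - e) ^ (q m)] with [m] invertible, and [e ^ q] is read off the
   coefficient of degree [q (m - 1)]. *)
Lemma generic_function (E : T -> k -> Prop) :
  definable (fun ge : T * k => E ge.1 ge.2) ->
  generic R (fun g => exists2 e, E g e & forall e', E g e' -> e' = e) ->
  exists q (a b : R), [/\ [pchar k].-nat q, b != 0 &
    generic R (fun g => forall e, E g e -> cev R g b * e ^+ q = cev R g a)].
Proof.
move=> dE uE; pose ev g e (P : {poly R}) := cev coord_ext (g, e) P.
pose vanish P := generic R (fun g => exists2 e, E g e & ev g e P = 0).
have vanishP P : vanish P -> generic R (fun g => forall e, E g e -> ev g e P = 0).
  move=> h; apply: generic_sub (generic_and uE h) => g [[e0 _ he0] [e Ee <-]] e' Ee'.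
  by rewrite (he0 _ Ee) (he0 _ Ee').
have dec P : vanish P \/ generic R (fun g => forall e, E g e -> ev g e P <> 0).
  have dP : definable (fun g => exists e, E g e /\ ev g e P = 0).
    apply: definable_exists; apply: definable_and => //.
    apply: definable_eq; last exact: cfun_cst.
    by refine (cfun_ext _ (@cev_cfun _ _ _ coord_ext P)) => -[].
  case: (generic_dec R dP) => h; [left|right]; apply: generic_sub h => g.
    by move=> [e []]; exists e.
  by move=> nP e Ee e0; apply: nP; exists e.
(* If [E] were generic in the product, a generic fibre would contain all but finitely many [e],
   against uniqueness. So the complement of [E] contains the open set of some [P], and this [P]
   vanishes on [E]. *)
have [H1 H10 vH1] : exists2 P : {poly R}, P != 0 & vanish P.
  case: (generic_dec coord_ext dE) => -[P P0 hP]; last first.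
    exists P => //; apply: generic_sub uE => g [e Ee _]; exists e => //.
    by apply/eqP/negPn/negP => /(hP (g, e)).
  have lP : lead_coef P != 0 by rewrite lead_coef_eq0.
  have [g [[e0 Ee0 ue0] gP]] := generic_ex (generic_and uE (generic_neq0 lP)).
  have Pg0 : map_poly (cev R g) P != 0.
    by apply: contraNneq gP => E0; rewrite /lead_coef -coef_map E0 coef0.
  have : map_poly (cev R g) P * ('X - e0%:P) != 0 by rewrite mulf_neq0 ?polyXsubC_eq0.
  move=> /closed_nonrootP[e]; rewrite /root hornerM hornerXsubC mulf_eq0 negb_or subr_eq0.
  by case/andP=> /(hP (g, e)) /= /ue0 ->; rewrite eqxx.
have [M [M0 vM minM]] : exists M : {poly R}, [/\ M != 0, vanish M &
    forall P, P != 0 -> vanish P -> (size M <= size P)%N].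
  have [n] := ubnP (size H1); elim: n H1 H10 vH1 => // n IH P P0 vP sP.
  case: (classic (exists Q : {poly R}, [/\ Q != 0, vanish Q & (size Q < size P)%N])).
    by move=> [Q [Q0 vQ sQ]]; apply: (IH Q) => //; apply: leq_trans sQ _; rewrite -ltnS.
  move=> nQ; exists P; split=> // Q Q0 vQ; rewrite leqNgt; apply/negP => sQ.
  by apply: nQ; exists Q.
have lM : lead_coef M != 0 by rewrite lead_coef_eq0.
(* Largeness now means truth at all roots of [M] over a generic [g]. It decides each function [r]:
   one vanishing on [E] is a multiple of [M] up to a scalar, any other is coprime to [M]. *)
have gM : generic R (fun g => forall e, ev g e M = 0 -> E g e).
  have [f wf hf] := definable_qf dE.
  pose L (P : T * k -> Prop) := generic R (fun g => forall e, ev g e M = 0 -> P (g, e)).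
  have Lsub (P Q : T * k -> Prop) : (forall ge, P ge -> Q ge) -> L P -> L Q.
    by move=> PQ; apply: generic_sub => g h e /h /PQ.
  case: (@qf_eval_decided k (T * k) _ coord_ext L f _ Lsub _ wf).
  - move=> P Q hP hQ; apply: generic_sub (generic_and hP hQ) => g [h1 h2] e he.
    by split; [exact: h1|exact: h2].
  - move=> r; case: (dec r) => vr; [left|right].
      have vrem : vanish (r %% M).
        apply: generic_sub (generic_and vM (vanishP _ vr)) => g [[e Ee eM] /(_ e Ee) er].
        exists e => //; have := congr1 (ev g e) (Pdiv.Idomain.divp_eq r M).
        rewrite {1}/ev cev_extZ -/(ev g e r) er mulr0 /ev rmorphD rmorphM.
        by rewrite -!/(ev g e _) eM mulr0 add0r.
      have rem0 : r %% M = 0.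
        apply/eqP/negPn/negP => rn0; have := minM _ rn0 vrem.
        by rewrite leqNgt ltn_modp M0.
      apply: generic_sub (generic_neq0 lM) => g gl e eM.
      have := congr1 (ev g e) (Pdiv.Idomain.divp_eq r M); rewrite rem0 addr0.
      rewrite /ev cev_extZ [X in _ = X]rmorphM -/(ev g e M) eM mulr0 => /eqP.
      by rewrite mulf_eq0 rmorphXn expf_eq0 (negbTE gl) andbF => /eqP.
    have r0 : r != 0.
      apply/eqP => r0; have [g [[e Ee _] /(_ e Ee)]] := generic_ex (generic_and uE vr).
      by rewrite /ev r0 rmorph0.
    (* A common factor yields [u r = v M] with [u] shorter than [M]. By minimality [u] is nonzero on
       [E], as is [r], although [M] vanishes there. *)
    have cop : coprimep r M.
      apply/negPn/negP => /(Bezout_coprimepPn r0 M0)[[u v]] /= /and3P[/andP[su sM] _ _] uv.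
      have u0 : u != 0 by rewrite -size_poly_gt0.
      case: (dec u) => vu; first by have := minM _ u0 vu; rewrite leqNgt sM.
      have [g [[[e Ee eM] hu] hr]] := generic_ex (generic_and (generic_and vM vu) vr).
      have := congr1 (ev g e) uv; rewrite /ev !rmorphM -!/(ev g e _) eM mulr0 => /eqP.
      by rewrite mulf_eq0 => /orP[] /eqP; [exact: hu|exact: hr].
    have [[u v] /=] := Bezout_coprimepP _ _ cop.
    rewrite -size_poly_eq1 => /size_poly1P[c c0 uv].
    apply: generic_sub (generic_neq0 c0) => g gc e eM er0.
    have := congr1 (ev g e) uv; have er : ev g e r = 0 by exact: er0.
    rewrite {1}/ev rmorphD !rmorphM -!/(ev g e _) eM er !mulr0 addr0.
    by rewrite /ev cev_extC => E0; rewrite -E0 eqxx in gc.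
  - by apply: generic_sub => g h e /h /(hf (g, e)).
  move=> h; have [g [[e Ee eM] /(_ e eM)]] := generic_ex (generic_and vM h).
  by case; apply/(hf (g, e)).
have sM : (1 < size M)%N.
  rewrite ltnNge; apply/negP => /size1_polyC ME.
  have M00 : M`_0 != 0 by move: lM; rewrite {1}ME lead_coefC.
  have [g [[e Ee]]] := generic_ex (generic_and vM (generic_neq0 M00)).
  have -> : ev g e M = cev R g M`_0 by rewrite {1}ME /ev cev_extC.
  by move=> -> /eqP.
pose d := (size M).-1; have d0 : (0 < d)%N by rewrite /d; case: (size M) sM => [|[]].
(* The degree splits into its [p]-part and its prime-to-[p] part; in characteristic 0 the first is
   1. *)
pose q := (d`_[pchar k])%N; pose m := (d`_([pchar k]^'))%N.
have dqm : d = (q * m)%N by rewrite partnC.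
have m0 : (0 < m)%N by rewrite part_gt0.
have mk : m%:R != 0 :> k by rewrite natf_neq0_pchar part_pnat.
exists q, (- M`_(q * m.-1)), (lead_coef M *+ m); split.
- exact: part_pnat.
- rewrite -mulr_natr mulf_neq0 //; apply: contraNneq mk => mR.
  have [g _] := cev_inf lM; have := congr1 (cev R g) mR.
  by rewrite rmorph_nat rmorph0 => ->.
have := generic_and (generic_and uE gM) (generic_neq0 lM).
apply: generic_sub => g [[[e0 Ee0 ue0] hM] gl] e Ee; rewrite (ue0 _ Ee) => {e Ee}.
pose h := map_poly (cev R g) M.
have sh : size h = size M by rewrite size_map_poly_id0.
have lh : lead_coef h = cev R g (lead_coef M) by rewrite lead_coef_map_eq.
have hE : h = lead_coef h *: ('X - e0%:P) ^+ d.
  have [s hs] := closed_field_poly_normal h; rewrite {1}hs.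
  have sn : s = nseq (size s) e0.
    apply/all_pred1P/allP => z zs /=; apply/eqP/ue0/hM; rewrite /ev cev_extE -/h.
    by apply/rootP; rewrite hs rootZ ?root_prod_XsubC // lh.
  have ss : size s = d.
    by rewrite /d -sh hs size_scale ?lh // size_prod_XsubC.
  congr (_ *: _); rewrite sn ss; elim: (d) => [|n IH]; first by rewrite big_nil.
  by rewrite big_cons IH exprS.
have := congr1 (fun P : {poly k} => P`_(q * m.-1)) hE.
rewrite /h coef_map /= -/h coefZ dqm coef_subXexp // ?part_pnat // => E1.
by rewrite rmorphN E1 rmorphMn lh mulNrn mulrN opprK mulrnAr mulrnAl.
Qed.

End CoordRings.

(** * Elimination by linear algebra *)

Section Fractions.
Variable R : idomainType.

Lemma fraction_numden (z : {fraction R}) :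
  exists n d, d != 0 /\ z = tofrac n / tofrac d.
Proof.
elim/quotW: z => x; exists (frac x).1, (frac x).2; have d0 := denom_ratioP x; split=> //.
have d0' : tofrac (frac x).2 != 0 by rewrite tofrac_eq0.
apply: (mulIf d0'); rewrite divfK //; rewrite /FracField.tofrac; unlock.
rewrite -[LHS]FracField.pi_mul; apply/eqmodP => /=.
rewrite FracField.equivfE /= /FracField.mulf !numden_Ratio ?oner_neq0 ?mulr1 //.
by rewrite mulrC.
Qed.

End Fractions.

Section LinearDependence.

Lemma lin_dep (K : fieldType) (I : finType) E (g : I -> 'rV[K]_E) : (E < #|I|)%N ->
  exists2 v : I -> K, (exists i, v i != 0) & \sum_i v i *: g i = 0.
Proof.
move=> EI; pose M := \matrix_(i < #|I|) g (enum_val i).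
have : kermx M != 0.
  by rewrite kermx_eq0 /row_free neq_ltn (leq_ltn_trans (rank_leq_col M)).
case/rowV0Pn => v /sub_kermxP vM v0; exists (fun i => v 0 (enum_rank i)).
  apply: NNPP => nv; case/eqP: v0; apply/rowP => j; rewrite mxE.
  apply/eqP/negPn/negP => vj; apply: nv; exists (enum_val j); by rewrite enum_valK.
rewrite -[RHS]vM mulmx_sum_row (reindex _ (onW_bij _ (enum_val_bij I))) /=.
by apply: eq_bigr => i _; rewrite rowK enum_valK.
Qed.

Lemma poly_lin_dep (K : fieldType) (I : finType) E (g : I -> {poly K}) :
  (forall i, (size (g i) <= E)%N) -> (E < #|I|)%N ->
  exists2 v : I -> K, (exists i, v i != 0) & \sum_i v i *: g i = 0.
Proof.
move=> sg EI; have [v v0 hv] := lin_dep (fun i => poly_rV (g i)) EI; exists v => //.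
rewrite -[LHS](@poly_rV_K _ E); last first.
  apply: (leq_trans (size_sum _ _ _)); apply/bigmax_leqP => i _.
  exact: leq_trans (size_scale_leq _ _) (sg i).
by rewrite linear_sum /= (eq_bigr _ (fun i _ => linearZ_LR _ _ _)) hv linear0.
Qed.

Local Notation fr := (@FracField.tofrac _).

Lemma idomain_lin_dep (D : idomainType) (I : finType) E (g : I -> {poly D}) :
  (forall i, (size (g i) <= E)%N) -> (E < #|I|)%N ->
  exists2 v : I -> D, (exists i, v i != 0) & \sum_i v i *: g i = 0.
Proof.
move=> sg EI.
have [|w [i0 w0] hw] := @poly_lin_dep _ I E (fun i => map_poly fr (g i)) _ EI.
  by move=> i; apply: leq_trans (size_poly _ _) (sg i).
have /fin_all_exists[n /fin_all_exists[d nd]] := fun i => fraction_numden (w i).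
have d0 i : d i != 0 by case: (nd i).
have wE i : w i = fr (n i) / fr (d i) by case: (nd i).
pose v i := n i * \prod_(j | j != i) d j.
have vE i : fr (v i) = fr (\prod_j d j) * w i.
  rewrite wE /v [in RHS](bigD1 i) //= !rmorphM /=.
  have fd0 : fr (d i) != 0 by rewrite tofrac_eq0.
  by rewrite [RHS]mulrA mulrAC [fr (d i) * _ / _]mulrAC divff // mul1r mulrC.
exists v; first exists i0.
  rewrite -(tofrac_eq0 (v i0)) [X in X != 0]vE mulf_neq0 // tofrac_eq0.
  by apply/prodf_neq0.
have inj : injective (@FracField.tofrac D) by move=> x y /eqP; rewrite tofrac_eq => /eqP.
apply: (map_inj_poly inj); first exact: rmorph0.
rewrite rmorph0 rmorph_sum /=.
transitivity (fr (\prod_j d j) *: \sum_i w i *: map_poly fr (g i)); last by rewrite hw scaler0.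
rewrite scaler_sumr; apply: eq_bigr => i _; by rewrite map_polyZ /= vE scalerA.
Qed.


(** Remainders modulo [f] have degree less than [n], so [n + 1] of them are dependent over [D]; the
    powers of the leading coefficient created by pseudo-division are absorbed into the [b i]. This
    plays the part of a resultant in the eliminations below. *)
Lemma dep_mod (D : idomainType) (f : {poly D}) n (Z : 'I_n.+1 -> {poly D}) :
  f != 0 -> (size f <= n.+1)%N ->
  exists2 b : 'I_n.+1 -> D, (exists i, b i != 0) & exists W, \sum_i b i *: Z i = W * f.
Proof.
move=> f0 sf.
have [i||v [i0 vi0] hv] := @idomain_lin_dep D 'I_n.+1 n (fun i => Z i %% f).
- by rewrite -ltnS; apply: leq_trans sf; rewrite ltn_modp.
- by rewrite card_ord.
exists (fun i => v i * lead_coef f ^+ scalp (Z i) f).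
  by exists i0; rewrite mulf_neq0 // expf_neq0 // lead_coef_eq0.
exists (\sum_i v i *: (Z i %/ f)); rewrite mulr_suml.
set S := LHS; rewrite -[LHS]subr0.
have -> : S - 0 = S - \sum_i v i *: (Z i %% f) by rewrite hv.
rewrite /S -sumrB; apply: eq_bigr => i _.
by rewrite -scalerA Pdiv.Idomain.divp_eq scalerDr addrK scalerAl.
Qed.

End LinearDependence.

Section HomogeneousForms.
Variables (k : closedFieldType).
Implicit Types p q : {poly k}.

(* [hom1 iota p e u v] is [v ^+ e * p (u / v)], for [size p <= e.+1]. *)
Definition hom1 (L : comNzRingType) (iota : k -> L) p e (u v : L) : L :=
  \sum_(i < e.+1) iota p`_i * u ^+ i * v ^+ (e - i).

Lemma hom1_morph (L M : comNzRingType) (iota : k -> L) (kappa : k -> M)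
  (phi : {rmorphism L -> M}) p e u v : phi \o iota =1 kappa ->
  phi (hom1 iota p e u v) = hom1 kappa p e (phi u) (phi v).
Proof.
by move=> h; rewrite rmorph_sum; apply: eq_bigr => i _; rewrite !rmorphM !rmorphXn -h.
Qed.

Lemma hom1_scale (L : comNzRingType) (iota : k -> L) p e (u v c : L) :
  hom1 iota p e (c * u) (c * v) = c ^+ e * hom1 iota p e u v.
Proof.
rewrite /hom1 mulr_sumr; apply: eq_bigr => i _.
have -> : c ^+ e = c ^+ i * c ^+ (e - i) by rewrite -exprD subnKC // -ltnS.
by rewrite !exprMn; ring.
Qed.

Lemma hom1_1 (L : comNzRingType) (iota : {rmorphism k -> L}) p e u :
  (size p <= e.+1)%N -> hom1 iota p e u 1 = (map_poly iota p).[u].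
Proof.
move=> sp; rewrite (@horner_coef_wide _ e.+1); last by apply: leq_trans sp; exact: size_poly.
by apply: eq_bigr => i _; rewrite expr1n mulr1 coef_map.
Qed.

Lemma hom1_frac (L : fieldType) (iota : {rmorphism k -> L}) p e u v :
  (size p <= e.+1)%N -> v != 0 ->
  hom1 iota p e u v = v ^+ e * (map_poly iota p).[u / v].
Proof.
by move=> sp v0; rewrite -(hom1_1 _ _ sp) -hom1_scale mulr1 mulrC divfK.
Qed.

(** Modulo [a - xi *: c] the fraction [a / c] becomes the constant [xi]. *)
Lemma hom1_mod p e (a c : {poly k}) (xi : k) :
  (size p <= e.+1)%N -> (a - xi *: c) %| (hom1 polyC p e a c - p.[xi] *: c ^+ e).
Proof.
move=> sp; rewrite (horner_coef_wide xi sp) scaler_suml -sumrB.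
apply: (big_ind (fun z => _ %| z)) => [|x y|i _]; [exact: dvdp0|exact: dvdp_add|].
have -> : (p`_i * xi ^+ i) *: c ^+ e = (p`_i)%:P * (xi *: c) ^+ i * c ^+ (e - i).
  rewrite exprZn -!mul_polyC polyCM.
  have -> : c ^+ e = c ^+ i * c ^+ (e - i) by rewrite -exprD subnKC // -ltnS.
  by ring.
rewrite -mulrBl -mulrBr; apply: dvdp_mulr; apply: dvdp_mull.
by rewrite subrXX dvdp_mulr.
Qed.

(* If [a / c] is in lowest terms, [1, t, ..., t^(d-1)] are independent over
   [k(a / c)], where [d] is the degree of the map [a / c]. *)
Lemma powers_indep (a c : {poly k}) m e (b : 'I_m -> {poly k}) :
  coprimep a c -> (exists i, b i != 0) -> (forall i, (size (b i) <= e.+1)%N) ->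
  \sum_i hom1 polyC (b i) e a c * 'X^i = 0 ->
  (size a <= m)%N /\ (size c <= m)%N.
Proof.
move=> cop [i0 bi0] sb hS; apply/andP; rewrite -geq_max leqNgt; apply/negP => sm.
pose d := (maxn (size a) (size c)).-1.
have lead0 : (a`_d)%:P - c`_d *: 'X != 0.
  apply/eqP => E; have := congr1 (fun r : {poly k} => r`_1) E.
  rewrite coefB coefC coefZ coefX /= mulr1 sub0r coef0 => /eqP; rewrite oppr_eq0 => /eqP cd.
  have := congr1 (fun r : {poly k} => r`_0) E.
  rewrite coefB coefC coefZ coefX /= mulr0 subr0 coef0 => ad; rewrite /d in cd ad.
  have [ac|ac] := leqP (size a) (size c).
    move: cd; rewrite (maxn_idPr ac) => /eqP; rewrite -/(lead_coef c) lead_coef_eq0.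
    by move/eqP => c0; move: sm; rewrite (maxn_idPr ac) c0 size_poly0.
  move: ad; rewrite (maxn_idPl (ltnW ac)) => /eqP; rewrite -/(lead_coef a) lead_coef_eq0.
  by move/eqP => a0; rewrite a0 size_poly0 in ac.
(* At this [xi] the coefficient [b i0] survives and [a - xi *: c] keeps the full degree [d]. Modulo
   it the relation gets constant coefficients, and its degree is too small for a nonzero
   multiple. *)
have /closed_nonrootP[xi] : b i0 * ((a`_d)%:P - c`_d *: 'X) != 0 by rewrite mulf_neq0.
rewrite /root hornerM mulf_eq0 negb_or => /andP[bxi].
rewrite hornerD hornerN hornerZ hornerC hornerX => dxi.
pose f := a - xi *: c; pose s := \sum_i (b i).[xi] *: 'X^i : {poly k}.
have sf : (m < size f)%N.
  have dS : maxn (size a) (size c) = d.+1 by rewrite /d prednK // (leq_trans _ sm).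
  rewrite dS ltnS in sm; apply: (leq_ltn_trans sm).
  rewrite ltnNge; apply/negP => /leq_sizeP /(_ d (leqnn d)).
  by rewrite coefB coefZ mulrC => /eqP; rewrite (negbTE dxi).
have fc : coprimep f (c ^+ e).
  apply: coprimep_expr; rewrite /f coprimep_sym -[a - _]addrC -mul_polyC -mulNr.
  by rewrite coprimep_addl_mul coprimep_sym.
have fs : f %| s * c ^+ e.
  have -> : s * c ^+ e = - \sum_i (hom1 polyC (b i) e a c - (b i).[xi] *: c ^+ e) * 'X^i.
    rewrite -[LHS]subr0 -[in LHS]hS mulr_suml -sumrB -sumrN; apply: eq_bigr => i _.
    by rewrite mulrBl opprB -scalerAl -scalerAl mulrC.
  rewrite dvdpNr; apply: (big_ind (fun z => f %| z)) => [|x y|i _]; [exact: dvdp0|exact: dvdp_add|].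
  exact/dvdp_mulr/hom1_mod.
rewrite Gauss_dvdpl // in fs.
have s0 : s = 0.
  apply/eqP/negPn/negP => s0; have := dvdp_leq s0 fs; rewrite leqNgt (leq_ltn_trans _ sf) //.
  apply: (leq_trans (size_sum _ _ _)); apply/bigmax_leqP => i _.
  by apply: leq_trans (size_scale_leq _ _) _; rewrite size_polyXn.
have := congr1 (fun r : {poly k} => r`_i0) s0; rewrite coef0 coef_sum (bigD1 i0) //=.
rewrite big1 ?addr0; last first.
  by move=> i ne; rewrite coefZ coefXn -[_ == _]/(i0 == i) eq_sym (negbTE ne) mulr0.
by rewrite coefZ coefXn eqxx mulr1 => E; rewrite E eqxx in bxi.
Qed.

End HomogeneousForms.

Section Evaluation.
Variable k : closedFieldType.

Definition evm_def (L : comNzRingType) (iota : {rmorphism k -> L}) (x y : L) :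
  {rmorphism poly2 k -> L} := horner_eval y \o map_poly (horner_eval x \o map_poly iota).
Fact evm_key : unit. Proof. exact: tt. Qed.
Definition evm (L : comNzRingType) (iota : {rmorphism k -> L}) (x y : L) :
  {rmorphism poly2 k -> L} := locked_with evm_key (evm_def iota x y).

Definition evm_inner (L : comNzRingType) (iota : {rmorphism k -> L}) (x : L) :
  {rmorphism {poly k} -> L} := horner_eval x \o map_poly iota.

Lemma evmE (L : comNzRingType) (iota : {rmorphism k -> L}) x y P :
  evm iota x y P = (map_poly (evm_inner iota x) P).[y].
Proof. by rewrite /evm locked_withE. Qed.

Lemma eval2E (L : comNzRingType) (iota : {rmorphism k -> L}) P x y :
  eval2 iota P x y = evm iota x y P.
Proof. by rewrite evmE. Qed.

Section Morphism.
Variables (L : comNzRingType) (iota : {rmorphism k -> L}).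
Implicit Types (x y : L) (P : poly2 k).

Lemma evm_polyC x y q : evm iota x y q%:P = (map_poly iota q).[x].
Proof. by rewrite evmE map_polyC /= hornerC. Qed.

Lemma evmC x y c : evm iota x y c%:P%:P = iota c.
Proof. by rewrite evm_polyC map_polyC /= hornerC. Qed.

Lemma evmX x y : evm iota x y ('X%:P) = x.
Proof. by rewrite evm_polyC map_polyX hornerX. Qed.

Lemma evmY x y : evm iota x y 'X = y.
Proof. by rewrite evmE map_polyX hornerX. Qed.

Lemma evm_sum x y P I J : (size P <= J)%N -> (forall j, size (P`_j)%R <= I)%N ->
  evm iota x y P = \sum_(j < J) \sum_(i < I) iota P`_j`_i * x ^+ i * y ^+ j.
Proof.
move=> sP sI; rewrite evmE (@horner_coef_wide _ J); last first.
  by apply: leq_trans sP; exact: size_poly.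
apply: eq_bigr => j _; rewrite coef_map /= /horner_eval (@horner_coef_wide _ I); last first.
  by apply: leq_trans (sI j); exact: size_poly.
by rewrite mulr_suml; apply: eq_bigr => i _; rewrite coef_map.
Qed.

End Morphism.

Lemma sizeY_bound (P : poly2 k) j : (size (P`_j)%R <= sizeY P)%N.
Proof. exact: max_size_coefXY. Qed.

Lemma evm_morph (L M : comNzRingType) (iota : {rmorphism k -> L}) (kappa : {rmorphism k -> M})
  (phi : {rmorphism L -> M}) x y P : phi \o iota =1 kappa ->
  phi (evm iota x y P) = evm kappa (phi x) (phi y) P.
Proof.
move=> h; rewrite !(@evm_sum _ _ _ _ _ (sizeY P) (size P)) //; do ?exact: sizeY_bound.
rewrite rmorph_sum; apply: eq_bigr => j _; rewrite rmorph_sum; apply: eq_bigr => i _.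
by rewrite !rmorphM !rmorphXn -h.
Qed.

Definition ev2 (x y : k) := evm (idfun : {rmorphism k -> k}) x y.

Lemma ev2_polyC x y q : ev2 x y q%:P = q.[x].
Proof. by rewrite /ev2 evm_polyC map_poly_id. Qed.

Section Ev2Morphism.
Variables (x y : k).
Implicit Types P Q : poly2 k.

Lemma ev2D P Q : ev2 x y (P + Q) = ev2 x y P + ev2 x y Q. Proof. exact: rmorphD. Qed.
Lemma ev2B P Q : ev2 x y (P - Q) = ev2 x y P - ev2 x y Q. Proof. exact: rmorphB. Qed.
Lemma ev2M P Q : ev2 x y (P * Q) = ev2 x y P * ev2 x y Q. Proof. exact: rmorphM. Qed.
Lemma ev2_exp P n : ev2 x y (P ^+ n) = ev2 x y P ^+ n. Proof. exact: rmorphXn. Qed.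
Lemma ev2_0 : ev2 x y 0 = 0. Proof. exact: rmorph0. Qed.
Lemma ev2_1 : ev2 x y 1 = 1. Proof. exact: rmorph1. Qed.
Lemma ev2_const c : ev2 x y c%:P%:P = c. Proof. by rewrite ev2_polyC hornerC. Qed.
Lemma ev2_X : ev2 x y ('X%:P) = x. Proof. exact: evmX. Qed.
Lemma ev2_Y : ev2 x y 'X = y. Proof. exact: evmY. Qed.

End Ev2Morphism.

Definition plane : @coord_ring k (k * k) _ := coord_ext (coord_base k).

Lemma cev_plane x y (P : poly2 k) : cev plane (x, y) P = ev2 x y P.
Proof.
rewrite /ev2 evmE /= /horner_eval /=; congr (_.[_]); apply: eq_map_poly => q /=.
by rewrite /horner_eval map_poly_id.
Qed.

Lemma ev2_inf (P : poly2 k) : P != 0 -> exists x y, ev2 x y P != 0.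
Proof.
by move=> /(@cev_inf _ _ _ plane)[[x y]]; rewrite cev_plane; exists x, y.
Qed.

Lemma ev2_eq0 (P : poly2 k) : (forall x y, ev2 x y P = 0) -> P = 0.
Proof. by move=> h; apply/eqP/negPn/negP => /ev2_inf[x [y]]; rewrite h eqxx. Qed.

(* [bihom iota P I J a c b d] is [c ^+ I * d ^+ J * P (a / c, b / d)]. *)
Definition bihom (L : comNzRingType) (iota : k -> L) (P : poly2 k) I J (a c b d : L) : L :=
  \sum_(j < J.+1) \sum_(i < I.+1) iota P`_j`_i * a ^+ i * c ^+ (I - i) * b ^+ j * d ^+ (J - j).

Lemma bihom_morph (L M : comNzRingType) (iota : k -> L) (kappa : k -> M)
  (phi : {rmorphism L -> M}) P I J a c b d : phi \o iota =1 kappa ->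
  phi (bihom iota P I J a c b d) = bihom kappa P I J (phi a) (phi c) (phi b) (phi d).
Proof.
move=> h; rewrite rmorph_sum; apply: eq_bigr => j _; rewrite rmorph_sum.
by apply: eq_bigr => i _; rewrite !rmorphM !rmorphXn -h.
Qed.

Lemma bihom_frac (L : fieldType) (iota : {rmorphism k -> L}) (P : poly2 k) I J (a c b d : L) :
  (size P <= J.+1)%N -> (forall j, size (P`_j)%R <= I.+1)%N -> c != 0 -> d != 0 ->
  bihom iota P I J a c b d = c ^+ I * d ^+ J * evm iota (a / c) (b / d) P.
Proof.
move=> sJ sI c0 d0; rewrite (evm_sum _ _ _ sJ sI) mulr_sumr; apply: eq_bigr => j _.
rewrite mulr_sumr; apply: eq_bigr => i _.
have -> : c ^+ I = c ^+ i * c ^+ (I - i) by rewrite -exprD subnKC // -ltnS.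
have -> : d ^+ J = d ^+ j * d ^+ (J - j) by rewrite -exprD subnKC // -ltnS.
by rewrite !exprMn !exprVn; field; rewrite !expf_neq0.
Qed.

Lemma size_bihom (P : poly2 k) I J (a c b d : {poly k}) m n :
  (size a <= m.+1)%N -> (size c <= m.+1)%N -> (size b <= n.+1)%N -> (size d <= n.+1)%N ->
  (size (bihom polyC P I J a c b d) <= (I * m + J * n).+1)%N.
Proof.
have sX (p : {poly k}) e r : (size p <= r.+1)%N -> (size (p ^+ e) <= (e * r).+1)%N.
  move=> sp; apply: leq_trans (size_poly_exp_leq _ _) _; rewrite ltnS mulnC leq_mul2l.
  by case: (size p) sp => [|s] //=; rewrite ?orbT // ltnS => ->; rewrite orbT.
have sM (p q : {poly k}) r s : (size p <= r.+1)%N -> (size q <= s.+1)%N ->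
    (size (p * q)%R <= (r + s).+1)%N.
  by move=> sp sq; apply: leq_trans (size_polyMleq _ _) _; lia.
move=> sa sc sb sd; apply: leq_trans (size_sum _ _ _) _; apply/bigmax_leqP => j _.
apply: leq_trans (size_sum _ _ _) _; apply/bigmax_leqP => i _.
have hi := ltn_ord i; have hj := ltn_ord j.
have -> : (I * m + J * n)%N = (0 + i * m + (I - i) * m + j * n + (J - j) * n)%N.
  rewrite add0n -mulnDl -addnA -mulnDl !subnKC //.
apply: (sM); last exact: (sX); apply: (sM); last exact: (sX); apply: (sM); last exact: (sX).
apply: (sM); last exact: (sX); exact: size_polyC_leq1.
Qed.

End Evaluation.

(** * Rational parametrisations of the level curves *)

(* A rational map [t |-> (pa / pc, pb / pd)] to the plane, and a rational
   function [pP / pQ] on the plane meant to be a left inverse of it. *)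
Record prm (k : closedFieldType) :=
  Prm { pa : {poly k}; pc : {poly k}; pb : {poly k}; pd : {poly k}; pP : poly2 k; pQ : poly2 k }.

Section Parametrization.
Variable k : closedFieldType.
Implicit Types (u v : prm k) (r : poly2 k).

Definition pX u t := (pa u).[t] / (pc u).[t].
Definition pY u t := (pb u).[t] / (pd u).[t].
Definition pdef u t := (pc u).[t] != 0 /\ (pd u).[t] != 0.

(** Stated on points, with poles excluded by [pdef], so as to be first-order in [lam] and the
    coefficients of [u]. The first clause keeps [pQ] from vanishing all along the curve, which would
    empty the relation [t * pQ = pP] of content. *)
Definition par F lam u :=
  (exists t, pdef u t /\ ev2 (pX u t) (pY u t) (pQ u) != 0) /\
  (forall t, pdef u t -> ev2 (pX u t) (pY u t) F = lam /\
    t * ev2 (pX u t) (pY u t) (pQ u) = ev2 (pX u t) (pY u t) (pP u)).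

(** As [pQ] is nonzero at [(x, y)], the parameter [t] is determined by the point. *)
Definition good u x y t :=
  [/\ pdef u t, (pa u).[t] = x * (pc u).[t], (pb u).[t] = y * (pd u).[t]
    & ev2 x y (pQ u) != 0].

Definition primeA (f : poly2 k) :=
  [/\ f != 0, ~ dvdA f 1 & forall g h, dvdA f (g * h) -> dvdA f g \/ dvdA f h].

Lemma dvdA_add f g h : dvdA f g -> dvdA f h -> dvdA f (g + h : poly2 k).
Proof. by move=> [x ->] [y ->]; exists (x + y); rewrite mulrDl. Qed.

Lemma dvdA_mull f g (h : poly2 k) : dvdA f g -> dvdA f (h * g).
Proof. by move=> [x ->]; exists (h * x); rewrite mulrA. Qed.

Lemma dvdA_opp f g : dvdA f g -> dvdA f (- g : poly2 k).
Proof. by move=> [x ->]; exists (- x); rewrite mulNr. Qed.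

Lemma dvdA_refl (f : poly2 k) : dvdA f f.
Proof. by exists 1; rewrite mul1r. Qed.

Lemma primeA_exp f g n : primeA f -> dvdA f (g ^+ n : poly2 k) -> dvdA f g.
Proof.
move=> [_ f1 fP]; elim: n => [|n IH]; first by rewrite expr0.
by rewrite exprS => /fP[|/IH].
Qed.

(* [k(x)[y]] is a field: modulo a prime, a non-multiple divides a nonzero
   polynomial in [X] alone. *)
Lemma primeA_inverse f r : primeA f -> ~ dvdA f r ->
  exists V W (rho : {poly k}), rho != 0 /\ V * r = rho%:P + W * f.
Proof.
move=> fP nr; have [f0 f1 fM] := fP.
have [b [i0 bi0] [W hW]] := @dep_mod _ f (size f).-1 (fun i => r ^+ i) f0 (leqSpred _).
(* Lowest nonzero coefficient: [r ^ j] factors out of the relation and is cancelled, [f] being prime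
   and not dividing [r]. What remains has constant term [b j]. *)
have [j bj minj] := @arg_minnP _ i0 (fun i => b i != 0) val bi0.
have : dvdA f (r ^+ j * \sum_(i | b i != 0) (b i)%:P * r ^+ (i - j)).
  exists W; rewrite -hW mulr_sumr [RHS](bigID (fun i => b i != 0)) /= [X in _ = _ + X]big1.
    by rewrite addr0; apply: eq_bigr => i bi; rewrite mulrCA -exprD subnKC ?minj // mul_polyC.
  by move=> i /negPn/eqP ->; rewrite scale0r.
case/fM => [/(primeA_exp fP)//|[W']]; rewrite (bigD1 j) //= subnn expr0 mulr1 => hW'.
exists (- \sum_(i | (b i != 0) && (i != j)) (b i)%:P * r ^+ (i - j).-1), (- W'), (b j); split=> //.
rewrite [X in _ = _ + X]mulNr -hW' opprD addrA subrr add0r mulNr mulr_suml; congr (- _).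
apply: eq_bigr => i /andP[bi ij]; rewrite -mulrA -exprSr prednK //.
by rewrite subn_gt0 ltn_neqAle minj // andbT eq_sym.
Qed.

Lemma par_nz F lam u : par F lam u -> pc u != 0 /\ pd u != 0.
Proof.
move=> [[t [[ct dt] _]] _]; split; [apply: contraNneq ct|apply: contraNneq dt] => ->;
  by rewrite horner0.
Qed.

Lemma pdef_dense F lam u p : par F lam u -> (forall t, pdef u t -> p.[t] = 0) -> p = 0.
Proof.
move=> /par_nz[c0 d0] h; apply/eqP/negPn/negP => p0.
have /closed_nonrootP[t] : p * pc u * pd u != 0 by rewrite !mulf_neq0.
by rewrite /root !hornerM !mulf_eq0 !negb_or => /andP[/andP[pt ct] dt]; rewrite h ?eqxx in pt.
Qed.

(** As [p] splits, some factor [a / c - z] vanishes identically: a rational function algebraic over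
    [k] is constant. *)
Lemma const_of_roots (c : {poly k}) (a : {poly k}) (p : {poly k}) (D : {poly k}) :
  c != 0 -> D != 0 -> p != 0 -> (forall t, c.[t] != 0 -> D.[t] != 0 -> p.[a.[t] / c.[t]] = 0) ->
  exists2 x, p.[x] = 0 & a = x *: c.
Proof.
move=> c0 D0 p0 h; have [s hs] := closed_field_poly_normal p.
have lp : lead_coef p != 0 by rewrite lead_coef_eq0.
have : \prod_(z <- s) (a - z *: c) = 0.
  apply/eqP/negPn/negP => P0.
  have /closed_nonrootP[t] : \prod_(z <- s) (a - z *: c) * c * D != 0 by rewrite !mulf_neq0.
  rewrite /root !hornerM !mulf_eq0 !negb_or => /andP[/andP[Pt ct] Dt].
  have := h t ct Dt; rewrite hs hornerZ => /eqP; rewrite mulf_eq0 (negbTE lp) /=.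
  rewrite horner_prod prodf_seq_eq0 => /hasP[z zs] /=.
  rewrite hornerXsubC subr_eq0 => /eqP az.
  case/negP: Pt; rewrite horner_prod prodf_seq_eq0; apply/hasP; exists z => //=.
  by rewrite hornerD hornerN hornerZ -az divfK // subrr.
move/eqP; rewrite prodf_seq_eq0 => /hasP[z zs] /=; rewrite subr_eq0 => /eqP ->; exists z => //.
by apply/eqP; rewrite -/(root p z) hs rootZ // root_prod_XsubC.
Qed.

Section Level.
Variables (F : poly2 k) (lam : k).
Let f := F - lam%:P%:P.
Hypotheses (fP : primeA f) (sF : (1 < size F)%N).

Lemma size_level : size f = size F.
Proof.
rewrite /f -polyCN size_polyDl //; apply: leq_ltn_trans sF; exact: size_polyC_leq1.
Qed.

Lemma ev2_level x y : ev2 x y f = ev2 x y F - lam.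
Proof. by rewrite ev2B ev2_const. Qed.

(** A vanishing fibre means that [X - x] divides [f]; as [f] is prime and has positive degree in
    [Y], [X - x] would be a unit. *)
Lemma level_fiber x : map_poly (horner_eval x) f != 0.
Proof.
have [f0 f1 fM] := fP; apply/eqP => E.
have [f' ff'] : exists f', f = ('X - x%:P)%:P * f'.
  exists (map_poly (fun q => q %/ ('X - x%:P)) f); apply/polyP => j.
  rewrite coefCM coef_map_id0 ?div0p // mulrC divpK // dvdp_XsubCl; apply/rootP.
  by have := congr1 (fun p : {poly k} => p`_j) E; rewrite coef_map coef0.
have : dvdA f (('X - x%:P)%:P * f') by rewrite -ff'; exact: dvdA_refl.
case/fM => [[w hw]|[w hw]].
  have := congr1 (fun p : poly2 k => size p) hw.
  have w0 : w != 0.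
    by apply/eqP => w0; move: hw; rewrite w0 mul0r => /eqP; rewrite polyC_eq0 polyXsubC_eq0.
  rewrite size_mul // size_level size_polyC polyXsubC_eq0 /= => /eqP.
  by move: w0 sF; rewrite -size_poly_gt0; case: (size w) (size F) => [|a] [|[|b]]//=; lia.
have : ('X - x%:P)%:P * w = 1.
  by apply: (mulIf f0); rewrite mul1r -mulrA -hw -ff'.
move=> h1; have := congr1 (ev2 x 0) h1.
rewrite ev2M ev2_1 ev2_polyC hornerXsubC subrr mul0r.
by move/eqP; rewrite eq_sym oner_eq0.
Qed.

Lemma level_fiberE x y : ev2 x y f = (map_poly (horner_eval x) f).[y].
Proof. by rewrite -cev_plane. Qed.

(* The curve [F = lam] is irreducible and [u] is not constant, so [u] is
   generically onto it. *)
Lemma par_kernel u r : par F lam u -> ~ dvdA f r ->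
  exists t, pdef u t /\ ev2 (pX u t) (pY u t) r != 0.
Proof.
move=> hu nr; apply: NNPP => nt.
have [c0 d0] := par_nz hu; have [[t0 [t0d Qt0]] hall] := hu.
have ht t : pdef u t -> ev2 (pX u t) (pY u t) r = 0.
  by move=> td; apply/eqP/negPn/negP => rt; apply: nt; exists t.
(* If [r] vanished along [u], this relation would make [pX] a root of [rho], hence a constant [x];
   then [pY], a root of [f (x, Y)], is constant too, while [pP / pQ] must still return [t]. *)
have [V [W [rho [rho0 hV]]]] := primeA_inverse fP nr.
have [|x rx ax] := @const_of_roots (pc u) (pa u) rho (pd u) c0 d0 rho0.
  move=> t ct dt; have td : pdef u t by [].
  have := congr1 (ev2 (pX u t) (pY u t)) hV.
  rewrite ev2M ev2D [ev2 _ _ (W * f)]ev2M ht // ev2_level (hall _ td).1.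
  by rewrite subrr !mulr0 addr0 ev2_polyC.
have Xx t : pdef u t -> pX u t = x by move=> [ct _]; rewrite /pX ax hornerZ mulfK.
have [|y fy by_] := @const_of_roots (pd u) (pb u) (map_poly (horner_eval x) f) (pc u) d0 c0 (level_fiber x).
  move=> t dt ct; have td : pdef u t by [].
  by rewrite -level_fiberE -(Xx t) // ev2_level (hall _ td).1 subrr.
have Yy t : pdef u t -> pY u t = y by move=> [_ dt]; rewrite /pY by_ hornerZ mulfK.
have : ev2 x y (pQ u) *: 'X - (ev2 x y (pP u))%:P = 0.
  apply: (pdef_dense hu) => t td; have := (hall t td).2; rewrite Xx // Yy // => <-.
  by rewrite hornerD hornerN hornerZ hornerX hornerC mulrC subrr.
move/(congr1 (fun p : {poly k} => p`_1)); rewrite coefB coefZ coefX coefC /= mulr1 subr0 coef0.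
by move=> Q0; case/negP: Qt0; rewrite Xx // Yy //; apply/eqP; exact: Q0.
Qed.

Lemma par_vanish u r : par F lam u ->
  (forall t, pdef u t -> ev2 (pX u t) (pY u t) r = 0) -> dvdA f r.
Proof.
move=> hu h; apply: NNPP => /(par_kernel hu)[t [td]]; by rewrite h ?eqxx.
Qed.

Lemma dvdA_par u r t : par F lam u -> dvdA f r -> pdef u t -> ev2 (pX u t) (pY u t) r = 0.
Proof.
by move=> hu [W ->] td; rewrite ev2M ev2_level (hu.2 t td).1 subrr mulr0.
Qed.

(* The numerator of [r (pX, pY)] over the denominator [pc ^ I * pd ^ J]. *)
Definition pnum u I J r := bihom polyC r I J (pa u) (pc u) (pb u) (pd u).

Lemma pnumE u I J r t : (sizeY r <= I.+1)%N -> (size r <= J.+1)%N -> pdef u t ->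
  (pnum u I J r).[t] = (pc u).[t] ^+ I * (pd u).[t] ^+ J * ev2 (pX u t) (pY u t) r.
Proof.
move=> sI sJ [ct dt]; rewrite -[LHS]/(horner_eval t (pnum u I J r)).
rewrite (@bihom_morph _ _ _ polyC (idfun : k -> k)); last by move=> c; exact: hornerC.
rewrite (@bihom_frac _ _ (idfun : {rmorphism k -> k})) //.
by move=> j; apply: leq_trans sI; exact: sizeY_bound.
Qed.

Lemma pnum_neq0 u I J r : (sizeY r <= I.+1)%N -> (size r <= J.+1)%N ->
  par F lam u -> ~ dvdA f r -> pnum u I J r != 0.
Proof.
move=> sI sJ hu /(par_kernel hu)[t [[ct dt] rt]].
apply/eqP => E; have := pnumE sI sJ (conj ct dt); rewrite E horner0 => /esym/eqP.
by rewrite !mulf_eq0 !expf_eq0 (negbTE ct) (negbTE dt) (negbTE rt) !andbF.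
Qed.

Lemma par_generic u r : par F lam u -> ~ dvdA f r ->
  exists2 p : {poly k}, p != 0 & forall t, p.[t] != 0 ->
    pdef u t /\ ev2 (pX u t) (pY u t) r != 0.
Proof.
move=> hu nr; have [c0 d0] := par_nz hu.
have sI := leqnSn (sizeY r); have sJ := leqnSn (size r).
exists (pnum u (sizeY r) (size r) r * pc u * pd u); first by rewrite !mulf_neq0 // pnum_neq0.
move=> t; rewrite !hornerM !mulf_eq0 !negb_or => /andP[/andP[nt ct] dt].
by split=> //; apply: contraNneq nt => E; rewrite (pnumE sI sJ) // E mulr0.
Qed.

Lemma pQ_ndvd u : par F lam u -> ~ dvdA f (pQ u).
Proof.
by move=> hu /dvdA_par; case: (hu) => -[t [td Qt]] _ /(_ _ _ hu td) E; rewrite E eqxx in Qt.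
Qed.

End Level.
End Parametrization.

Section Moebius.
Variables (k : closedFieldType) (F : poly2 k) (lam : k).
Let f := F - lam%:P%:P.
Hypotheses (fP : primeA f) (sF : (1 < size F)%N).
Implicit Types (u v : prm k) (p : {poly k}).

Definition tau u (x y : k) := ev2 x y (pP u) / ev2 x y (pQ u).

Lemma goodE u x y t : good u x y t -> pX u t = x /\ pY u t = y.
Proof. by move=> [[ct dt] ax by_ _]; rewrite /pX /pY ax by_ !mulfK. Qed.

Lemma good_pdef u x y t : good u x y t -> pdef u t. Proof. by case. Qed.

Lemma good_level u x y t : par F lam u -> good u x y t -> ev2 x y F = lam.
Proof. by move=> hu hg; have [<- <-] := goodE hg; rewrite (hu.2 t (good_pdef hg)).1. Qed.

Lemma good_tau u x y t : par F lam u -> good u x y t -> t = tau u x y.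
Proof.
move=> hu hg; have [hx hy] := goodE hg; have [td _ _ Q0] := hg.
by have := (hu.2 t td).2; rewrite hx hy /tau => <-; rewrite mulfK.
Qed.

Definition deg_prm u := (size (pa u) + size (pc u) + size (pb u) + size (pd u))%N.

(* [pull u p] is the numerator of the function [p (pP / pQ)] on the plane. *)
Definition pull u p : poly2 k := hom1 (polyC \o polyC) p (deg_prm u) (pP u) (pQ u).

Lemma ev2_pull u p x y :
  ev2 x y (pull u p) = hom1 idfun p (deg_prm u) (ev2 x y (pP u)) (ev2 x y (pQ u)).
Proof. by rewrite (@hom1_morph _ _ _ _ idfun) // => c; exact: ev2_const. Qed.

Lemma hom1_id p e (a b : k) : (size p <= e.+1)%N -> b != 0 ->
  hom1 idfun p e a b = b ^+ e * p.[a / b].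
Proof.
move=> sp b0; rewrite (@hom1_frac _ _ (idfun : {rmorphism k -> k})) //.
by rewrite map_poly_id.
Qed.

Lemma pull_par u p t : (size p <= (deg_prm u).+1)%N -> par F lam u -> pdef u t ->
  ev2 (pX u t) (pY u t) (pull u p) = ev2 (pX u t) (pY u t) (pQ u) ^+ deg_prm u * p.[t].
Proof.
move=> sp hu td; rewrite ev2_pull -(hu.2 t td).2.
set q := ev2 _ _ _; rewrite mulrC -{2}[q]mulr1 hom1_scale.
by rewrite (@hom1_1 _ _ (idfun : {rmorphism k -> k})) // map_poly_id.
Qed.

Lemma pull_good u p x y : (size p <= (deg_prm u).+1)%N -> ev2 x y (pQ u) != 0 ->
  ev2 x y (pull u p) = ev2 x y (pQ u) ^+ deg_prm u * p.[tau u x y].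
Proof. by move=> sp q0; rewrite ev2_pull hom1_id. Qed.

Lemma deg_prm_bounds u : [/\ (size (pa u) <= (deg_prm u).+1)%N, (size (pc u) <= (deg_prm u).+1)%N,
  (size (pb u) <= (deg_prm u).+1)%N & (size (pd u) <= (deg_prm u).+1)%N].
Proof. by rewrite /deg_prm; split; lia. Qed.

Lemma pull_X u : par F lam u -> dvdA f (pull u (pa u) - 'X%:P * pull u (pc u)).
Proof.
move=> hu; have [sa sc _ _] := deg_prm_bounds u.
apply: (par_vanish fP sF hu) => t td; rewrite ev2B ev2M ev2_X !pull_par //.
by rewrite mulrCA /pX; case: td => ct _; rewrite divfK // subrr.
Qed.

Lemma pull_Y u : par F lam u -> dvdA f (pull u (pb u) - 'X * pull u (pd u)).
Proof.
move=> hu; have [_ _ sb sd] := deg_prm_bounds u.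
apply: (par_vanish fP sF hu) => t td; rewrite ev2B ev2M ev2_Y !pull_par //.
by rewrite mulrCA /pY; case: td => _ dt; rewrite divfK // subrr.
Qed.

Definition bad u : poly2 k := pQ u * pull u (pc u) * pull u (pd u).

Lemma bad_ndvd u : par F lam u -> ~ dvdA f (bad u).
Proof.
move=> hu; have [_ sc _ sd] := deg_prm_bounds u; have [_ _ fM] := fP.
have npull p : (size p <= (deg_prm u).+1)%N -> p != 0 -> ~ dvdA f (pull u p).
  move=> sp p0 /(dvdA_par hu) h.
  have [q q0 hq] := par_generic fP sF hu (pQ_ndvd hu).
  have /closed_nonrootP[t] : q * p != 0 by rewrite mulf_neq0.
  rewrite /root hornerM mulf_eq0 negb_or => /andP[/hq[td Qt] pt].
  have /eqP := h t td; rewrite pull_par // mulf_eq0 expf_eq0 (negbTE Qt) andbF /=.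
  exact/negP.
have [c0 d0] := par_nz hu.
case/fM => [/fM[]|]; [exact: (pQ_ndvd hu)|exact: npull|exact: npull].
Qed.

(** The relations [pull_X] and [pull_Y] hold modulo [f], thus at every point of the curve and not
    only at points already known to be reached; away from [bad] they exhibit the point as the image
    of [tau]. *)
Lemma good_of_nbad u x y : par F lam u -> ev2 x y F = lam -> ev2 x y (bad u) != 0 ->
  good u x y (tau u x y).
Proof.
move=> hu hl; have [sa sc sb sd] := deg_prm_bounds u.
have f0 : ev2 x y f = 0 by rewrite ev2_level hl subrr.
rewrite /bad !ev2M !mulf_eq0 !negb_or => /andP[/andP[Q0]].
rewrite !pull_good // !mulf_eq0 !expf_eq0 (negbTE Q0) !andbF /= => ct dt.
have qe : ev2 x y (pQ u) ^+ deg_prm u != 0 by rewrite expf_neq0.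
split=> //.
  have [w hw] := pull_X hu; have := congr1 (ev2 x y) hw.
  rewrite [ev2 _ _ (w * _)]ev2M f0 mulr0 ev2B ev2M ev2_X !pull_good // mulrCA -mulrBr => /eqP.
  by rewrite mulf_eq0 (negbTE qe) subr_eq0 => /eqP.
have [w hw] := pull_Y hu; have := congr1 (ev2 x y) hw.
rewrite [ev2 _ _ (w * _)]ev2M f0 mulr0 ev2B ev2M ev2_Y !pull_good // mulrCA -mulrBr => /eqP.
by rewrite mulf_eq0 (negbTE qe) subr_eq0 => /eqP.
Qed.

Definition moebius (m : k * k * k * k) t := (m.1.1.1 * t + m.1.1.2) / (m.1.2 * t + m.2).

(** [moebius_tau] is cross-multiplied so as to keep a meaning where a denominator vanishes. *)
Record moebius_rel u v (m : k * k * k * k) : Prop := MoebiusRel {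
  moebius_det : m.1.1.1 * m.2 - m.1.1.2 * m.1.2 != 0;
  moebius_tau : forall t, pdef u t -> ev2 (pX u t) (pY u t) (pP v) * (m.1.2 * t + m.2) =
     ev2 (pX u t) (pY u t) (pQ v) * (m.1.1.1 * t + m.1.1.2);
  moebius_eq : forall t, pdef u t -> m.1.2 * t + m.2 != 0 -> pdef v (moebius m t) ->
     pX u t = pX v (moebius m t) /\ pY u t = pY v (moebius m t) }.

Lemma size2_horner p t : (size p <= 2)%N -> p.[t] = p`_1 * t + p`_0.
Proof. by move=> sp; rewrite (horner_coef_wide _ sp) !big_ord_recl big_ord0 /= mulr1 addr0 addrC. Qed.

(** Composing [u] with the inverse of [v] gives a rational function [A' / B'] of [t]; applying to it
    [v] and then the inverse of [u] returns [t]. So [1] and [t] are dependent over [k(A' / B')], and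
    [powers_indep] bounds the degree of [A' / B'] by one. *)
Lemma par_moebius u v : par F lam u -> par F lam v -> exists m, moebius_rel u v m.
Proof.
move=> hu hv; have [_ _ fM] := fP.
pose I (w : prm k) := (sizeY (pP w) + sizeY (pQ w))%N; pose J (w : prm k) := (size (pP w) + size (pQ w))%N.
have IJ w : [/\ (sizeY (pP w) <= (I w).+1)%N, (size (pP w) <= (J w).+1)%N,
    (sizeY (pQ w) <= (I w).+1)%N & (size (pQ w) <= (J w).+1)%N].
  by rewrite /I /J; split; lia.
have [sPv sPv' sQv sQv'] := IJ v; have [sPu sPu' sQu sQu'] := IJ u.
have [sa sc sb sd] := deg_prm_bounds v.
pose A := pnum u (I v) (J v) (pP v); pose B := pnum u (I v) (J v) (pQ v).
have Qv : ~ dvdA f (pQ v) by exact: (pQ_ndvd hv).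
have Qu : ~ dvdA f (pQ u) by exact: (pQ_ndvd hu).
have B0 : B != 0 by exact: (pnum_neq0 fP sF sQv sQv' hu Qv).
pose g := gcdp A B; pose A' := A %/ g; pose B' := B %/ g.
have g0 : g != 0 by rewrite gcdp_eq0 negb_and B0 orbT.
have AE : A = A' * g by rewrite divpK // dvdp_gcdl.
have BE : B = B' * g by rewrite divpK // dvdp_gcdr.
have cop : coprimep A' B' by rewrite coprimep_div_gcd // B0 orbT.
have B'0 : B' != 0 by apply: contraNneq B0 => E; rewrite BE E mul0r.
have [gen gen0 genP] : exists2 p : {poly k}, p != 0 & forall t, p.[t] != 0 ->
    [/\ pdef u t, ev2 (pX u t) (pY u t) (bad v) != 0, ev2 (pX u t) (pY u t) (pQ u) != 0
      & B'.[t] != 0].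
  have [|q q0 hq] := @par_generic _ _ _ fP sF u (bad v * pQ u) hu.
    by case/fM; [exact: bad_ndvd|].
  exists (q * B'); first by rewrite mulf_neq0.
  move=> t; rewrite hornerM mulf_eq0 negb_or => /andP[/hq[td]].
  by rewrite ev2M mulf_eq0 negb_or => /andP[].
have gdense p : (forall t, gen.[t] != 0 -> p.[t] = 0) -> p = 0.
  move=> h; apply/eqP/negPn/negP => p0.
  have /closed_nonrootP[t] : gen * p != 0 by rewrite mulf_neq0.
  by rewrite /root hornerM mulf_eq0 negb_or => /andP[/h ->]; rewrite eqxx.
have ABt t : pdef u t -> ev2 (pX u t) (pY u t) (pP v) * B'.[t] =
    ev2 (pX u t) (pY u t) (pQ v) * A'.[t].
  move=> td; have : A * B' = B * A' by rewrite AE BE; ring.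
  move/(congr1 (horner^~ t)); rewrite !hornerM !pnumE // -!mulrA.
  case: td => ct dt; move/(mulfI (expf_neq0 _ ct))/(mulfI (expf_neq0 _ dt)).
  by rewrite [pX _ _]/pX [pY _ _]/pY.
have genE t : gen.[t] != 0 -> good v (pX u t) (pY u t) (A'.[t] / B'.[t]).
  move=> /genP[td bt _ Bt]; have Q0 : ev2 (pX u t) (pY u t) (pQ v) != 0.
    by apply: contraNneq bt; rewrite /bad !ev2M => ->; rewrite !mul0r.
  have -> : A'.[t] / B'.[t] = tau v (pX u t) (pY u t).
    by apply/eqP; rewrite /tau eqr_div // mulrC -ABt // mulrC.
  by apply: good_of_nbad => //; rewrite (hu.2 t td).1.
pose b (i : 'I_2) := if i == ord0 then - pnum v (I u) (J u) (pP u) else pnum v (I u) (J u) (pQ u).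
pose e := (size (b ord0) + size (b (lift ord0 ord0)))%N.
have sbi i : (size (b i) <= e.+1)%N.
  apply: leqW; rewrite /e; case: (unliftP ord0 i) => [j ->|->]; last exact: leq_addr.
  by rewrite (ord1 j) leq_addl.
have [sA' sB'] : (size A' <= 2)%N /\ (size B' <= 2)%N.
  apply: (@powers_indep _ A' B' 2 e b cop).
  - exists (lift ord0 ord0); exact: (pnum_neq0 fP sF sQu sQu' hv Qu).
  - exact: sbi.
  apply: gdense => t gt; have [td bt Qt Bt] := genP t gt; have hg := genE t gt.
  have [hx hy] := goodE hg; have rd := good_pdef hg.
  rewrite horner_sum !big_ord_recl big_ord0 addr0 !hornerM !hornerXn expr0 mulr1 expr1.
  have hE p : (size p <= e.+1)%N -> (hom1 polyC p e A' B').[t] = B'.[t] ^+ e * p.[A'.[t] / B'.[t]].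
    move=> sp; rewrite -[LHS]/(horner_eval t _) (@hom1_morph _ _ _ _ idfun) ?hom1_id //.
    by move=> c; exact: hornerC.
  rewrite !hE ?sbi //.
  rewrite -mulrA -mulrDr /b /= hornerN !pnumE // hx hy -(hu.2 t td).2.
  by rewrite [X in _ + X]mulrC mulrCA addrC subrr mulr0.
pose m := (A'`_1, A'`_0, B'`_1, B'`_0).
have A'E t : A'.[t] = m.1.1.1 * t + m.1.1.2 by rewrite size2_horner.
have B'E t : B'.[t] = m.1.2 * t + m.2 by rewrite size2_horner.
exists m; split.
(* A vanishing determinant makes [A' / B'] constant; two distinct generic parameters would then have
   the same image point, but the inverse of [u] separates them. *)
- apply/eqP => D0.
  have /closed_nonrootP[t1 g1] := gen0.
  have /closed_nonrootP[t2] : gen * ('X - t1%:P) != 0 by rewrite mulf_neq0 // polyXsubC_eq0.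
  rewrite /root hornerM hornerXsubC mulf_eq0 negb_or subr_eq0 => /andP[g2 /eqP t12].
  have G1 := genE t1 g1; have G2 := genE t2 g2.
  have [t1d _ Q1 B1] := genP t1 g1; have [t2d _ Q2 B2] := genP t2 g2.
  have rE : A'.[t1] / B'.[t1] = A'.[t2] / B'.[t2].
    apply/eqP; rewrite eqr_div // -subr_eq0; apply/eqP.
    have -> : A'.[t1] * B'.[t2] - A'.[t2] * B'.[t1] =
        (m.1.1.1 * m.2 - m.1.1.2 * m.1.2) * (t1 - t2) by rewrite !A'E !B'E; ring.
    by rewrite D0 mul0r.
  have [x1 y1] := goodE G1; have [x2 y2] := goodE G2; rewrite rE in x1 y1.
  have gu t : pdef u t -> ev2 (pX u t) (pY u t) (pQ u) != 0 -> good u (pX u t) (pY u t) t.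
    by move=> td Qt; case: (td) => ct dt; split=> //; rewrite divfK.
  by apply: t12; rewrite (good_tau hu (gu _ t1d Q1)) (good_tau hu (gu _ t2d Q2)) -x1 -y1 x2 y2.
- by move=> t td; rewrite -A'E -B'E; exact: ABt.
move=> t td; rewrite -B'E /moebius -A'E -B'E => Bt [ct dt].
(* Checked at generic parameters, this becomes a polynomial identity and is then available at every
   [t]. *)
have idX : pa u * hom1 polyC (pc v) (deg_prm v) A' B' = pc u * hom1 polyC (pa v) (deg_prm v) A' B'.
  apply/eqP; rewrite -subr_eq0; apply/eqP/gdense => s gs; have [[cs ds] _ _ Bs] := genP s gs.
  have [_ ax _ _] := genE s gs.
  rewrite hornerD hornerN !hornerM -!/(horner_eval s (hom1 _ _ _ _ _)).
  rewrite !(@hom1_morph _ _ _ polyC idfun) /horner_eval; try by move=> c; exact: hornerC.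
  by rewrite !hom1_id // ax /pX; field.
have idY : pb u * hom1 polyC (pd v) (deg_prm v) A' B' = pd u * hom1 polyC (pb v) (deg_prm v) A' B'.
  apply/eqP; rewrite -subr_eq0; apply/eqP/gdense => s gs; have [[cs ds] _ _ Bs] := genP s gs.
  have [_ _ ax _] := genE s gs.
  rewrite hornerD hornerN !hornerM -!/(horner_eval s (hom1 _ _ _ _ _)).
  rewrite !(@hom1_morph _ _ _ polyC idfun) /horner_eval; try by move=> c; exact: hornerC.
  by rewrite !hom1_id // ax /pY; field.
case: td => cu du; have Be : B'.[t] ^+ deg_prm v != 0 by rewrite expf_neq0.
split; apply/eqP; rewrite eqr_div //; apply/eqP/(mulfI Be).
  move: idX => /(congr1 (horner_eval t)); rewrite /= /horner_eval !hornerM.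
  rewrite -!/(horner_eval t (hom1 _ _ _ _ _)).
  rewrite !(@hom1_morph _ _ _ polyC idfun) /horner_eval; try by move=> c; exact: hornerC.
  by rewrite !hom1_id // => E; rewrite mulrCA E; ring.
move: idY => /(congr1 (horner_eval t)); rewrite /= /horner_eval !hornerM.
rewrite -!/(horner_eval t (hom1 _ _ _ _ _)).
rewrite !(@hom1_morph _ _ _ polyC idfun) /horner_eval; try by move=> c; exact: hornerC.
by rewrite !hom1_id // => E; rewrite mulrCA E; ring.
Qed.

Lemma good_moebius u v m x y t s : par F lam u -> par F lam v -> moebius_rel u v m ->
  good u x y t -> good v x y s -> m.1.2 * t + m.2 != 0 /\ s = moebius m t.
Proof.
move=> hu hv hm gu gv; have [hx hy] := goodE gu; have [_ _ _ Qv] := gv.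
have := moebius_tau hm (good_pdef gu); rewrite hx hy => E.
have B0 : m.1.2 * t + m.2 != 0.
  apply/eqP => B0; move: E; rewrite B0 mulr0 => /esym/eqP; rewrite mulf_eq0 (negbTE Qv) /= => /eqP A0.
  case/eqP: (moebius_det hm).
  case: (eqVneq m.1.2 0) B0 A0 => [->|g0].
    by rewrite mul0r add0r => -> _; rewrite !mulr0 subrr.
  move=> B0 A0; apply: (mulfI g0); rewrite mulr0.
  have -> : m.2 = - (m.1.2 * t) by apply/eqP; rewrite -addr_eq0 addrC B0.
  have -> : m.1.1.2 = - (m.1.1.1 * t) by apply/eqP; rewrite -addr_eq0 addrC A0.
  by ring.
split=> //; rewrite (good_tau hv gv) /tau /moebius; apply/eqP.
by rewrite eqr_div // E mulrC.
Qed.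

End Moebius.

Section ParametrizationExists.
Variable k : closedFieldType.
Local Notation fr := (@FracField.tofrac _).

Definition ktm : {rmorphism k -> ratfun k} := fr \o polyC.

Lemma eval2_kt P x y : eval2 (@kt_emb k) P x y = evm ktm x y P.
Proof. exact: (eval2E ktm). Qed.

Lemma rational_prime (f : poly2 k) : k_rational_quot f -> primeA f.
Proof.
move=> [[f0 _] [x [y [ker _]]]]; split=> //.
  by move/ker; rewrite eval2_kt rmorph1 => /eqP; rewrite oner_eq0.
move=> g h /ker; rewrite eval2_kt rmorphM => /eqP; rewrite mulf_eq0.
by case/orP => /eqP E; [left|right]; apply/ker; rewrite eval2_kt.
Qed.

Lemma lowest_terms (z : ratfun k) :
  exists a c : {poly k}, [/\ c != 0, coprimep a c & z = fr a / fr c].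
Proof.
have [a [c [c0 ->]]] := fraction_numden z; pose g := gcdp a c.
have g0 : g != 0 by rewrite gcdp_eq0 negb_and c0 orbT.
have cE : c = c %/ g * g by rewrite divpK // dvdp_gcdr.
have aE : a = a %/ g * g by rewrite divpK // dvdp_gcdl.
have c'0 : c %/ g != 0 by apply: contraNneq c0 => E; rewrite cE E mul0r.
exists (a %/ g), (c %/ g); split=> //; first by rewrite coprimep_div_gcd // c0 orbT.
rewrite {1}aE {1}cE !rmorphM /= -mulf_div divff ?mulr1 //.
by rewrite tofrac_eq0.
Qed.

Lemma evm_swap (L : comNzRingType) (iota : {rmorphism k -> L}) x y (P : poly2 k) :
  evm iota y x (swapXY P) = evm iota x y P.
Proof.
rewrite (@evm_sum _ _ _ y x (swapXY P) (maxn (size P) (sizeY P)) (maxn (size P) (sizeY P))).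
- rewrite (@evm_sum _ _ _ x y P (maxn (size P) (sizeY P)) (maxn (size P) (sizeY P))).
  + rewrite exchange_big; apply: eq_bigr => j _; apply: eq_bigr => i _.
    by rewrite coef_swapXY mulrAC.
  + exact: leq_maxl.
  by move=> j; apply: leq_trans (sizeY_bound _ _) (leq_maxr _ _).
- by rewrite -sizeYE leq_maxr.
move=> j; apply: leq_trans (sizeY_bound _ _) _.
by rewrite sizeYE swapXYK leq_maxl.
Qed.

Lemma size_sum_bound (I : finType) (b : I -> {poly k}) i :
  (size (b i) <= (\sum_j size (b j)).+1)%N.
Proof. by apply: leqW; rewrite (bigD1 i) //= leq_addr. Qed.

(* [k(t)] has degree at most [deg_Y f] over [k(x)]. *)
Lemma rational_degree (f : poly2 k) (x y : ratfun k) (P Q : poly2 k) (a c : {poly k}) :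
  f != 0 -> evm ktm x y f = 0 -> evm ktm x y Q != 0 -> fr 'X * evm ktm x y Q = evm ktm x y P ->
  c != 0 -> coprimep a c -> x = fr a / fr c -> (size a <= size f)%N /\ (size c <= size f)%N.
Proof.
move=> f0 fxy Q0 tQ c0 cop xE; pose n := (size f).-1.
have sf : size f = n.+1 by rewrite /n prednK // size_poly_gt0.
(* Since [P = t Q] on the curve, these elements are [Q ^ n] times [1, t, ..., t ^ n]. *)
have [b b0 [W hW]] := dep_mod (fun i : 'I_n.+1 => P ^+ i * Q ^+ (n - i)) f0 (eq_leq sf).
rewrite sf; pose e := (\sum_j size (b j))%N.
have sb i : (size (b i) <= e.+1)%N by exact: size_sum_bound.
apply: (powers_indep cop b0 sb).
have c0' : fr c != 0 by rewrite tofrac_eq0.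
apply/eqP; rewrite -tofrac_eq0 rmorph_sum; apply/eqP.
have -> : \sum_i fr (hom1 polyC (b i) e a c * 'X^i) =
    fr c ^+ e * \sum_i evm ktm x y (b i)%:P * fr 'X ^+ i.
  rewrite mulr_sumr; apply: eq_bigr => i _; rewrite rmorphM rmorphXn /=.
  rewrite (@hom1_morph _ _ _ polyC ktm) // hom1_frac // evm_polyC -xE mulrA //.
suff -> : \sum_i evm ktm x y (b i)%:P * fr 'X ^+ i = 0 by rewrite mulr0.
apply: (mulfI (expf_neq0 n Q0)); rewrite mulr0 mulr_sumr.
transitivity (evm ktm x y (\sum_i b i *: (P ^+ i * Q ^+ (n - i)))); last first.
  by rewrite hW rmorphM /= fxy mulr0.
rewrite rmorph_sum; apply: eq_bigr => i _; rewrite -mul_polyC !rmorphM !rmorphXn /= -tQ exprMn.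
have -> : evm ktm x y Q ^+ n = evm ktm x y Q ^+ i * evm ktm x y Q ^+ (n - i).
  by rewrite -exprD subnKC // -ltnS.
by ring.
Qed.

Lemma fr_pnum (u : prm k) I J r : (sizeY r <= I.+1)%N -> (size r <= J.+1)%N ->
  pc u != 0 -> pd u != 0 ->
  fr (pnum u I J r) = fr (pc u) ^+ I * fr (pd u) ^+ J *
    evm ktm (fr (pa u) / fr (pc u)) (fr (pb u) / fr (pd u)) r.
Proof.
move=> sI sJ c0 d0; rewrite (@bihom_morph _ _ _ polyC ktm) //.
by rewrite bihom_frac ?tofrac_eq0 // => j; apply: leq_trans sI; exact: sizeY_bound.
Qed.

Lemma size_poly_coefs n D (w : 'I_n -> 'I_D -> k) :
  exists P : poly2 k, [/\ (size P <= n)%N, (sizeY P <= D)%N &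
    forall (j : 'I_n) (i : 'I_D), P`_j`_i = w j i].
Proof.
pose q (j : 'I_n) : {poly k} := \sum_(i < D) w j i *: 'X^i.
have sq j : (size (q j) <= D)%N.
  apply: leq_trans (size_sum _ _ _) _; apply/bigmax_leqP => i _.
  by apply: leq_trans (size_scale_leq _ _) _; rewrite size_polyXn.
have qE j (i : 'I_D) : (q j)`_i = w j i.
  rewrite coef_sum (bigD1 i) //= coefZ coefXn eqxx mulr1 big1 ?addr0 // => l li.
  by rewrite coefZ coefXn -[_ == _]/(i == l) eq_sym (negbTE li) mulr0.
pose P : poly2 k := \sum_(j < n) (q j)%:P * 'X^j.
have PE (j : 'I_n) : P`_j = q j.
  rewrite coef_sum (bigD1 j) //= coefCM coefXn eqxx mulr1 big1 ?addr0 // => l li.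
  by rewrite coefCM coefXn -[_ == _]/(j == l) eq_sym (negbTE li) mulr0.
have sP : (size P <= n)%N.
  apply: leq_trans (size_sum _ _ _) _; apply/bigmax_leqP => j _.
  by rewrite mul_polyC; apply: leq_trans (size_scale_leq _ _) _; rewrite size_polyXn.
exists P; split=> // [|j i]; last by rewrite PE qE.
rewrite /sizeY; apply/bigmax_leqP => j _; have jn : (j < n)%N by apply: leq_trans sP.
by have -> : P`_j = q (Ordinal jn) by exact: (PE (Ordinal jn)).
Qed.

Lemma dvdA_size (f P : poly2 k) : dvdA f P -> (size P < size f)%N -> P = 0.
Proof.
move=> [W ->] sP; apply/eqP/negPn/negP; rewrite mulf_eq0 negb_or => /andP[W0 f0].
move: sP; rewrite size_mul // ltnNge; apply/negP/negPn.
by move: W0; rewrite -size_poly_gt0; case: (size W) => // s _; rewrite addSn /= leq_addl.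
Qed.

Section Bound.
Variables (F : poly2 k).
Definition Ybound := (maxn (sizeY F) 1).

(** The bounds depend on [F] only, which lets all parametrisations range over one finite-dimensional
    space. [rational_degree] bounds [x] and, after swapping the variables, [y]. The inverse given by
    the hypothesis has no bounded degree, so a new one is found by counting, as a nontrivial
    relation [P = t Q]. *)
Lemma par_exists lam : (1 < size F)%N -> k_rational_quot (F - lam%:P%:P) ->
  exists u, [/\ par F lam u, (size (pa u) <= size F)%N /\ (size (pc u) <= size F)%N,
    (size (pb u) <= Ybound)%N /\ (size (pd u) <= Ybound)%N,
    (size (pP u) <= size F)%N /\ (size (pQ u) <= size F)%N
    & (sizeY (pP u) <= Ybound.+2)%N /\ (sizeY (pQ u) <= Ybound.+2)%N].
Proof.
move=> sF rat; have [[f0 _] [x [y [ker gen]]]] := rat.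
set f := F - lam%:P%:P in f0 ker; have sf : size f = size F by exact: size_level.
have [a [c [c0 copx xE]]] := lowest_terms x; have [b [d [d0 copy yE]]] := lowest_terms y.
have fxy : evm ktm x y f = 0 by rewrite -eval2_kt; apply/ker; exact: dvdA_refl.
have [P0 [Q0 [Qn0 tE]]] := gen (fr 'X); rewrite !eval2_kt in Qn0 tE.
have tQ0 : fr 'X * evm ktm x y Q0 = evm ktm x y P0 by rewrite tE divfK.
have [sa sc] := rational_degree f0 fxy Qn0 tQ0 c0 copx xE; rewrite sf in sa sc.
have sYf : (size (swapXY f) <= Ybound)%N.
  rewrite rmorphB /= swapXY_polyC map_polyC /=; apply: leq_trans (size_polyD _ _) _.
  rewrite size_polyN -sizeYE /Ybound geq_max leq_maxl /=; apply: leq_trans (size_polyC_leq1 _) _.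
  exact: leq_maxr.
have [sb sd] : (size b <= Ybound)%N /\ (size d <= Ybound)%N.
  have [] := @rational_degree (swapXY f) y x (swapXY P0) (swapXY Q0) b d.
  - by rewrite swapXY_eq0.
  - by rewrite evm_swap.
  - by rewrite evm_swap.
  - by rewrite !evm_swap.
  - exact: d0.
  - exact: copy.
  - exact: yE.
  by move=> h1 h2; split; [apply: leq_trans h1 _|apply: leq_trans h2 _].
pose n := (size F).-1; have nE : size F = n.+1 by rewrite /n prednK // ltnW.
have n0 : (0 < n)%N by rewrite -ltnS -nE.
have [dy dyE] : exists dy, Ybound = dy.+1.
  by exists Ybound.-1; rewrite prednK // /Ybound leq_max orbT.
(* There are [2 n (D + 1)] unknowns for polynomials in [t] of degree at most [D n + (n - 1) dy + 1];
   with [D = dy + 1] the unknowns prevail. Exponents of [Y] stay below [n], so that [P] and [Q]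
   cannot be nonzero multiples of [f]. *)
pose D := dy.+1; pose I := ('I_2 * 'I_n * 'I_D.+1)%type.
pose mon (j : 'I_n) (i : 'I_D.+1) := a ^+ i * c ^+ (D - i) * b ^+ j * d ^+ (n.-1 - j).
pose g (z : I) := (if z.1.1 == ord0 then 1 else - 'X) * mon z.1.2 z.2.
have smon j i : (size (mon j i) <= (D * n + n.-1 * dy).+1)%N.
  have -> : mon j i = bihom polyC ('X^j * ('X^i)%:P) D n.-1 a c b d.
    have cE j' i' : ('X^j * ('X^i)%:P : poly2 k)`_j'`_i' = ((j' == j) && (i' == i))%:R.
      by rewrite coefMC coefXn; case: (j' == _); rewrite ?mul1r ?mul0r ?coefXn ?coef0.
    rewrite /bihom; have hj : (j < n.-1.+1)%N by rewrite prednK.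
    rewrite (bigD1 (Ordinal hj)) //= (bigD1 i) //= cE !eqxx polyC1 mul1r.
    rewrite big1 => [|l li]; last first.
      by rewrite cE eqxx -[_ == i :> nat]/(l == i) (negbTE li) polyC0 !mul0r.
    rewrite addr0 big1 => [|l li]; first by rewrite addr0.
    rewrite big1 // => q _; rewrite cE -[_ == j :> nat]/(l == Ordinal hj) (negbTE li).
    by rewrite polyC0 !mul0r.
  by apply: size_bihom; rewrite -?nE -?dyE.
have [v [z0 vz0] hv] : exists2 v : I -> k, (exists z, v z != 0) & \sum_z v z *: g z = 0.
  apply: (@poly_lin_dep k I (D * n + n.-1 * dy).+2).
    move=> [[s j] i]; rewrite /g /=; case: ifP => _; first by rewrite mul1r leqW.
    rewrite mulNr size_polyN; apply: leq_trans (size_polyMleq _ _) _.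
    by rewrite size_polyX add2n ltnS.
  rewrite !card_prod !card_ord /D; move: n0; case: (n) => // n' _ /=; nia.
have [P [sP sYP PE]] := size_poly_coefs (fun j i => v (ord0, j, i)).
have [Q [sQ sYQ QE]] := size_poly_coefs (fun j i => v (lift ord0 ord0, j, i)).
pose u := Prm a c b d P Q.
have bihomE (R : poly2 k) w : (forall (j : 'I_n) (i : 'I_D.+1), R`_j`_i = w j i) ->
    pnum u D n.-1 R = \sum_j \sum_i w j i *: mon j i.
  move=> RE; rewrite /pnum /bihom; have nS : n.-1.+1 = n by rewrite prednK.
  transitivity (\sum_(j < n.-1.+1) \sum_(i < D.+1) (R`_j`_i)%:P * (a ^+ i * c ^+ (D - i) * b ^+ j * d ^+ (n.-1 - j))).
    by apply: eq_bigr => j _; apply: eq_bigr => i _; rewrite !mulrA.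
  rewrite nS; apply: eq_bigr => j _; apply: eq_bigr => i _; by rewrite RE mul_polyC.
have relPQ : pnum u D n.-1 P - 'X * pnum u D n.-1 Q = 0.
  transitivity (\sum_s \sum_j \sum_i v (s, j, i) *: g (s, j, i)); last first.
    rewrite -[RHS]hv pair_bigA pair_bigA; apply: eq_bigr => -[[s j] i] _ //.
  rewrite (bihomE _ _ PE) (bihomE _ _ QE) !big_ord_recl big_ord0 addr0.
  congr (_ + _); first by apply: eq_bigr => j _; apply: eq_bigr => i _; rewrite /g mul1r.
  rewrite -mulNr mulr_sumr; apply: eq_bigr => j _; rewrite mulr_sumr.
  by apply: eq_bigr => i _; rewrite /g /= -scalerAr.
have nS : n.-1.+1 = n by rewrite prednK.
have sP' : (size P <= n.-1.+1)%N by rewrite nS.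
have sQ' : (size Q <= n.-1.+1)%N by rewrite nS.
have c0' : fr c != 0 by rewrite tofrac_eq0.
have d0' : fr d != 0 by rewrite tofrac_eq0.
have cd0 : fr c ^+ D * fr d ^+ n.-1 != 0.
  have -> : fr c ^+ D * fr d ^+ n.-1 = fr (c ^+ D * d ^+ n.-1) by rewrite rmorphM !rmorphXn.
  rewrite tofrac_eq0 mulf_eq0 negb_or.
  by apply/andP; split; rewrite expf_eq0 ?(negbTE c0) ?(negbTE d0) andbF.
have tQ : fr 'X * evm ktm x y Q = evm ktm x y P.
  apply/eqP; rewrite eq_sym -subr_eq0; apply/eqP; apply: (mulfI cd0).
  rewrite mulr0 mulrBr mulrCA xE yE.
  rewrite -(@fr_pnum u D n.-1 P) // -(@fr_pnum u D n.-1 Q) // -rmorphM -rmorphB.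
  by rewrite relPQ rmorph0.
have Qxy : evm ktm x y Q != 0.
  apply/eqP => Q00.
  have QZ : Q = 0.
    apply: (@dvdA_size f); last by rewrite sf nE ltnS.
    by apply/ker; rewrite eval2_kt.
  have PZ : P = 0.
    apply: (@dvdA_size f); last by rewrite sf nE ltnS.
    by apply/ker; rewrite eval2_kt -tQ Q00 mulr0.
  case/eqP: vz0; case: z0 => [[s j] i].
  case: (unliftP ord0 s) => [l ->|->].
    by rewrite (ord1 l) -QE QZ !coef0.
  by rewrite -PE PZ !coef0.
have pn0 I' J' r : (sizeY r <= I'.+1)%N -> (size r <= J'.+1)%N ->
    evm ktm x y r = 0 -> pnum u I' J' r = 0.
  move=> sI sJ r0; apply/eqP; rewrite -tofrac_eq0 fr_pnum //=.
  by rewrite -xE -yE r0 mulr0.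
have evu r t : pdef u t -> evm ktm x y r = 0 -> ev2 (pX u t) (pY u t) r = 0.
  move=> td r0; have := @pnumE _ u (sizeY r) (size r) r t (leqnSn _) (leqnSn _) td.
  rewrite pn0 // horner0 => /esym/eqP; case: td => ct dt.
  by rewrite !mulf_eq0 !expf_eq0 (negbTE ct) (negbTE dt) !andbF /= => /eqP.
exists u; split=> //.
- split.
    have Qn : pnum u D n.-1 Q != 0.
      apply: contraNneq Qxy => E; apply/eqP; apply: (mulfI cd0).
      by rewrite mulr0 xE yE -(@fr_pnum u D n.-1 Q) // E rmorph0.
    have /closed_nonrootP[t] : pnum u D n.-1 Q * c * d != 0 by rewrite !mulf_neq0.
    rewrite /root !hornerM !mulf_eq0 !negb_or => /andP[/andP[Qt ct] dt].
    exists t; split=> //; apply: contraNneq Qt => E.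
    by rewrite (@pnumE _ u D n.-1) // E mulr0.
  move=> t td; split.
    by apply/eqP; rewrite -subr_eq0 -ev2_level; apply/eqP/evu.
  have := congr1 (horner^~ t) relPQ; rewrite hornerD hornerN hornerM hornerX horner0.
  rewrite !pnumE // mulrCA -mulrBr => /eqP; case: td => ct dt.
  by rewrite !mulf_eq0 !expf_eq0 (negbTE ct) (negbTE dt) !andbF /= subr_eq0 => /eqP.
- by rewrite nE; split; apply: leqW.
by rewrite dyE; split; apply: leqW.
Qed.
End Bound.
End ParametrizationExists.

(** * Binary quadratics and conics over k(S) *)

Section BinaryQuadratics.
Variable k : fieldType.
Implicit Types (u v w : k * k * k) (m : k * k * k * k) (t : k).

(* [(a, b, c)] stands for the vector field [(a t^2 + b t + c) d/dt]; [qvec a b]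
   is the one vanishing at [a] and [b] with derivative [1] at [a]. *)
Definition qvec (a b : k) : k * k * k := ((a - b)^-1, - (a + b) / (a - b), a * b / (a - b)).

Definition qadd u v : k * k * k := (u.1.1 + v.1.1, u.1.2 + v.1.2, u.2 + v.2).
Definition qscale (c : k) u : k * k * k := (c * u.1.1, c * u.1.2, c * u.2).
Definition qzero : k * k * k := (0, 0, 0).

Definition qsum (T : Type) (r : seq T) (f : T -> k * k * k) : k * k * k :=
  (\sum_(x <- r) (f x).1.1, \sum_(x <- r) (f x).1.2, \sum_(x <- r) (f x).2).

(* The polarised discriminant, i.e. the Killing form of sl2. *)
Definition qform u v := u.1.2 * v.1.2 - 2%:R * (u.1.1 * v.2) - 2%:R * (v.1.1 * u.2).

Definition qbracket u v : k * k * k :=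
  (u.1.1 * v.1.2 - v.1.1 * u.1.2, 2%:R * (u.1.1 * v.2 - v.1.1 * u.2),
   u.1.2 * v.2 - v.1.2 * u.2).

Definition mdet m := m.1.1.1 * m.2 - m.1.1.2 * m.1.2.

(* Pull-back of vector fields along a Moebius map. *)
Definition qact m u : k * k * k :=
  ((u.1.1 * m.1.1.1 ^+ 2 + u.1.2 * m.1.1.1 * m.1.2 + u.2 * m.1.2 ^+ 2) / mdet m,
   (2%:R * u.1.1 * m.1.1.1 * m.1.1.2 + u.1.2 * (m.1.1.1 * m.2 + m.1.1.2 * m.1.2)
     + 2%:R * u.2 * m.1.2 * m.2) / mdet m,
   (u.1.1 * m.1.1.2 ^+ 2 + u.1.2 * m.1.1.2 * m.2 + u.2 * m.2 ^+ 2) / mdet m).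

Definition mob m t := (m.1.1.1 * t + m.1.1.2) / (m.1.2 * t + m.2).

Lemma quad_eq u v : u.1.1 = v.1.1 -> u.1.2 = v.1.2 -> u.2 = v.2 -> u = v.
Proof. by case: u v => [[a b] c] [[a' b'] c'] /= -> -> ->. Qed.

Lemma mob_sub m a b : m.1.2 * a + m.2 != 0 -> m.1.2 * b + m.2 != 0 ->
  mob m a - mob m b = mdet m * (a - b) / ((m.1.2 * a + m.2) * (m.1.2 * b + m.2)).
Proof. by move=> a0 b0; rewrite /mob /mdet; field; rewrite a0 b0. Qed.

Lemma qvec_qact m a b : mdet m != 0 -> m.1.2 * a + m.2 != 0 -> m.1.2 * b + m.2 != 0 ->
  qvec a b = qact m (qvec (mob m a) (mob m b)).
Proof.
(* For [a = b] both sides are zero, because [0^-1 = 0]. *)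
move=> D0 a0 b0; have [->|ab] := eqVneq a b.
  by rewrite /qvec /qact !subrr !invr0 !mulr0 !mul0r !addr0 mul0r.
have ab0 : a - b != 0 by rewrite subr_eq0.
rewrite /qvec /qact mob_sub // /mob.
move: D0; rewrite /mdet; case: m a0 b0 => [[[al be] ga] de] /= a0 b0 D0.
by apply: quad_eq => /=; field; rewrite ?ab0 ?a0 ?b0 ?D0.
Qed.

Lemma qact_add m u v : qact m (qadd u v) = qadd (qact m u) (qact m v).
Proof. by apply: quad_eq => /=; ring. Qed.

Lemma qact_scale m c u : qact m (qscale c u) = qscale c (qact m u).
Proof. by apply: quad_eq => /=; ring. Qed.

Lemma qact0 m : qact m qzero = qzero.
Proof. by apply: quad_eq => /=; ring. Qed.

Lemma qsum_nil (T : Type) (f : T -> k * k * k) : qsum [::] f = qzero.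
Proof. by rewrite /qsum !big_nil. Qed.

Lemma qsum_cons (T : Type) x (r : seq T) (f : T -> k * k * k) :
  qsum (x :: r) f = qadd (f x) (qsum r f).
Proof. by rewrite /qsum !big_cons. Qed.

Lemma qsum_qact (T : eqType) (r : seq T) m (f g : T -> k * k * k) :
  (forall x, x \in r -> f x = qact m (g x)) -> qsum r f = qact m (qsum r g).
Proof.
elim: r => [|x r IH] h; first by rewrite !qsum_nil qact0.
rewrite !qsum_cons qact_add h ?mem_head // IH // => y yr.
by apply: h; rewrite inE yr orbT.
Qed.

Lemma qform_qact m u v : mdet m != 0 -> qform (qact m u) (qact m v) = qform u v.
Proof.
rewrite /qform /qact /mdet; case: m => [[[al be] ga] de] /= D0.
by field; rewrite D0.
Qed.

Lemma qbracket_qact m u v : mdet m != 0 ->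
  qbracket (qact m u) (qact m v) = qact m (qbracket u v).
Proof.
rewrite /qbracket /qact /mdet; case: m => [[[al be] ga] de] /= D0.
by apply: quad_eq => /=; field; rewrite D0.
Qed.

Definition qcomb (a b c : k) u v := qadd (qadd (qscale a u) (qscale b v)) (qscale c (qbracket u v)).

Lemma qact_comb m a b c u v : mdet m != 0 ->
  qact m (qcomb a b c u v) = qcomb a b c (qact m u) (qact m v).
Proof. by move=> D0; rewrite /qcomb !qact_add !qact_scale qbracket_qact. Qed.

(** The bracket is orthogonal to [u] and [v], and its norm is minus their Gram determinant. Hence
    the form on the three vectors is known from the Gram matrix of [u] and [v] alone. *)
Lemma qform_comb a b c u v : qform (qcomb a b c u v) (qcomb a b c u v) =
  a ^+ 2 * qform u u + 2%:R * (a * b) * qform u v + b ^+ 2 * qform v v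
  + c ^+ 2 * (qform u v ^+ 2 - qform u u * qform v v).
Proof. by rewrite /qform /qcomb /qadd /qscale /qbracket /=; ring. Qed.

(* The first coordinate of the exterior product, a test of independence. *)
Definition qwedge u v := u.1.1 * v.1.2 - v.1.1 * u.1.2.

(** Pairing with the bracket, orthogonal to [u] and [v], isolates [c]; the wedge then takes care of
    [a] and [b]. *)
Lemma qcomb_neq0 a b c u v : qwedge u v != 0 -> (a, b, c) != (0, 0, 0) ->
  c = 0 \/ qform u v ^+ 2 - qform u u * qform v v != 0 -> qcomb a b c u v <> qzero.
Proof.
move=> w0 abc hc E.
have c0 : c = 0.
  case: hc => // N0; apply/eqP.
  have : qform (qcomb a b c u v) (qbracket u v) = c * (qform u v ^+ 2 - qform u u * qform v v).
    by rewrite /qform /qcomb /qadd /qscale /qbracket /=; ring.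
  rewrite E /qform /qzero /= => /esym/eqP.
  by rewrite !(mul0r, mulr0) !subr0 mulf_eq0 (negbTE N0) orbF.
move: E; rewrite c0 /qcomb /qadd /qscale /qzero => -[]; rewrite !mul0r !addr0 => E1 E2 _.
have ha : a * qwedge u v = 0.
  have -> : a * qwedge u v = (a * u.1.1 + b * v.1.1) * v.1.2 - (a * u.1.2 + b * v.1.2) * v.1.1.
    by rewrite /qwedge; ring.
  by rewrite E1 E2 !mul0r subrr.
have hb : b * qwedge u v = 0.
  have -> : b * qwedge u v = u.1.1 * (a * u.1.2 + b * v.1.2) - u.1.2 * (a * u.1.1 + b * v.1.1).
    by rewrite /qwedge; ring.
  by rewrite E1 E2 !mulr0 subrr.
move/eqP: ha; move/eqP: hb; rewrite !mulf_eq0 (negbTE w0) !orbF => /eqP b0 /eqP a0.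
by move: abc; rewrite a0 b0 c0 eqxx.
Qed.

(* [qsquare p q] is [(q t - p)^2], with the double root [p / q]. *)
Definition qsquare (p q : k) : k * k * k := (q ^+ 2, - 2%:R * (p * q), p ^+ 2).

Definition mp m (p q : k) := p * m.2 - q * m.1.1.2.
Definition mq m (p q : k) := q * m.1.1.1 - p * m.1.2.

Lemma qact_square m p q : qact m (qsquare p q) =
  (mq m p q ^+ 2 / mdet m, - 2%:R * (mp m p q * mq m p q) / mdet m, mp m p q ^+ 2 / mdet m).
Proof. by apply: quad_eq => /=; rewrite /mp /mq; ring. Qed.

(** The square of [q P - Q p] is bilinear in the coordinates of the two quadratics, so the
    comparison needs no division by 2. *)
Lemma qsquare_root m p q p' q' : mdet m != 0 ->
  qsquare p q = qact m (qsquare p' q') -> q * mp m p' q' = mq m p' q' * p.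
Proof.
move=> D0; rewrite qact_square; set P := mp _ _ _; set Q := mq _ _ _.
case=> E1 E2 E3; apply/eqP; rewrite -subr_eq0 -sqrf_eq0.
have -> : (q * P - Q * p) ^+ 2 = q ^+ 2 * P ^+ 2 + Q ^+ 2 * p ^+ 2 + - 2%:R * (p * q) * (P * Q).
  by ring.
rewrite E1 E2 E3; apply/eqP; field; exact: D0.
Qed.

(** A zero discriminant means a double root. Square roots of [A] and [C] give it up to a sign, which
    [B] fixes; in characteristic 2 the hypothesis says [B = 0]. *)
Lemma isotropic_square (K : closedFieldType) (A B C : K) :
  B ^+ 2 - 2%:R * (A * C) - 2%:R * (A * C) = 0 ->
  exists p q : K, (q ^+ 2, - 2%:R * (p * q), p ^+ 2) = (A, B, C).
Proof.
have sq (x : K) : exists y, y ^+ 2 = x.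
  have [y] := @solve_monicpoly K 2 (fun i => if i is 0%N then x else 0) isT.
  by rewrite !big_ord_recl big_ord0 /= mulr1 mul0r !addr0 => <-; exists y.
move=> D0; have [q qA] := sq A; have [p pC] := sq C.
have : B ^+ 2 = (- 2%:R * (p * q)) ^+ 2.
  have -> : (- 2%:R * (p * q)) ^+ 2 = 4%:R * (q ^+ 2 * p ^+ 2) by ring.
  rewrite qA pC; apply/eqP; rewrite -subr_eq0; apply/eqP; rewrite -[RHS]D0; ring.
move/eqP; rewrite eqf_sqr => /orP[] /eqP ->.
  by exists p, q; rewrite qA pC.
exists (- p), q; rewrite qA sqrrN pC; congr (_, _, _); ring.
Qed.

(* The affine coordinate with pole [p / q], value [0] at [a] and [1] at [b]. *)
Definition qcr (p q t a b : k) := (p - q * b) * (t - a) / ((a - b) * (q * t - p)).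

Lemma qcr_prop p q p' q' t a b : q * p' = q' * p -> q * t - p != 0 -> q' * t - p' != 0 ->
  qcr p q t a b = qcr p' q' t a b.
Proof.
move=> E h h'; have [->|ab] := eqVneq a b; first by rewrite /qcr subrr !mul0r invr0 !mulr0.
have ab0 : a - b != 0 by rewrite subr_eq0.
apply/eqP; rewrite /qcr eqr_div ?mulf_neq0 //; apply/eqP.
have -> : (p - q * b) * (t - a) * ((a - b) * (q' * t - p')) =
  (t - a) * (a - b) * ((p' - q' * b) * (q * t - p) + (q * p' - q' * p) * (b - t)) by ring.
by rewrite E subrr mul0r addr0; ring.
Qed.

(* The value at [mob m t], written so as to make sense when [mob m t] is infinite. *)
Lemma qcr_moebius m p q t a b : mdet m != 0 ->
  m.1.2 * a + m.2 != 0 -> m.1.2 * b + m.2 != 0 -> mq m p q * t - mp m p q != 0 ->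
  qcr (mp m p q) (mq m p q) t a b =
  (p - q * mob m b) * (m.1.1.1 * t + m.1.1.2 - mob m a * (m.1.2 * t + m.2)) /
  ((mob m a - mob m b) * (mq m p q * t - mp m p q)).
Proof.
move=> D0 a0 b0 h; have [->|ab] := eqVneq a b.
  by rewrite /qcr !subrr !mul0r invr0 !mulr0.
have ab0 : a - b != 0 by rewrite subr_eq0.
rewrite mob_sub // /qcr; move: h D0; rewrite /mp /mq /mob /mdet.
case: m a0 b0 => [[[al be] ga] de] /= a0 b0 h D0.
by field; rewrite ?ab0 ?a0 ?b0 ?D0 ?h.
Qed.

End BinaryQuadratics.

Section Legendre.
Variable k : closedFieldType.
Implicit Types (a b c : {poly k}).

Lemma closed_root_exists (x : k) n : (0 < n)%N -> exists y, y ^+ n = x.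
Proof.
move=> n0; have [y] := @solve_monicpoly k n (fun i => if i is 0%N then x else 0) n0.
case: n n0 y => // n _ y E; exists y; rewrite E big_ord_recl /= mulr1 big1 ?addr0 // => i _.
by rewrite mul0r.
Qed.

Lemma interpolation (s : seq k) (v : k -> k) : uniq s ->
  exists2 c : {poly k}, (size c <= size s)%N & forall x, x \in s -> c.[x] = v x.
Proof.
elim: s => [|x s IH] /=; first by exists 0; rewrite ?size_poly0.
move=> /andP[xs /IH[c sc hc]]; pose P := \prod_(z <- s) ('X - z%:P).
have Px : P.[x] != 0 by rewrite -/(root P x) root_prod_XsubC.
exists (c + ((v x - c.[x]) / P.[x]) *: P).
  apply: leq_trans (size_polyD _ _) _; rewrite geq_max (leq_trans sc) //=.
  by apply: leq_trans (size_scale_leq _ _) _; rewrite size_prod_XsubC.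
move=> y; rewrite inE hornerD hornerZ => /orP[/eqP ->|ys]; first by rewrite divfK // addrC subrK.
have /eqP -> : P.[y] == 0 by rewrite -/(root P y) root_prod_XsubC.
by rewrite mulr0 addr0 hc.
Qed.

Lemma not_uniq_rem (T : eqType) (s : seq T) : ~~ uniq s -> exists2 r, r \in s & r \in rem r s.
Proof.
elim: s => //= x s IH; rewrite negb_and negbK => /orP[xs|/IH[r rs rr]].
  by exists x; rewrite ?mem_head ?eqxx.
exists r; first by rewrite inE rs orbT.
by case: eqP => [//|_]; rewrite inE rr orbT.
Qed.

(* Legendre's descent: every residue class is a square modulo a squarefree [b],
   so [c ^ 2 - a = b b'] with [b'] smaller, and norms from [k(S)(sqrt a)] multiply. *)
Lemma legendre a b : exists x y z, (x, y, z) != (0, 0, 0) :> {poly k} * {poly k} * {poly k} /\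
  a * x ^+ 2 + b * y ^+ 2 = z ^+ 2.
Proof.
have [n] := ubnP (size a + size b); elim: n a b => // n IH a b.
wlog ab : a b / (size a <= size b)%N.
  move=> W sab; have [ab|/ltnW ba] := leqP (size a) (size b); first exact: W.
  have [|x [y [z [nz E]]]] := W b a ba _; first by rewrite addnC.
  exists y, x, z; split; last by rewrite addrC.
  by apply: contraNneq nz => -[-> -> ->].
(* A constant [a] is a square, which gives a solution at once. *)
move=> sab; have [sa|sa] := leqP (size a) 1.
  have [al hal] := @closed_root_exists a`_0 2 isT; exists 1, 0, al%:P.
  split; first by apply/eqP => -[/eqP]; rewrite oner_eq0.
  by rewrite (size1_polyC sa) expr1n mulr1 expr0n mulr0 addr0 -polyC_exp hal.
have b0 : b != 0 by rewrite -size_poly_gt0 (leq_trans _ ab) // ltnW.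
have lb : lead_coef b != 0 by rewrite lead_coef_eq0.
have [s bE] := closed_field_poly_normal b.
(* A square factor of [b] is removed; a solution for the quotient is carried back by multiplying [x]
   and [z] by its root. *)
have [us|] := boolP (uniq s); last first.
  move=> /not_uniq_rem[r rs rr]; pose s' := rem r (rem r s).
  have bE' : b = ('X - r%:P) ^+ 2 * (lead_coef b *: \prod_(z <- s') ('X - z%:P)).
    rewrite {1}bE (perm_big _ (perm_to_rem rs)) big_cons (perm_big _ (perm_to_rem rr)) big_cons.
    by rewrite /= expr2 -scalerAr mulrA.
  set b1 := _ *: _ in bE'.
  have b10 : b1 != 0 by apply: contraNneq b0 => E; rewrite bE' E mulr0.
  have [|x [y [z [nz E]]]] := IH a b1.
    rewrite -ltnS; apply: leq_trans sab; rewrite ltnS ltn_add2l bE'.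
    rewrite size_mul ?expf_neq0 ?polyXsubC_eq0 // size_exp_XsubC /=.
    by rewrite addSn /= ltnW.
  exists (('X - r%:P) * x), y, (('X - r%:P) * z); split; last first.
    by rewrite !exprMn -E [in LHS]bE'; ring.
  apply: contraNneq nz => -[/eqP E1 -> /eqP E2]; move: E1 E2.
  by rewrite !mulf_eq0 polyXsubC_eq0 /= => /eqP -> /eqP ->.
have /fin_all_exists[sq hsq] : forall x : seq_sub s, exists y, y ^+ 2 = a.[ssval x].
  by move=> x; exact: closed_root_exists.
pose v x := if insub x is Some y then sq y else 0.
have [c sc hc] := interpolation v us.
have ss : size b = (size s).+1 by rewrite bE size_scale // size_prod_XsubC.
have [b' hb'] : exists b', c ^+ 2 - a = b' * b.
  have /dvdpP[q hq] : \prod_(z <- s) ('X - z%:P) %| c ^+ 2 - a.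
    apply: uniq_roots_dvdp; last by rewrite uniq_rootsE.
    apply/allP => x xs; rewrite /root hornerD hornerN horner_exp hc // /v insubT hsq /=.
    by rewrite subrr.
  by exists ((lead_coef b)^-1 *: q); rewrite hq [in X in _ = _ * X]bE -scalerAl -scalerAr scalerA mulVf ?scale1r.
have [b'0|b'0] := eqVneq b' 0.
  exists 1, 0, c; split; first by apply/eqP => -[/eqP]; rewrite oner_eq0.
  move: hb'; rewrite b'0 mul0r => /eqP; rewrite subr_eq0 => /eqP ->.
  by rewrite expr1n mulr1 expr0n mulr0 addr0.
(* The degree of [c] is below that of [b], and that of [a] is at most that of [b]; so
   [c ^ 2 - a = b' b] forces [b'] to have smaller degree than [b]. *)
have [|x [y [z [nz E]]]] := IH a b'.
  rewrite -ltnS; apply: leq_trans sab; rewrite ltnS ltn_add2l.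
  have : (size (c ^+ 2 - a)%R <= maxn (size (c ^+ 2)%R) (size a))%N.
    by apply: leq_trans (size_polyD _ _) _; rewrite size_polyN.
  rewrite hb' size_mul // ss addnS /=.
  have : (size (c ^+ 2)%R <= ((size c).-1 * 2).+1)%N by exact: size_poly_exp_leq.
  move: sc ab sa; rewrite ss.
  move: (size b') (size (c ^+ 2)%R) (size a) (size c) (size s) => n1 n2 n3 n4 n5; lia.
have [y0|y0] := eqVneq y 0.
  exists x, 0, z; split; first by move: nz; rewrite y0.
  by rewrite -E y0 expr0n !mulr0.
exists (z + c * x), (b' * y), (z * c + a * x); split.
  apply/eqP => -[_ /eqP]; rewrite mulf_eq0 (negbTE b'0) (negbTE y0) //.
have -> : a = c ^+ 2 - b' * b by rewrite -hb'; ring.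
have := E; have -> : a = c ^+ 2 - b' * b by rewrite -hb'; ring.
move=> {}E; apply/eqP; rewrite -subr_eq0.
rewrite [X in X == 0](_ : _ = b' * b * ((c ^+ 2 - b' * b) * x ^+ 2 + b' * y ^+ 2 - z ^+ 2)).
  by rewrite E subrr mulr0.
ring.
Qed.

(* Tsen's theorem for the conic attached to a rational curve; the multiplier
   [e ^ 2] clears the common denominator [e] of the three coefficients. *)
Lemma conic_point (E0 E01 E1 e : {poly k}) : e != 0 -> exists a b c,
  [/\ (a, b, c) != (0, 0, 0), c = 0 \/ E01 ^+ 2 - E0 * E1 != 0 &
   a ^+ 2 * E0 + 2%:R * (a * b) * E01 + b ^+ 2 * E1 + e * c ^+ 2 * (E01 ^+ 2 - E0 * E1) = 0].
Proof.
move=> e0; set N := E01 ^+ 2 - E0 * E1.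
have [E00|E00] := eqVneq E0 0.
  exists 1, 0, 0; split; [|by left|by rewrite E00; ring].
  by apply/eqP => -[/eqP]; rewrite oner_eq0.
(* The Gram matrix is singular, as is always the case in characteristic 2, where [qform] is the
   product of the middle coefficients. The combination orthogonal to the first vector is then
   isotropic. *)
have [N0|N0] := eqVneq N 0.
  exists (- E01), E0, 0; split; [|by left|].
    by apply: contraNneq E00 => -[_ ->].
  have h : E0 * E1 = E01 ^+ 2 by apply/eqP; rewrite eq_sym -subr_eq0; apply/eqP.
  rewrite N0 mulr0 addr0; transitivity (E0 * (E0 * E1 - E01 ^+ 2)); first by ring.
  by rewrite h subrr mulr0.
(* Completing the square in the first variable turns the conic into
   [x ^ 2 = N y ^ 2 - E0 e N z ^ 2]. *)
have [y [z [x [nz E]]]] := legendre N (- (E0 * e * N)).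
exists (x - E01 * y), (E0 * y), (E0 * z); split; [|by right|].
  apply: contraNneq nz => -[h1 /eqP h2 /eqP h3].
  move: h1 h2 h3; rewrite !mulf_eq0 (negbTE E00) /= => h1 /eqP y0 /eqP z0.
  by move: h1; rewrite y0 z0 mulr0 subr0 => ->.
transitivity (E0 * (x ^+ 2 - (N * y ^+ 2 + - (E0 * e * N) * z ^+ 2)) ).
  by rewrite /N; ring.
by rewrite E subrr mulr0.
Qed.
End Legendre.

(** * The canonical coordinate of a level curve *)

Section CanonicalCoordinate.
Variables (k : closedFieldType) (F : poly2 k) (lam : k) (m : nat).
Let f := F - lam%:P%:P.
Hypotheses (fP : primeA f) (sF : (1 < size F)%N).
(* [r l] lists the points of [F = lam] on the line [X = ln l]. *)
Variables (ln : 'I_3 -> k) (r : 'I_3 -> seq k).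

Definition wt := (('I_3 * 'I_m) * ('I_3 * 'I_m))%type.
Implicit Types (u v : prm k) (h : wt).

(** A sum over all points of two lines does not depend on their order; the weights [z ^ i * z' ^ j]
    are there to recover the single terms. *)
Definition dsum h (g : k -> k -> k) :=
  \sum_(z <- r h.1.1) \sum_(z' <- r h.2.1) z ^+ h.1.2 * z' ^+ h.2.2 * g z z'.

Lemma dsum_eq h g g' : (forall z z', z \in r h.1.1 -> z' \in r h.2.1 -> g z z' = g' z z') ->
  dsum h g = dsum h g'.
Proof.
move=> E; apply: eq_big_seq => z zr; apply: eq_big_seq => z' zr'.
by rewrite E.
Qed.

Lemma dsumB h g g' : dsum h (fun z z' => g z z' - g' z z') = dsum h g - dsum h g'.
Proof.
rewrite /dsum -sumrB; apply: eq_bigr => z _; rewrite -sumrB; apply: eq_bigr => z' _.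
by rewrite mulrBr.
Qed.

Lemma dsumMr h g c : dsum h (fun z z' => g z z' * c) = dsum h g * c.
Proof.
rewrite /dsum mulr_suml; apply: eq_bigr => z _; rewrite mulr_suml; apply: eq_bigr => z' _.
by rewrite mulrA.
Qed.

Definition tl u l z := tau u (ln l) z.

Definition all_good u := forall l z, z \in r l -> good u (ln l) z (tl u l z).

(* These fields see the parameter only through its values at the points [r l], so
   they are transported by Moebius changes of parameter. *)
Definition ufield u h : k * k * k :=
  qsum (r h.1.1) (fun z => qsum (r h.2.1) (fun z' =>
    qscale (z ^+ h.1.2 * z' ^+ h.2.2) (qvec (tl u h.1.1 z) (tl u h.2.1 z')))).

Definition tcoord u h p q t := dsum h (fun z z' => qcr p q t (tl u h.1.1 z) (tl u h.2.1 z')).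

(** Up to sign, the determinant of the homography from [t] to [tcoord]; see [tcoordE] and
    [slopeE]. *)
Definition slope u h p q := dsum h (fun z z' =>
  (p - q * tl u h.1.1 z) * (p - q * tl u h.2.1 z') / (tl u h.1.1 z - tl u h.2.1 z')).

Section Lagrange.
Hypotheses (ur : forall l, uniq (r l)) (sr : forall l, (size (r l) <= m)%N).

Lemma lagrange l z0 : z0 \in r l ->
  exists L : 'I_m -> k, forall z, z \in r l -> \sum_i L i * z ^+ i = (z == z0)%:R.
Proof.
move=> z0r; have [c sc hc] := interpolation (fun z => (z == z0)%:R) (ur l).
exists (fun i => c`_i) => z zr; rewrite -hc // (@horner_coef_wide _ m) //.
exact: leq_trans sc (sr l).
Qed.

(** Lagrange polynomials in each ordinate; their degrees stay below [m] since no line carries more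
    than [m] points. *)
Lemma dsum_separate l l' z0 z0' : z0 \in r l -> z0' \in r l' ->
  exists L : 'I_m -> 'I_m -> k, forall g,
    \sum_i \sum_j L i j * dsum ((l, i), (l', j)) g = g z0 z0'.
Proof.
move=> zr zr'; have [L hL] := lagrange zr; have [L' hL'] := lagrange zr'.
exists (fun i j => L i * L' j) => g.
transitivity (\sum_(z <- r l) \sum_(z' <- r l') (z == z0)%:R * (z' == z0')%:R * g z z').
  transitivity (\sum_i \sum_j \sum_(z <- r l) \sum_(z' <- r l')
      (L i * z ^+ i) * (L' j * z' ^+ j) * g z z').
    apply: eq_bigr => i _; apply: eq_bigr => j _; rewrite /dsum /= mulr_sumr.
    by apply: eq_bigr => z _; rewrite mulr_sumr; apply: eq_bigr => z' _; ring.
  under eq_bigr => i _ do rewrite exchange_big /=.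
  rewrite exchange_big /=; apply: eq_big_seq => z zz.
  under eq_bigr => i _ do rewrite exchange_big /=.
  rewrite exchange_big /=; apply: eq_big_seq => z' zz'.
  rewrite -(hL _ zz) -(hL' _ zz') !mulr_suml; apply: eq_bigr => i _.
  by rewrite mulr_sumr mulr_suml.
rewrite (bigD1_seq z0) //= [X in _ + X]big1 ?addr0 => [|z zn]; last first.
  by rewrite big1 // => z' _; rewrite (negbTE zn) !mul0r.
rewrite (bigD1_seq z0') //= [X in _ + X]big1 ?addr0 => [|z zn]; last first.
  by rewrite (negbTE zn) mulr0 mul0r.
by rewrite !eqxx !mul1r.
Qed.

Hypothesis ln_inj : injective ln.
Hypothesis rn0 : forall l, exists z, z \in r l.
Variables (u : prm k).
Hypotheses (hu : par F lam u) (gu : all_good u).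

Lemma tl_inj l l' z z' : l != l' -> z \in r l -> z' \in r l' -> tl u l z != tl u l' z'.
Proof.
move=> ll zr zr'; apply: contraNneq ll => E; apply/eqP/ln_inj.
have [<- _] := goodE (gu zr); have [<- _] := goodE (gu zr').
by rewrite -!/(tl u _ _) E.
Qed.

(** If all wedges vanished, separation would make the single fields with zeros [a, b] and [a, c]
    proportional, for parameters on three different lines; but their wedge is
    [(b - c) / ((a - b) (a - c))]. Here the third line is needed. *)
Lemma ufield_indep : exists h h', qwedge (ufield u h) (ufield u h') != 0.
Proof.
apply: NNPP => nh.
have nw h h' : (ufield u h).1.1 * (ufield u h').1.2 = (ufield u h').1.1 * (ufield u h).1.2.
  apply/eqP; rewrite -subr_eq0; apply/negPn/negP => w0; apply: nh; by exists h, h'.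
pose l0 : 'I_3 := inord 0; pose l1 : 'I_3 := inord 1; pose l2 : 'I_3 := inord 2.
have n01 : l0 != l1 by rewrite -val_eqE /= !inordK.
have n02 : l0 != l2 by rewrite -val_eqE /= !inordK.
have n12 : l1 != l2 by rewrite -val_eqE /= !inordK.
have [z0 r0] := rn0 l0; have [z1 r1] := rn0 l1; have [z2 r2] := rn0 l2.
have [L hL] := dsum_separate r0 r1; have [L' hL'] := dsum_separate r0 r2.
pose gA l l' z z' := (qvec (tl u l z) (tl u l' z')).1.1.
pose gB l l' z z' := (qvec (tl u l z) (tl u l' z')).1.2.
have UA h : (ufield u h).1.1 = dsum h (gA h.1.1 h.2.1) by [].
have UB h : (ufield u h).1.2 = dsum h (gB h.1.1 h.2.1) by [].
have step1 h : gA l0 l1 z0 z1 * (ufield u h).1.2 = (ufield u h).1.1 * gB l0 l1 z0 z1.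
  rewrite -!hL mulr_suml mulr_sumr; apply: eq_bigr => i _.
  rewrite mulr_suml mulr_sumr; apply: eq_bigr => j _.
  by rewrite -mulrA -(UA ((l0, i), (l1, j))) nw -UB mulrCA.
have : gA l0 l1 z0 z1 * gB l0 l2 z0 z2 = gA l0 l2 z0 z2 * gB l0 l1 z0 z1.
  rewrite -!hL' mulr_suml mulr_sumr; apply: eq_bigr => i _.
  rewrite mulr_suml mulr_sumr; apply: eq_bigr => j _.
  by rewrite mulrCA -(UB ((l0, i), (l2, j))) step1 -UA mulrA.
have := tl_inj n01 r0 r1; have := tl_inj n02 r0 r2; have := tl_inj n12 r1 r2.
rewrite /gA /gB /qvec /=; move: (tl u l0 z0) (tl u l1 z1) (tl u l2 z2) => a b c.
rewrite -subr_eq0 => bc; rewrite -subr_eq0 => ac; rewrite -subr_eq0 => ab /eqP.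
rewrite -subr_eq0 (_ : _ - _ = (b - c) / ((a - b) * (a - c))); last first.
  by field; rewrite ab ac.
by rewrite mulf_eq0 invr_eq0 mulf_eq0 (negbTE ab) (negbTE ac) (negbTE bc).
Qed.

(** Points on different lines have different parameters, so the pole is met on at most one of three
    lines; on the other two a single term of the sum is nonzero. *)
Lemma slope_exists p q : (p, q) != (0, 0) -> exists h, slope u h p q != 0.
Proof.
move=> pq.
have key l l' z z' : l != l' -> z \in r l -> z' \in r l' ->
    (p - q * tl u l z) != 0 -> (p - q * tl u l' z') != 0 -> exists h, slope u h p q != 0.
  move=> ll zr zr' P0 P1; apply: NNPP => nh; have [L hL] := dsum_separate zr zr'.
  have := hL (fun a b => (p - q * tl u l a) * (p - q * tl u l' b) / (tl u l a - tl u l' b)).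
  rewrite big1 => [/esym/eqP|i _].
    rewrite !mulf_eq0 invr_eq0 (negbTE P0) (negbTE P1) subr_eq0 /=; apply/negP.
    exact: tl_inj.
  rewrite big1 // => j _; rewrite -/(slope u ((l, i), (l', j)) p q).
  have [->|S0] := eqVneq (slope u ((l, i), (l', j)) p q) 0; first by rewrite mulr0.
  by case: nh; exists ((l, i), (l', j)).
have zero2 a b : p - q * a = 0 -> p - q * b = 0 -> a = b.
  move=> /eqP; rewrite subr_eq0 => /eqP pE /eqP; rewrite pE -mulrBr mulf_eq0 => /orP[/eqP q0|].
    by move: pq; rewrite pE q0 mul0r eqxx.
  by rewrite subr_eq0 => /eqP.
pose l0 : 'I_3 := inord 0; pose l1 : 'I_3 := inord 1; pose l2 : 'I_3 := inord 2.
have n01 : l0 != l1 by rewrite -val_eqE /= !inordK.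
have n02 : l0 != l2 by rewrite -val_eqE /= !inordK.
have n12 : l1 != l2 by rewrite -val_eqE /= !inordK.
have [z0 r0] := rn0 l0; have [z1 r1] := rn0 l1; have [z2 r2] := rn0 l2.
have [E0|P0] := eqVneq (p - q * tl u l0 z0) 0.
  apply: (key l1 l2 z1 z2) => //; apply/eqP => E; first by move/eqP: (tl_inj n01 r0 r1); apply; exact: zero2.
  by move/eqP: (tl_inj n02 r0 r2); apply; exact: zero2.
have [E1|P1] := eqVneq (p - q * tl u l1 z1) 0.
  apply: (key l0 l2 z0 z2) => //; apply/eqP => E.
  by move/eqP: (tl_inj n12 r1 r2); apply; exact: zero2.
exact: (key l0 l1 z0 z1).
Qed.

End Lagrange.

Lemma frames_moebius u v : par F lam u -> par F lam v -> all_good u -> all_good v ->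
  exists mm, [/\ moebius_rel u v mm, mdet mm != 0 & forall l z, z \in r l ->
    mm.1.2 * tl u l z + mm.2 != 0 /\ tl v l z = mob mm (tl u l z)].
Proof.
move=> hu hv gu gv; have [mm hm] := par_moebius fP sF hu hv; exists mm; split=> //.
  exact: moebius_det hm.
by move=> l z zr; apply: (good_moebius hu hv hm (gu _ _ zr)); exact: gv.
Qed.

Lemma ufield_qact u v mm h :
  mdet mm != 0 -> (forall l z, z \in r l ->
    mm.1.2 * tl u l z + mm.2 != 0 /\ tl v l z = mob mm (tl u l z)) ->
  ufield u h = qact mm (ufield v h).
Proof.
move=> D0 ht; apply: qsum_qact => z zr; apply: qsum_qact => z' zr'.
have [d1 ->] := ht _ _ zr; have [d2 ->] := ht _ _ zr'.
by rewrite qact_scale -qvec_qact.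
Qed.

Lemma gram_invariant u v h h' : par F lam u -> par F lam v -> all_good u -> all_good v ->
  qform (ufield u h) (ufield u h') = qform (ufield v h) (ufield v h').
Proof.
move=> hu hv gu gv; have [mm [_ D0 ht]] := frames_moebius hu hv gu gv.
by rewrite !(ufield_qact _ D0 ht) qform_qact.
Qed.

Definition tnum u h p q := dsum h (fun z z' =>
  (p - q * tl u h.2.1 z') / (tl u h.1.1 z - tl u h.2.1 z')).
Definition tden u h p q := dsum h (fun z z' =>
  tl u h.1.1 z * (p - q * tl u h.2.1 z') / (tl u h.1.1 z - tl u h.2.1 z')).

Lemma tcoordE u h p q t : q * t - p != 0 ->
  tcoord u h p q t = (tnum u h p q * t - tden u h p q) / (q * t - p).
Proof.
move=> h0; rewrite /tcoord /tnum /tden -dsumMr -dsumB -dsumMr; apply: dsum_eq => z z' _ _.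
rewrite /qcr invfM; ring.
Qed.

Lemma slopeE u h p q : slope u h p q = tnum u h p q * p - tden u h p q * q.
Proof.
rewrite /slope /tnum /tden -!dsumMr -dsumB; apply: dsum_eq => z z' _ _; ring.
Qed.

Section TwoFrames.
Variables (u v : prm k) (h : wt) (a b c : k) (h0 h1 : wt) (p q p' q' : k).
Hypotheses (hu : par F lam u) (hv : par F lam v) (gu : all_good u) (gv : all_good v).
Hypotheses (pqu : qsquare p q = qcomb a b c (ufield u h0) (ufield u h1))
  (pqv : qsquare p' q' = qcomb a b c (ufield v h0) (ufield v h1)).

Lemma frames_root mm : mdet mm != 0 -> (forall l z, z \in r l ->
    mm.1.2 * tl u l z + mm.2 != 0 /\ tl v l z = mob mm (tl u l z)) ->
  q * mp mm p' q' = mq mm p' q' * p.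
Proof.
move=> D0 ht; apply: (qsquare_root D0).
by rewrite pqu pqv qact_comb // -!(ufield_qact _ D0 ht).
Qed.

Lemma mq_mp mm t : mq mm p' q' * t - mp mm p' q' =
  q' * (mm.1.1.1 * t + mm.1.1.2) - p' * (mm.1.2 * t + mm.2).
Proof. by rewrite /mq /mp; ring. Qed.

Lemma mqp_neq0 mm t : mdet mm != 0 -> q * mp mm p' q' = mq mm p' q' * p ->
  (p', q') != (0, 0) -> q * t - p != 0 -> mq mm p' q' * t - mp mm p' q' != 0.
Proof.
move=> D0 E pq0 h0'; apply/eqP => E0.
have q0 : mq mm p' q' = 0.
  apply: (mulIf h0'); rewrite mul0r.
  transitivity (q * (mq mm p' q' * t - mp mm p' q') + (q * mp mm p' q' - mq mm p' q' * p)); first by ring.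
  by rewrite E0 E subrr mulr0 addr0.
have p0 : mp mm p' q' = 0 by move/eqP: E0; rewrite q0 mul0r sub0r oppr_eq0 => /eqP.
case/eqP: pq0; congr (_, _); apply: (mulIf D0); rewrite mul0r.
  transitivity (mp mm p' q' * mm.1.1.1 + mq mm p' q' * mm.1.1.2); first by rewrite /mp /mq /mdet; ring.
  by rewrite p0 q0 !mul0r addr0.
transitivity (mp mm p' q' * mm.1.2 + mq mm p' q' * mm.2); first by rewrite /mp /mq /mdet; ring.
by rewrite p0 q0 !mul0r addr0.
Qed.

(** The right-hand side is homogeneous in the numerator and denominator of the Moebius map, so that
    [t] may be sent to infinity. *)
Lemma tcoord_moebius mm t : mdet mm != 0 -> (forall l z, z \in r l ->
    mm.1.2 * tl u l z + mm.2 != 0 /\ tl v l z = mob mm (tl u l z)) ->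
  (p', q') != (0, 0) -> q * t - p != 0 ->
  tcoord u h p q t = (tnum v h p' q' * (mm.1.1.1 * t + mm.1.1.2) - tden v h p' q' * (mm.1.2 * t + mm.2))
    / (q' * (mm.1.1.1 * t + mm.1.1.2) - p' * (mm.1.2 * t + mm.2)).
Proof.
move=> D0 ht pq0 nz; have E := frames_root D0 ht; have nz' := mqp_neq0 D0 E pq0 nz.
rewrite -mq_mp /tcoord /tnum /tden -!dsumMr -dsumB -dsumMr; apply: dsum_eq => z z' zr zr'.
rewrite (qcr_prop _ _ E nz nz'); have [d1 ->] := ht _ _ zr; have [d2 ->] := ht _ _ zr'.
rewrite qcr_moebius // invfM; ring.
Qed.

Lemma tcoord_point x y t t' : (p', q') != (0, 0) ->
  good u x y t -> good v x y t' -> q * t - p != 0 -> q' * t' - p' != 0 ->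
  tcoord u h p q t = tcoord v h p' q' t'.
Proof.
move=> pq0 gt gt' nz nz'; have [mm [hm D0 ht]] := frames_moebius hu hv gu gv.
have [d0 t'E] := good_moebius hu hv hm gt gt'.
rewrite (tcoord_moebius D0 ht) // tcoordE //; rewrite t'E /moebius in nz' *.
set X := mm.1.1.1 * t + _ in nz' *; set Y := mm.1.2 * t + _ in d0 nz' *.
have nz2 : q' * X - p' * Y != 0.
  apply: contraNneq nz' => E0; apply/eqP; apply: (mulIf d0); rewrite mul0r mulrBl -E0.
  by rewrite -mulrA divfK.
by apply/eqP; rewrite eqr_div //; apply/eqP; field.
Qed.

Lemma tcoord_inj x y x' y' t t' : (p', q') != (0, 0) ->
  good u x y t -> good v x' y' t' -> q * t - p != 0 -> q' * t' - p' != 0 ->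
  slope v h p' q' != 0 -> tcoord u h p q t = tcoord v h p' q' t' -> x = x' /\ y = y'.
Proof.
move=> pq0 gt gt' nz nz' sl; have [mm [hm D0 ht]] := frames_moebius hu hv gu gv.
have nz1 := mqp_neq0 D0 (frames_root D0 ht) pq0 nz; rewrite mq_mp in nz1.
rewrite (tcoord_moebius D0 ht) // tcoordE // => /eqP; rewrite eqr_div // => /eqP.
set X := mm.1.1.1 * t + _ in nz1 *; set Y := mm.1.2 * t + _ in nz1 *.
(* As [slope] is nonzero, equal coordinates mean equal projective parameters, [X : Y = t' : 1]. *)
move=> E; have XY : X = t' * Y.
  apply: (mulfI sl); rewrite slopeE; apply/eqP; rewrite -subr_eq0.
  set A := tnum _ _ _ _ in E *; set B := tden _ _ _ _ in E *.
  rewrite [X in X == 0](_ : _ = (A * t' - B) * (q' * X - p' * Y) - (A * X - B * Y) * (q' * t' - p')).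
    by rewrite E mulrC subrr.
  ring.
have Y0 : Y != 0.
  apply/eqP => Y0; rewrite Y0 mulr0 in XY; case/eqP: D0; rewrite /mdet.
  have -> : mm.2 = - (mm.1.2 * t) by apply/eqP; rewrite -addr_eq0 addrC -/Y Y0.
  have -> : mm.1.1.2 = - (mm.1.1.1 * t) by apply/eqP; rewrite -addr_eq0 addrC -/X XY.
  ring.
have tE : moebius mm t = t' by rewrite /moebius -/X -/Y XY mulfK.
have := moebius_eq hm (good_pdef gt) Y0; rewrite tE => /(_ (good_pdef gt')) [].
by have [-> ->] := goodE gt; have [-> ->] := goodE gt'.
Qed.

End TwoFrames.
End CanonicalCoordinate.

(** * Parametrisations as coefficient vectors, and their definability *)

Section Decoding.
Variable k : closedFieldType.

Definition polv N (v : {ffun 'I_N -> k}) : {poly k} := \sum_(i < N) v i *: 'X^i.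

Definition polv2 n D (v : {ffun 'I_n * 'I_D -> k}) : poly2 k :=
  \sum_(j < n) \sum_(i < D) (v (j, i))%:P%:P * ('X%:P) ^+ i * 'X ^+ j.

Lemma horner_polv N (v : {ffun 'I_N -> k}) t : (polv v).[t] = \sum_(i < N) v i * t ^+ i.
Proof. by rewrite horner_sum; apply: eq_bigr => i _; rewrite hornerZ hornerXn. Qed.

Lemma ev2_polv2 n D (v : {ffun 'I_n * 'I_D -> k}) x y :
  ev2 x y (polv2 v) = \sum_(j < n) \sum_(i < D) v (j, i) * x ^+ i * y ^+ j.
Proof.
rewrite /polv2 rmorph_sum; apply: eq_bigr => j _; rewrite rmorph_sum; apply: eq_bigr => i _.
by rewrite /= !ev2M ev2_const !ev2_exp ev2_X ev2_Y.
Qed.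

Lemma polv_surj N (p : {poly k}) : (size p <= N)%N -> exists v : {ffun 'I_N -> k}, polv v = p.
Proof.
move=> sp; exists [ffun i : 'I_N => p`_i]; apply/polyP => i; rewrite coef_sum.
have [iN|iN] := ltnP i N.
  rewrite (bigD1 (Ordinal iN)) //= ffunE coefZ coefXn eqxx mulr1 big1 ?addr0 // => l li.
  by rewrite coefZ coefXn -[_ == _]/(Ordinal iN == l) eq_sym (negbTE li) mulr0.
rewrite nth_default ?(leq_trans sp) // big1 // => l _; rewrite coefZ coefXn gtn_eqF ?mulr0 //.
exact: leq_trans (ltn_ord l) iN.
Qed.

Lemma polv2_surj n D (P : poly2 k) : (size P <= n)%N -> (sizeY P <= D)%N ->
  exists v : {ffun 'I_n * 'I_D -> k}, polv2 v = P.
Proof.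
move=> sP sY; exists [ffun z : 'I_n * 'I_D => P`_z.1`_z.2].
apply/eqP; rewrite -subr_eq0; apply/eqP/ev2_eq0 => x y; rewrite ev2B ev2_polv2.
rewrite /ev2 (evm_sum _ x y sP (fun j => leq_trans (sizeY_bound P j) sY)).
apply/eqP; rewrite subr_eq0; apply/eqP; apply: eq_bigr => j _; apply: eq_bigr => i _.
by rewrite ffunE.
Qed.

Definition prmT n N D := ({ffun 'I_n -> k} * {ffun 'I_n -> k} * {ffun 'I_N -> k} *
  {ffun 'I_N -> k} * {ffun 'I_n * 'I_D -> k} * {ffun 'I_n * 'I_D -> k})%type.

Definition dec n N D (g : prmT n N D) : prm k :=
  Prm (polv g.1.1.1.1.1) (polv g.1.1.1.1.2) (polv g.1.1.1.2) (polv g.1.1.2)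
    (polv2 g.1.2) (polv2 g.2).

Lemma dec_surj n N D (u : prm k) :
  (size (pa u) <= n)%N /\ (size (pc u) <= n)%N -> (size (pb u) <= N)%N /\ (size (pd u) <= N)%N ->
  (size (pP u) <= n)%N /\ (size (pQ u) <= n)%N ->
  (sizeY (pP u) <= D)%N /\ (sizeY (pQ u) <= D)%N -> exists g : prmT n N D, dec g = u.
Proof.
case: u => a c b d P Q /= [/polv_surj[va <-] /polv_surj[vc <-]] [/polv_surj[vb <-] /polv_surj[vd <-]].
move=> [sP sQ] [/(polv2_surj sP)[vP <-] /(polv2_surj sQ)[vQ <-]].
by exists (va, vc, vb, vd, vP, vQ).
Qed.

End Decoding.

Section DefinableParametrizations.
Variable k : closedFieldType.
Context {T : Type} {H : Ctx k T}.

Lemma cfun_on_fst {U V : Type} {HU : Ctx k U} {HV : Ctx k V} (f : T -> V) :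
  cfun f -> cfun (fun g : T * U => f g.1).
Proof.
move=> hf; refine (cfun_comp (psi := f) (phi := @fst T U) hf _); exact: cfun_fst.
Qed.

Lemma cfun_proj1 {U V : Type} {HU : Ctx k U} {HV : Ctx k V} (f : T -> U * V) :
  cfun f -> cfun (fun g => (f g).1).
Proof. move=> hf; exact: (cfun_comp (@cfun_fst k U V HU HV) hf). Qed.

Lemma cfun_proj2 {U V : Type} {HU : Ctx k U} {HV : Ctx k V} (f : T -> U * V) :
  cfun f -> cfun (fun g => (f g).2).
Proof. move=> hf; exact: (cfun_comp (@cfun_snd k U V HU HV) hf). Qed.

Lemma cfun_coord (I : finType) (f : T -> {ffun I -> k}) i : cfun f -> cfun (fun g => f g i).
Proof. move=> hf; refine (cfun_comp (psi := fun v : {ffun I -> k} => v i) _ hf); exact: cfun_ffun. Qed.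

Lemma cfun_polv N (v : T -> {ffun 'I_N -> k}) (t : T -> k) :
  cfun v -> cfun t -> cfun (fun g => (polv (v g)).[t g]).
Proof.
move=> hv ht.
have hs : cfun (fun g => \sum_(i < N) v g i * t g ^+ i).
  by apply: cfun_sum => i; apply: cfunM; [exact: cfun_coord|exact: cfunX].
by apply: cfun_ext hs => g; rewrite horner_polv.
Qed.

Lemma cfun_polv2 n D (v : T -> {ffun 'I_n * 'I_D -> k}) (x y : T -> k) :
  cfun v -> cfun x -> cfun y -> cfun (fun g => ev2 (x g) (y g) (polv2 (v g))).
Proof.
move=> hv hx hy.
have hs : cfun (fun g => \sum_(j < n) \sum_(i < D) v g (j, i) * x g ^+ i * y g ^+ j).
  apply: cfun_sum => j; apply: cfun_sum => i.
  by apply: cfunM; [apply: cfunM; [exact: cfun_coord|exact: cfunX]|exact: cfunX].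
by apply: cfun_ext hs => g; rewrite ev2_polv2.
Qed.

Lemma cfun_ev2 (P : poly2 k) (x y : T -> k) :
  cfun x -> cfun y -> cfun (fun g => ev2 (x g) (y g) P).
Proof.
move=> hx hy; have := cfun_comp (@cev_cfun _ _ _ (plane k) P) (cfun_pair hx hy).
by apply: cfun_ext => g; rewrite cev_plane.
Qed.

Section Dec.
Variables (n N D : nat) (u : T -> prmT k n N D).
Hypothesis hu : cfun u.

Let h1 := cfun_proj1 hu.
Let h11 := cfun_proj1 h1.
Let h111 := cfun_proj1 h11.
Let h1111 := cfun_proj1 h111.

Lemma cfun_pa t : cfun t -> cfun (fun g => (pa (dec (u g))).[t g]).
Proof. by move=> ht; apply: cfun_polv => //; exact: cfun_proj1. Qed.
Lemma cfun_pc t : cfun t -> cfun (fun g => (pc (dec (u g))).[t g]).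
Proof. by move=> ht; apply: cfun_polv => //; exact: cfun_proj2. Qed.
Lemma cfun_pb t : cfun t -> cfun (fun g => (pb (dec (u g))).[t g]).
Proof. by move=> ht; apply: cfun_polv => //; exact: cfun_proj2. Qed.
Lemma cfun_pd t : cfun t -> cfun (fun g => (pd (dec (u g))).[t g]).
Proof. by move=> ht; apply: cfun_polv => //; exact: cfun_proj2. Qed.
Lemma cfun_pP x y : cfun x -> cfun y -> cfun (fun g => ev2 (x g) (y g) (pP (dec (u g)))).
Proof. by move=> hx hy; apply: cfun_polv2 => //; exact: cfun_proj2. Qed.
Lemma cfun_pQ x y : cfun x -> cfun y -> cfun (fun g => ev2 (x g) (y g) (pQ (dec (u g)))).
Proof. by move=> hx hy; apply: cfun_polv2 => //; exact: cfun_proj2. Qed.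

Lemma cfun_pX t : cfun t -> cfun (fun g => pX (dec (u g)) (t g)).
Proof. by move=> ht; apply: cfunM; [exact: cfun_pa|apply: cfunV; exact: cfun_pc]. Qed.
Lemma cfun_pY t : cfun t -> cfun (fun g => pY (dec (u g)) (t g)).
Proof. by move=> ht; apply: cfunM; [exact: cfun_pb|apply: cfunV; exact: cfun_pd]. Qed.
Lemma cfun_tau x y : cfun x -> cfun y -> cfun (fun g => tau (dec (u g)) (x g) (y g)).
Proof. by move=> hx hy; apply: cfunM; [exact: cfun_pP|apply: cfunV; exact: cfun_pQ]. Qed.

Lemma definable_pdef t : cfun t -> definable (fun g => pdef (dec (u g)) (t g)).
Proof.
move=> ht; apply: definable_and; apply: definable_neq; try exact: cfun_cst.
  exact: cfun_pc.
exact: cfun_pd.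
Qed.

Lemma definable_good x y t : cfun x -> cfun y -> cfun t ->
  definable (fun g => good (dec (u g)) (x g) (y g) (t g)).
Proof.
move=> hx hy ht.
suff X : @definable k T H (fun g => pdef (dec (u g)) (t g) /\
    ((pa (dec (u g))).[t g] = x g * (pc (dec (u g))).[t g] /\
    ((pb (dec (u g))).[t g] = y g * (pd (dec (u g))).[t g] /\ ev2 (x g) (y g) (pQ (dec (u g))) != 0))).
  by refine (definable_iff _ X) => g; split=> [[h [h' [h'' h''']]]|[h h' h'' h''']].
apply: definable_and; first exact: definable_pdef.
apply: definable_and.
  by apply: definable_eq; [exact: cfun_pa|apply: cfunM => //; exact: cfun_pc].
apply: definable_and.
  by apply: definable_eq; [exact: cfun_pb|apply: cfunM => //; exact: cfun_pd].
by apply: definable_neq; [exact: cfun_pQ|exact: cfun_cst].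
Qed.

End Dec.
End DefinableParametrizations.

Lemma definable_par (k : closedFieldType) (T : Type) {H : Ctx k T} n N D (F : poly2 k)
  (lam : T -> k) (u : T -> prmT k n N D) :
  cfun lam -> cfun u -> definable (fun g => par F (lam g) (dec (u g))).
Proof.
move=> hl hu.
have hu1 : cfun (fun gt : T * k => u gt.1) by exact: cfun_on_fst.
have hl1 : cfun (fun gt : T * k => lam gt.1) by exact: cfun_on_fst.
have ht : cfun (fun gt : T * k => gt.2) by exact: cfun_snd.
have hX := cfun_pX hu1 ht; have hY := cfun_pY hu1 ht.
apply: definable_and.
  apply: definable_exists; apply: definable_and; first exact: definable_pdef.
  by apply: definable_neq; [exact: cfun_pQ|exact: cfun_cst].
apply: definable_forall; apply: definable_imp; first exact: definable_pdef.
apply: definable_and; first by apply: definable_eq => //; exact: cfun_ev2.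
by apply: definable_eq; [apply: cfunM => //; exact: cfun_pQ|exact: cfun_pP].
Qed.

(** * Frames: a parametrisation with the points of the curve on three parallel lines *)

Section Frames.
Variables (k : closedFieldType) (F : poly2 k) (e : 'I_3 -> k).

(** The sizes are the bounds of [par_exists], valid for all levels at once. *)
Definition parT := prmT k (size F) (Ybound F) (Ybound F).+2.
Definition frameT m := (parT * {ffun 'I_3 * 'I_m -> k})%type.
#[export] Instance ctx_parT : Ctx k parT := _.
#[export] Instance ctx_frameT m : Ctx k (frameT m) := _.

(** Listing the points makes sums over them terms in the entries of the frame, hence definable. *)
Definition frame m c lam (x : frameT m) :=
  [/\ par F lam (dec x.1), forall l a b, a != b -> x.2 (l, a) != x.2 (l, b),
     forall l z, ev2 (c + e l) z F = lam <-> exists a, z = x.2 (l, a) &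
     forall l a, good (dec x.1) (c + e l) (x.2 (l, a)) (tau (dec x.1) (c + e l) (x.2 (l, a)))].

Lemma definable_frame m (T : Type) {H : Ctx k T} (c lam : T -> k) (x : T -> frameT m) :
  cfun c -> cfun lam -> cfun x -> definable (fun g => frame (c g) (lam g) (x g)).
Proof.
move=> hc hl hx; have hx1 := cfun_proj1 hx; have hx2 := cfun_proj2 hx.
have hce l : cfun (fun g => c g + e l) by apply: cfunD => //; exact: cfun_cst.
have X1 : @definable k T H (fun g => par F (lam g) (dec (x g).1)) by exact: definable_par.
have X2 : @definable k T H (fun g => forall l a b, a != b -> (x g).2 (l, a) != (x g).2 (l, b)).
  apply: definable_forall_fin => l; apply: definable_forall_fin => a.
  apply: definable_forall_fin => b; apply: definable_imp; first exact: definable_const.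
  by apply: definable_neq; exact: cfun_coord.
have X3 : @definable k T H (fun g => forall l z, ev2 (c g + e l) z F = lam g <-> exists a, z = (x g).2 (l, a)).
  apply: definable_forall_fin => l; apply: definable_forall; apply: definable_iff_fun.
    apply: definable_eq; last by exact: cfun_on_fst.
    by apply: cfun_ev2; [exact: (cfun_on_fst (hce l))|exact: cfun_snd].
  apply: definable_exists_fin => a; apply: definable_eq; first exact: cfun_snd.
  exact: (cfun_on_fst (cfun_coord (l, a) hx2)).
have X4 : @definable k T H (fun g => forall l a, good (dec (x g).1) (c g + e l) ((x g).2 (l, a))
    (tau (dec (x g).1) (c g + e l) ((x g).2 (l, a)))).
  apply: definable_forall_fin => l; apply: definable_forall_fin => a.
  by apply: definable_good => //; [exact: cfun_coord|apply: cfun_tau => //; exact: cfun_coord].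
refine (definable_iff _ (definable_and X1 (definable_and X2 (definable_and X3 X4)))) => g.
by split=> [[? [? [? ?]]]|[? ? ? ?]].
Qed.

Hypothesis sF : (1 < size F)%N.
Variable s : seq k.
Hypothesis hF : forall lam, lam \notin s -> k_rational_quot (F - lam%:P%:P).

Lemma generic_notin (l : seq k) : generic (coord_base k) (fun x => x \notin l).
Proof.
exists (\prod_(z <- l) ('X - z%:P)).
  by rewrite prodf_seq_neq0; apply/allP => z _; rewrite polyXsubC_eq0.
move=> x /=; rewrite /horner_eval; apply: contraNN => xl.
by rewrite -/(root _ x) root_prod_XsubC.
Qed.

Lemma generic_base_root (r : {poly k}) : r != 0 -> generic (coord_base k) (fun x => r.[x] != 0).
Proof. by move=> r0; exists r. Qed.

Lemma generic_line (P : k * k -> Prop) : generic (plane k) P ->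
  exists2 q : {poly k}, q != 0 & forall x, q.[x] != 0 -> generic (coord_base k) (fun y => P (x, y)).
Proof.
move=> [r r0 hr]; exists (lead_coef r); first by rewrite lead_coef_eq0.
move=> x qx; exists (map_poly (horner_eval x) r).
  by apply: contraNneq qx => E; rewrite -[_.[x]]/(horner_eval x (lead_coef r)) /lead_coef -coef_map E coef0.
by move=> y hy; apply: (hr (x, y)).
Qed.

Lemma fiber_poly x lam : (lead_coef F).[x] != 0 -> exists2 p : {poly k},
  size p = size F & forall z, p.[z] = ev2 x z F - lam.
Proof.
move=> lx; exists (map_poly (horner_eval x) F - lam%:P).
  have sE : size (map_poly (horner_eval x) F) = size F by rewrite size_map_poly_id0.
  rewrite -polyCN size_polyDl ?sE //.
  exact: leq_ltn_trans (size_polyC_leq1 _) sF.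
by move=> z; rewrite hornerD hornerN hornerC -cev_plane.
Qed.

Lemma fiber_roots x lam : (lead_coef F).[x] != 0 -> exists m : 'I_(size F),
  (0 < m)%N /\ exists st : {ffun 'I_m -> k}, (forall a b, a != b -> st a != st b) /\
    forall z, ev2 x z F = lam <-> exists a, z = st a.
Proof.
move=> lx; have [p sp pE] := fiber_poly lam lx.
have p0 : p != 0 by rewrite -size_poly_gt0 sp ltnW.
have [l hl] := closed_field_poly_normal p; have lp : lead_coef p != 0 by rewrite lead_coef_eq0.
have memE z : (z \in undup l) = (ev2 x z F == lam).
  by rewrite mem_undup -subr_eq0 -pE -/(root p z) hl rootZ // root_prod_XsubC.
have sl : (size (undup l) < size F)%N.
  apply: (leq_ltn_trans (size_undup l)); rewrite -sp hl size_scale // size_prod_XsubC.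
  exact: ltnSn.
exists (Ordinal sl); split.
  have [|z pz] := closed_rootP p _; first by rewrite sp neq_ltn sF orbT.
  rewrite /= lt0n size_eq0; apply/eqP => E; move: (memE z); rewrite E in_nil => /esym/negP; apply.
  by rewrite -subr_eq0 -pE.
exists [ffun a : 'I_(size (undup l)) => nth 0 (undup l) a]; split.
  by move=> a b ab; rewrite !ffunE nth_uniq ?undup_uniq ?ltn_ord.
move=> z; split.
  move/eqP; rewrite -memE => /(nthP 0)[i il <-]; exists (Ordinal il); by rewrite ffunE.
by move=> [a ->]; apply/eqP; rewrite -memE ffunE mem_nth.
Qed.

(** Where the leading coefficient survives, the number of distinct roots lies between 1 and the
    degree in [Y]; one of these finitely many values is generic. *)
Lemma generic_roots : exists m, (0 < m)%N /\ generic (plane k) (fun cl : k * k =>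
  exists st : {ffun 'I_m -> k}, (forall a b, a != b -> st a != st b) /\
    forall z, ev2 cl.1 z F = cl.2 <-> exists a, z = st a).
Proof.
pose P (m : 'I_(size F)) (cl : k * k) := (0 < m)%N /\
  exists st : {ffun 'I_m -> k}, (forall a b, a != b -> st a != st b) /\
    forall z, ev2 cl.1 z F = cl.2 <-> exists a, z = st a.
have dP m : definable (P m).
  apply: definable_and; first exact: definable_const.
  apply: definable_exists; apply: definable_and.
    apply: definable_forall_fin => a; apply: definable_forall_fin => b.
    apply: definable_imp; first exact: definable_const.
    by apply: definable_neq; apply: cfun_coord; exact: cfun_snd.
  apply: definable_forall; apply: definable_iff_fun.
    have g0 : cfun (fun g : k * k * {ffun 'I_m -> k} * k => g.1) by exact: cfun_fst.
    have g1 := cfun_proj1 (cfun_proj1 g0); have g2 := cfun_proj2 (cfun_proj1 g0).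
    have g3 : cfun (fun g : k * k * {ffun 'I_m -> k} * k => g.2) by exact: cfun_snd.
    by apply: definable_eq; first exact: cfun_ev2.
  apply: definable_exists_fin => a; apply: definable_eq; first exact: cfun_snd.
  have g0 : cfun (fun g : k * k * {ffun 'I_m -> k} * k => g.1) by exact: cfun_fst.
  exact: (cfun_coord a (cfun_proj2 g0)).
have lF0 : lead_coef F != 0 by rewrite lead_coef_eq0 -size_poly_gt0 ltnW.
have gP : generic (plane k) (fun cl => exists m, P m cl).
  exists (lead_coef F)%:P; first by rewrite polyC_eq0.
  move=> [c lam]; rewrite cev_plane ev2_polyC => /(fiber_roots lam)[m [m0 hm]].
  by exists m; split.
have [m hm] := generic_finite_cover dP gP; exists m; split; last by apply: generic_sub hm => g [].
by have [g []] := generic_ex hm.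
Qed.

(* For fixed [lam] a single parametrisation misses only finitely many points of
   the curve, so a generic line avoids them all. *)
Lemma generic_allgood : generic (plane k) (fun cl : k * k =>
  exists u : parT, par F cl.2 (dec u) /\ forall l z, ev2 (cl.1 + e l) z F = cl.2 ->
    good (dec u) (cl.1 + e l) z (tau (dec u) (cl.1 + e l) z)).
Proof.
set P := (X in generic _ X).
have dP : definable P.
  apply: definable_exists; apply: definable_and.
    have g0 : cfun (fun g : k * k * parT => g.1) by exact: cfun_fst.
    by apply: definable_par; [exact: (cfun_proj2 g0)|exact: cfun_snd].
  apply: definable_forall_fin => l; apply: definable_forall.
  have g0 : cfun (fun g : k * k * parT * k => g.1) by exact: cfun_fst.
  have h1 : cfun (fun g : k * k * parT * k => g.1.1.1 + e l).
    by apply: cfunD (cfun_proj1 (cfun_proj1 g0)) _; exact: cfun_cst.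
  have h2 := cfun_proj2 g0.
  have h3 : cfun (fun g : k * k * parT * k => g.2) by exact: cfun_snd.
  apply: definable_imp.
    by apply: definable_eq; [exact: cfun_ev2|exact: (cfun_proj2 (cfun_proj1 g0))].
  by apply: definable_good => //; exact: cfun_tau.
(* Otherwise the property fails wherever [r] is nonzero; a level outside [s] on which [r] is not
   identically zero gives the contradiction. *)
case: (generic_dec (plane k) dP) => // -[r r0 hr]; exfalso.
have [lam] : exists lam, lam \notin s /\ (lead_coef (swapXY r)).[lam] != 0.
  have l0 : lead_coef (swapXY r) != 0 by rewrite lead_coef_eq0 swapXY_eq0.
  by have [x []] := generic_ex (generic_and (generic_notin s) (generic_base_root l0)); exists x.
move=> [ls rl]; have rat := hF ls; have fP := rational_prime rat.
have [u0 [hu sa sb sP sY]] := par_exists sF rat.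
have [u uE] := dec_surj sa sb sP sY; rewrite -uE in hu.
have [V [W [rho [rho0 hV]]]] := primeA_inverse fP (bad_ndvd fP sF hu).
(* the abscissae of the bad points are roots of [rho] *)
have [q q0 hq] : exists2 q : {poly k}, q != 0 & forall c, q.[c] != 0 ->
    ev2 c lam r != 0 /\ forall l, rho.[c + e l] != 0.
  have rr : map_poly (horner_eval lam) (swapXY r) != 0.
    apply: contraNneq rl => E.
    by rewrite -[_.[lam]]/(horner_eval lam (lead_coef (swapXY r))) /lead_coef -coef_map E coef0.
  exists (map_poly (horner_eval lam) (swapXY r) * \prod_l (rho \Po ('X + (e l)%:P))).
    rewrite mulf_neq0 //; apply/prodf_neq0 => l _; rewrite -size_poly_gt0 size_comp_poly2.
      by rewrite size_poly_gt0.
    by rewrite size_XaddC.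
  move=> c; rewrite hornerM mulf_eq0 negb_or horner_prod => /andP[h1 /prodf_neq0 h2]; split.
    by move: h1; rewrite -cev_plane cev_plane /ev2 -evm_swap -/(ev2 _ _ _) -cev_plane.
  by move=> l; have := h2 l isT; rewrite horner_comp hornerD hornerX hornerC.
have /closed_nonrootP[c /hq[rc hrho]] := q0.
case: (hr (c, lam)); first by rewrite cev_plane.
exists u; split=> //= l z hz; apply: (good_of_nbad fP sF hu hz).
apply/eqP => B0; move: (hrho l); rewrite -(@ev2_polyC _ (c + e l) z).
have := congr1 (ev2 (c + e l) z) hV; rewrite ev2M B0 mulr0 ev2D ev2M ev2_level hz subrr mulr0 addr0.
by move=> <-; rewrite eqxx.
Qed.

(** The offset [c] is fixed once for all three lines and all levels, so that frames depend on [lam]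
    only. *)
Lemma generic_frame : exists c m, (0 < m)%N /\
  generic (coord_base k) (fun lam => exists x : frameT m, frame c lam x).
Proof.
have [m [m0 /generic_line[q1 q10 h1]]] := generic_roots.
have [q2 q20 h2] := generic_line generic_allgood.
have /closed_nonrootP[c] : q2 * \prod_l (q1 \Po ('X + (e l)%:P)) != 0.
  rewrite mulf_neq0 //; apply/prodf_neq0 => l _; rewrite -size_poly_gt0 size_comp_poly2.
    by rewrite size_poly_gt0.
  by rewrite size_XaddC.
rewrite /root hornerM mulf_eq0 negb_or horner_prod => /andP[/h2 c2 /prodf_neq0 c1].
have h1' l : generic (coord_base k) (fun lam => exists st : {ffun 'I_m -> k},
    (forall a b, a != b -> st a != st b) /\ forall z, ev2 (c + e l) z F = lam <-> exists a, z = st a).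
  by have := c1 l isT; rewrite horner_comp hornerD hornerX hornerC => /h1.
exists c, m; split=> //.
have hl : generic (coord_base k) (fun lam => forall l, exists st : {ffun 'I_m -> k},
    (forall a b, a != b -> st a != st b) /\ forall z, ev2 (c + e l) z F = lam <-> exists a, z = st a).
  have hs (t : seq 'I_3) : generic (coord_base k) (fun lam => forall l, l \in t -> exists st : {ffun 'I_m -> k},
    (forall a b, a != b -> st a != st b) /\ forall z, ev2 (c + e l) z F = lam <-> exists a, z = st a).
    elim: t => [|a t IH]; first exact: generic_all.
    apply: generic_sub (generic_and (h1' a) IH) => lam [ha ht] l.
    by rewrite inE => /orP[/eqP ->|/ht].
  by apply: generic_sub (hs (enum 'I_3)) => lam h l; apply: h; rewrite mem_enum.
apply: generic_sub (generic_and c2 hl) => lam [[u [hu gu]] /fin_all_exists[st hst]].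
exists (u, [ffun z : 'I_3 * 'I_m => st z.1 z.2]); split=> //=.
- by move=> l a b ab; rewrite !ffunE /=; apply: (hst l).1.
- move=> l z; rewrite (hst l).2; split=> -[a ->]; exists a; by rewrite ffunE.
by move=> l a; apply: gu; apply/(hst l).2; exists a; rewrite ffunE.
Qed.

End Frames.

Section FrameFields.
Variables (k : closedFieldType) (F : poly2 k) (e : 'I_3 -> k) (c : k) (m : nat).
Implicit Types (x y : frameT F m) (h : wt m) (w : frameT F m * k * k * k).

Definition frame_line (l : 'I_3) := c + e l.
Definition frame_pts x l : seq k := [seq x.2 (l, a) | a <- enum 'I_m].

Lemma frame_ptsP lam x l z : frame e c lam x ->
  reflect (ev2 (frame_line l) z F = lam) (z \in frame_pts x l).
Proof.
case=> _ _ hx _; apply: (iffP mapP) => [[a _ ->]|/hx[a ->]]; first by apply/hx; exists a.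
by exists a; rewrite ?mem_enum.
Qed.

Lemma frame_pts_uniq lam x l : frame e c lam x -> uniq (frame_pts x l).
Proof.
case=> _ hx _ _; rewrite map_inj_uniq ?enum_uniq // => a b E.
by apply/eqP/negPn/negP => /(hx l); rewrite E eqxx.
Qed.

Lemma frame_pts_perm lam x y l : frame e c lam x -> frame e c lam y ->
  perm_eq (frame_pts x l) (frame_pts y l).
Proof.
move=> hx hy; apply: uniq_perm (frame_pts_uniq _ hx) (frame_pts_uniq _ hy) _ => z.
by apply/(frame_ptsP _ _ hx)/(frame_ptsP _ _ hy).
Qed.

Lemma frame_good lam x : frame e c lam x -> all_good frame_line (frame_pts x) (dec x.1).
Proof. by move=> [_ _ _ hx] l z /mapP[a _ ->]; exact: hx. Qed.

Definition frame_field x h := ufield frame_line (frame_pts x) (dec x.1) h.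
Definition frame_coord x h p q t := tcoord frame_line (frame_pts x) (dec x.1) h p q t.
Definition frame_slope x h p q := slope frame_line (frame_pts x) (dec x.1) h p q.

Lemma dsum_perm (r r' : 'I_3 -> seq k) h g : (forall l, perm_eq (r l) (r' l)) ->
  dsum r h g = dsum r' h g.
Proof.
move=> rr; rewrite /dsum (perm_big _ (rr _)) /=; apply: eq_bigr => z _.
exact: perm_big.
Qed.

Lemma ufield_perm (r r' : 'I_3 -> seq k) u h : (forall l, perm_eq (r l) (r' l)) ->
  ufield frame_line r u h = ufield frame_line r' u h.
Proof.
move=> rr; have Q T (g : T -> k * k * k) s s' : (forall f : T -> k, \sum_(i <- s) f i = \sum_(i <- s') f i) ->
    qsum s g = qsum s' g by move=> E; rewrite /qsum !E.
rewrite /ufield (Q _ _ _ (r' h.1.1)) => [|f]; last exact: perm_big.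
apply: quad_eq; apply: eq_bigr => z _; rewrite (Q _ _ _ (r' h.2.1)) // => f; exact: perm_big.
Qed.

Section Definable.
Variables (T : Type) (H : Ctx k T).

Lemma cfun_tl (x : T -> frameT F m) (l l' : 'I_3) (a : 'I_m) : cfun x ->
  cfun (fun g => tl frame_line (dec (x g).1) l ((x g).2 (l', a))).
Proof.
move=> hx; apply: cfun_tau; first exact: cfun_proj1.
  exact: cfun_cst.
by apply: cfun_coord; exact: cfun_proj2.
Qed.

Lemma cfun_dsum (x : T -> frameT F m) h (G : T -> 'I_3 -> 'I_3 -> k -> k -> k) :
  cfun x -> (forall l l' a a', cfun (fun g => G g l l' ((x g).2 (l, a)) ((x g).2 (l', a')))) ->
  cfun (fun g => dsum (frame_pts (x g)) h (G g h.1.1 h.2.1)).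
Proof.
move=> hx hG; have hx2 := cfun_proj2 hx.
have X : cfun (fun g => \sum_(a <- enum 'I_m) \sum_(a' <- enum 'I_m)
   (x g).2 (h.1.1, a) ^+ h.1.2 * (x g).2 (h.2.1, a') ^+ h.2.2 *
   G g h.1.1 h.2.1 ((x g).2 (h.1.1, a)) ((x g).2 (h.2.1, a'))).
  apply: cfun_sum => a; apply: cfun_sum => a'; apply: cfunM; last exact: hG.
  by apply: cfunM; apply: cfunX; apply: cfun_coord.
apply: cfun_ext X => g; rewrite /dsum [RHS]big_map; apply: eq_bigr => a _.
by rewrite [RHS]big_map.
Qed.

Lemma frame_fieldE x h : frame_field x h =
  (dsum (frame_pts x) h (fun z z' => (qvec (tl frame_line (dec x.1) h.1.1 z) (tl frame_line (dec x.1) h.2.1 z')).1.1),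
   dsum (frame_pts x) h (fun z z' => (qvec (tl frame_line (dec x.1) h.1.1 z) (tl frame_line (dec x.1) h.2.1 z')).1.2),
   dsum (frame_pts x) h (fun z z' => (qvec (tl frame_line (dec x.1) h.1.1 z) (tl frame_line (dec x.1) h.2.1 z')).2)).
Proof. by []. Qed.

Lemma cfun_frame_field (x : T -> frameT F m) h : cfun x -> cfun (fun g => frame_field (x g) h).
Proof.
move=> hx; pose G g (l l' : 'I_3) z z' :=
  qvec (tl frame_line (dec (x g).1) l z) (tl frame_line (dec (x g).1) l' z').
have tx l a : cfun (fun g => tl frame_line (dec (x g).1) l ((x g).2 (l, a))) by exact: cfun_tl.
have td l a l' a' : cfun (fun g => (tl frame_line (dec (x g).1) l ((x g).2 (l, a)) -
    tl frame_line (dec (x g).1) l' ((x g).2 (l', a')))^-1).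
  by apply: cfunV; apply: cfunD => //; apply: cfunN.
have h1 := @cfun_dsum x h (fun g l l' z z' => (G g l l' z z').1.1) hx.
have h2 := @cfun_dsum x h (fun g l l' z z' => (G g l l' z z').1.2) hx.
have h3 := @cfun_dsum x h (fun g l l' z z' => (G g l l' z z').2) hx.
apply: (cfun_ext (fun g => esym (frame_fieldE (x g) h))); apply: cfun_pair; first apply: cfun_pair.
- by apply: h1 => l l' a a'; exact: td.
- apply: h2 => l l' a a'; apply: cfunM; last exact: td.
  by apply: cfunN; apply: cfunD.
by apply: h3 => l l' a a'; apply: cfunM; [exact: cfunM|exact: td].
Qed.

Lemma cfun_frame_slope (x : T -> frameT F m) h p q : cfun x -> cfun p -> cfun q ->
  cfun (fun g => frame_slope (x g) h (p g) (q g)).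
Proof.
move=> hx hp hq.
have tx l a : cfun (fun g => tl frame_line (dec (x g).1) l ((x g).2 (l, a))) by exact: cfun_tl.
apply: (@cfun_dsum x h (fun g l l' z z' => (p g - q g * tl frame_line (dec (x g).1) l z) *
  (p g - q g * tl frame_line (dec (x g).1) l' z') /
  (tl frame_line (dec (x g).1) l z - tl frame_line (dec (x g).1) l' z')) hx) => l l' a a'.
have tn l0 a0 : cfun (fun g => p g - q g * tl frame_line (dec (x g).1) l0 ((x g).2 (l0, a0))).
  by apply: cfunD => //; apply: cfunN; apply: cfunM.
apply: cfunM; first exact: cfunM.
by apply: cfunV; apply: cfunD => //; apply: cfunN.
Qed.

Lemma cfun_frame_coord (x : T -> frameT F m) h p q t : cfun x -> cfun p -> cfun q -> cfun t ->
  cfun (fun g => frame_coord (x g) h (p g) (q g) (t g)).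
Proof.
move=> hx hp hq ht.
have tx l a : cfun (fun g => tl frame_line (dec (x g).1) l ((x g).2 (l, a))) by exact: cfun_tl.
apply: (@cfun_dsum x h (fun g l l' z z' => qcr (p g) (q g) (t g)
  (tl frame_line (dec (x g).1) l z) (tl frame_line (dec (x g).1) l' z')) hx) => l l' a a'.
rewrite /qcr; apply: cfunM.
  apply: cfunM; first by apply: cfunD => //; apply: cfunN; apply: cfunM.
  by apply: cfunD => //; apply: cfunN.
apply: cfunV; apply: cfunM; first by apply: cfunD => //; apply: cfunN.
by apply: cfunD; [apply: cfunM|apply: cfunN].
Qed.

Lemma cfun_qform (u v : T -> k * k * k) : cfun u -> cfun v -> cfun (fun g => qform (u g) (v g)).
Proof.
move=> hu hv; have u12 := cfun_proj1 hu; have v12 := cfun_proj1 hv.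
have u1 := cfun_proj1 u12; have v1 := cfun_proj1 v12; have u2 := cfun_proj2 u12.
have v2 := cfun_proj2 v12; have u3 := cfun_proj2 hu; have v3 := cfun_proj2 hv.
have c2 : cfun (fun _ : T => 2%:R : k) by exact: cfun_cst.
rewrite /qform; apply: cfunD; first apply: cfunD; first exact: cfunM.
  by apply: cfunN; apply: cfunM => //; exact: cfunM.
by apply: cfunN; apply: cfunM => //; exact: cfunM.
Qed.

Lemma cfun_qwedge (u v : T -> k * k * k) : cfun u -> cfun v -> cfun (fun g => qwedge (u g) (v g)).
Proof.
move=> hu hv; have u12 := cfun_proj1 hu; have v12 := cfun_proj1 hv.
have u1 := cfun_proj1 u12; have v1 := cfun_proj1 v12; have u2 := cfun_proj2 u12.
have v2 := cfun_proj2 v12.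
by rewrite /qwedge; apply: cfunD; [exact: cfunM|apply: cfunN; exact: cfunM].
Qed.

Lemma definable_qsquare_comb (p q a b d : T -> k) (u v : T -> k * k * k) :
  cfun p -> cfun q -> cfun a -> cfun b -> cfun d -> cfun u -> cfun v ->
  definable (fun g => qsquare (p g) (q g) = qcomb (a g) (b g) (d g) (u g) (v g)).
Proof.
move=> hp hq ha hb hd hu hv; have u12 := cfun_proj1 hu; have v12 := cfun_proj1 hv.
have u1 := cfun_proj1 u12; have v1 := cfun_proj1 v12; have u2 := cfun_proj2 u12.
have v2 := cfun_proj2 v12; have u3 := cfun_proj2 hu; have v3 := cfun_proj2 hv.
have c2 : cfun (fun _ : T => 2%:R : k) by exact: cfun_cst.
have bM (f1 f2 f3 f4 : T -> k) : cfun f1 -> cfun f2 -> cfun f3 -> cfun f4 ->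
    cfun (fun g => f1 g * f2 g - f3 g * f4 g).
  by move=> *; apply: cfunD; [exact: cfunM|apply: cfunN; exact: cfunM].
have hc (f1 f2 f3 : T -> k) : cfun f1 -> cfun f2 -> cfun f3 ->
    cfun (fun g => a g * f1 g + b g * f2 g + d g * f3 g).
  by move=> *; apply: cfunD; [apply: cfunD|]; exact: cfunM.
have E1 : @definable k T H (fun g => q g ^+ 2 = (qcomb (a g) (b g) (d g) (u g) (v g)).1.1).
  by apply: definable_eq; [exact: cfunX|apply: hc => //; exact: bM].
have E2 : @definable k T H (fun g => - 2%:R * (p g * q g) = (qcomb (a g) (b g) (d g) (u g) (v g)).1.2).
  apply: definable_eq; first by apply: cfunM; [exact: cfunN|exact: cfunM].
  by apply: hc => //; apply: cfunM => //; exact: bM.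
have E3 : @definable k T H (fun g => p g ^+ 2 = (qcomb (a g) (b g) (d g) (u g) (v g)).2).
  by apply: definable_eq; [exact: cfunX|apply: hc => //; exact: bM].
refine (definable_iff _ (definable_and E1 (definable_and E2 E3))) => g; split=> [[e1 [e2 e3]]|E].
  by apply: quad_eq.
by rewrite -E.
Qed.

End Definable.

Section Invariance.
Hypotheses (e_inj : injective e) (m0 : (0 < m)%N) (sF : (1 < size F)%N).
Variable lam : k.
Hypothesis fP : primeA (F - lam%:P%:P).

Lemma frame_line_inj : injective frame_line.
Proof. by move=> l l' /addrI /e_inj. Qed.

Lemma frame_pts_bounds x : frame e c lam x ->
  [/\ forall l, uniq (frame_pts x l), forall l, (size (frame_pts x l) <= m)%N
    & forall l, exists z, z \in frame_pts x l].
Proof.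
move=> hx; split=> l; first exact: frame_pts_uniq hx.
  by rewrite size_map size_enum_ord.
by exists (x.2 (l, Ordinal m0)); apply: map_f; rewrite mem_enum.
Qed.

Lemma frame_field_indep x : frame e c lam x ->
  exists h : wt m * wt m, qwedge (frame_field x h.1) (frame_field x h.2) != 0.
Proof.
move=> hx; have [ux sx nx] := frame_pts_bounds hx.
have [h [h' hh]] := ufield_indep ux sx frame_line_inj nx (frame_good hx).
by exists (h, h').
Qed.

Lemma frame_slope_exists x (p q : k) : frame e c lam x -> (p, q) <> (0, 0) ->
  exists h, frame_slope x h p q != 0.
Proof.
move=> hx /eqP pq; have [ux sx nx] := frame_pts_bounds hx.
exact: (slope_exists ux sx frame_line_inj nx (frame_good hx) pq).
Qed.

Lemma frame_gram x y h h' : frame e c lam x -> frame e c lam y ->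
  qform (frame_field x h) (frame_field x h') = qform (frame_field y h) (frame_field y h').
Proof.
move=> hx hy; have pp l : perm_eq (frame_pts y l) (frame_pts x l) by exact: frame_pts_perm hy hx.
rewrite /frame_field !(ufield_perm _ _ pp).
have [px _ _ _] := hx; have [py _ _ _] := hy.
apply (gram_invariant fP sF h h' px py (frame_good hx)) => l z zx.
by apply: (frame_good hy); rewrite (perm_mem (pp l)).
Qed.

Lemma frame_coord_point x y h h0 h1 a b d p q p' q' X Y t t' :
  frame e c lam x -> frame e c lam y ->
  qsquare p q = qcomb a b d (frame_field x h0) (frame_field x h1) ->
  qsquare p' q' = qcomb a b d (frame_field y h0) (frame_field y h1) -> (p', q') <> (0, 0) ->
  good (dec x.1) X Y t -> good (dec y.1) X Y t' -> q * t - p != 0 -> q' * t' - p' != 0 ->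
  frame_coord x h p q t = frame_coord y h p' q' t'.
Proof.
move=> hx hy; have pp l : perm_eq (frame_pts y l) (frame_pts x l) by exact: frame_pts_perm hy hx.
rewrite /frame_field /frame_coord /tcoord !(ufield_perm (dec y.1) _ pp) (dsum_perm _ _ pp).
have [px _ _ _] := hx; have [py _ _ _] := hy => E1 E2 /eqP pq g g' n n'.
apply: (tcoord_point fP sF h px py (frame_good hx) _ E1 E2 pq g g' n n') => l z zx.
by apply: (frame_good hy); rewrite (perm_mem (pp l)).
Qed.

Lemma frame_coord_inj x y h h0 h1 a b d p q p' q' X Y X' Y' t t' :
  frame e c lam x -> frame e c lam y ->
  qsquare p q = qcomb a b d (frame_field x h0) (frame_field x h1) ->
  qsquare p' q' = qcomb a b d (frame_field y h0) (frame_field y h1) -> (p', q') <> (0, 0) ->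
  good (dec x.1) X Y t -> good (dec y.1) X' Y' t' -> q * t - p != 0 -> q' * t' - p' != 0 ->
  frame_slope y h p' q' != 0 ->
  frame_coord x h p q t = frame_coord y h p' q' t' -> X = X' /\ Y = Y'.
Proof.
move=> hx hy; have pp l : perm_eq (frame_pts y l) (frame_pts x l) by exact: frame_pts_perm hy hx.
rewrite /frame_field /frame_coord /frame_slope /tcoord /slope !(ufield_perm (dec y.1) _ pp) !(dsum_perm _ _ pp).
have [px _ _ _] := hx; have [py _ _ _] := hy => E1 E2 /eqP pq g g' n n'.
apply: (tcoord_inj fP sF px py (frame_good hx) _ E1 E2 pq g g' n n') => l z zx.
by apply: (frame_good hy); rewrite (perm_mem (pp l)).
Qed.

End Invariance.
End FrameFields.

(** * The pole of the canonical coordinate and the chart [(S, T)] *)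

Section CanonicalChart.
Variables (k : closedFieldType) (F : poly2 k) (e : 'I_3 -> k) (s : seq k) (c : k) (m : nat).
Hypotheses (e_inj : injective e) (m0 : (0 < m)%N) (sF : (1 < size F)%N).
Hypothesis hF : forall lam, lam \notin s -> k_rational_quot (F - lam%:P%:P).
Hypothesis hfr : generic (coord_base k) (fun lam => exists x : frameT F m, frame e c lam x).
Let base := coord_base k.

(** [k] is perfect: the coefficients have [q]-th roots, and Frobenius is additive. *)
Lemma pchar_root_poly q r (P : {poly k}) : [pchar k].-nat q ->
  exists P' : {poly k}, P' ^+ q = P \Po 'X^(q * r).
Proof.
move=> qp; have q0 : (0 < q)%N by case/andP: qp.
have qp' : [pchar {poly k}].-nat q by rewrite (eq_pnat _ (pchar_poly k)).
elim/poly_ind: P => [|P z [P' hP]]; first by exists 0; rewrite comp_poly0 expr0n gtn_eqF.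
have [y hy] := closed_root_exists z q0; exists (P' * 'X^r + y%:P).
by rewrite exprDn_pchar // exprMn hP -exprM [(r * q)%N]mulnC -polyC_exp hy comp_polyD comp_polyM comp_polyX comp_polyC.
Qed.

Lemma pchar_exp_inj (R : idomainType) q (x y : R) : [pchar R].-nat q -> x ^+ q = y ^+ q -> x = y.
Proof.
move=> qp /eqP; have q0 : (0 < q)%N by case/andP: qp.
rewrite -subr_eq0 -exprNn_pchar // -exprDn_pchar // expf_eq0 q0 /= subr_eq0.
by move/eqP.
Qed.

Lemma generic_base_pow q (P : k -> Prop) : (0 < q)%N -> generic base P ->
  generic base (fun x => P (x ^+ q)).
Proof.
move=> q0 [r r0 hr]; exists (r \Po 'X^q).
  by rewrite comp_poly_eq0 // size_polyXn.
by move=> x /=; rewrite /horner_eval horner_comp hornerXn => /hr.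
Qed.

Lemma generic_prime : generic base (fun lam => primeA (F - lam%:P%:P)).
Proof. by apply: generic_sub (generic_notin s) => lam /hF /rational_prime. Qed.

(** Each level that divides [r] is split off and lowers the degree in [Y]. Another level cannot
    divide the factor split off, because the two differ by a nonzero constant. *)
Lemma generic_ndvd (r : poly2 k) : r != 0 -> generic base (fun lam => ~ dvdA (F - lam%:P%:P) r).
Proof.
clear m0; move=> r0; have [n] := ubnP (size r); elim: n r r0 => // n IH r r0 sr.
have [[lam0 [ls [Q rE]]]|nex] := classic (exists lam, lam \notin s /\ dvdA (F - lam%:P%:P) r); last first.
  by apply: generic_sub (generic_notin s) => lam ls d; apply: nex; exists lam.
have [Q0 f0] : Q != 0 /\ F - lam0%:P%:P != 0.
  by apply/andP; rewrite -negb_or -mulf_eq0 -rE.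
have sQ : (size Q < n)%N.
  move: sr; rewrite rE size_mul // size_level //; move: (size Q) sF => a; move: (size F) => b; lia.
apply: generic_sub (generic_and generic_prime (generic_and (generic_notin [:: lam0]) (IH Q Q0 sQ))).
move=> lam [[_ n1 fM] [ll nd]]; rewrite rE => /fM[//|[W hW]]; apply: n1.
rewrite mem_seq1 -subr_eq0 in ll; exists ((W - 1) * ((lam - lam0)^-1)%:P%:P).
have {}hW : (lam - lam0)%:P%:P = (W - 1) * (F - lam%:P%:P).
  by rewrite mulrBl -hW !polyCB; ring.
by rewrite mulrAC -hW -!polyCM mulfV.
Qed.

Notation field x h := (frame_field e c x h).

Lemma definable_frame_and (P : frameT F m -> k -> Prop) :
  definable (fun g : k * frameT F m => P g.2 g.1) ->
  definable (fun lam => exists x : frameT F m, frame e c lam x /\ P x lam).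
Proof.
move=> dP; apply: definable_exists; apply: definable_and => //.
by apply: definable_frame; [exact: cfun_cst|exact: cfun_fst|exact: cfun_snd].
Qed.

(** By [frame_gram] the entry is the same for all frames over [lam], which is the uniqueness that
    [generic_function] asks for. *)
Lemma gram_function h h' : exists q (a b : {poly k}), [/\ [pchar k].-nat q, b != 0 &
  generic base (fun lam => forall x : frameT F m, frame e c lam x ->
    b.[lam] * qform (field x h) (field x h') ^+ q = a.[lam])].
Proof.
pose E lam d := exists x : frameT F m, frame e c lam x /\ d = qform (field x h) (field x h').
have dE : definable (fun ge : k * k => E ge.1 ge.2).
  apply: definable_exists; apply: definable_and.
    have g0 : cfun (fun g : k * k * frameT F m => g.1) by exact: cfun_fst.
    by apply: definable_frame; [exact: cfun_cst|exact: (cfun_proj1 g0)|exact: cfun_snd].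
  have g0 : cfun (fun g : k * k * frameT F m => g.1) by exact: cfun_fst.
  apply: definable_eq; first exact: (cfun_proj2 g0).
  by apply: cfun_qform; apply: cfun_frame_field; exact: cfun_snd.
have uE : generic base (fun lam => exists2 d, E lam d & forall d', E lam d' -> d' = d).
  apply: generic_sub (generic_and generic_prime hfr) => lam [fP [x hx]].
  exists (qform (field x h) (field x h')); first by exists x.
  by move=> d' [y [hy ->]]; by apply: frame_gram hy hx.
have [q [a [b [qp b0 hab]]]] := generic_function dE uE.
exists q, a, b; split=> //; apply: generic_sub hab => lam hl x hx.
by apply: hl; exists x.
Qed.

Lemma generic_basis : exists h : wt m * wt m, generic base (fun lam =>
  exists x : frameT F m, frame e c lam x /\ qwedge (field x h.1) (field x h.2) != 0).
Proof.
pose P (h : wt m * wt m) lam := exists x : frameT F m, frame e c lam x /\ qwedge (field x h.1) (field x h.2) != 0.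
apply: (@generic_finite_cover _ _ _ _ _ P).
  move=> h; apply: definable_frame_and; apply: definable_neq; last exact: cfun_cst.
  by apply: cfun_qwedge; apply: cfun_frame_field; exact: cfun_snd.
apply: generic_sub hfr => lam [x hx].
have [h hh] := frame_field_indep e_inj m0 hx; by exists h, x.
Qed.

(** Here [q] is the product of the inseparability exponents of the three Gram entries. Putting
    [lam = S ^ q] allows all three roots to be extracted, and the entries become rational functions
    of [S]. *)
Lemma generic_isotropic : exists q (A B D : {poly k}) (h : wt m * wt m), [pchar k].-nat q /\
  generic base (fun S => exists x : frameT F m, frame e c (S ^+ q) x /\ exists pq : k * k,
    pq <> (0, 0) /\
    qsquare pq.1 pq.2 = qcomb A.[S] B.[S] D.[S] (field x h.1) (field x h.2)).
Proof.
have [h hw] := generic_basis.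
have [q0 [a0 [b0 [qp0 b00 hg0]]]] := gram_function h.1 h.1.
have [q1 [a1 [b1 [qp1 b10 hg1]]]] := gram_function h.1 h.2.
have [q2 [a2 [b2 [qp2 b20 hg2]]]] := gram_function h.2 h.2.
pose q := (q0 * q1 * q2)%N.
have qp : [pchar k].-nat q by rewrite !pnatM qp0 qp1 qp2.
have q_gt0 : (0 < q)%N by case/andP: qp.
have root_of q' r a b (d : k -> k -> Prop) : [pchar k].-nat q' -> q = (q' * r)%N -> b != 0 ->
    generic base (fun lam => forall x, d lam x -> b.[lam] * x ^+ q' = a.[lam]) ->
    exists a' b' : {poly k}, b' != 0 /\
      generic base (fun S => forall x, d (S ^+ q) x -> b'.[S] * x = a'.[S]).
  move=> qp' qr bn0 hd; have q'0 : (0 < q')%N by case/andP: qp'.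
  have [a' ha'] := pchar_root_poly r a qp'; have [b' hb'] := pchar_root_poly r b qp'.
  have vE (P P' : {poly k}) (S : k) : P' ^+ q' = P \Po 'X^(q' * r) -> P'.[S] ^+ q' = P.[S ^+ q].
    by move=> E; rewrite -horner_exp E horner_comp hornerXn qr.
  exists a', b'; split.
    have : b \Po 'X^(q' * r) != 0 by rewrite comp_poly_eq0 // size_polyXn ltnS -qr.
    by rewrite -hb' expf_eq0 q'0.
  apply: generic_sub (generic_base_pow q_gt0 hd) => S hS x dx.
  by apply: (pchar_exp_inj qp'); rewrite exprMn (vE _ _ _ ha') (vE _ _ _ hb'); exact: hS.
have gram h' h'' q' a b r : [pchar k].-nat q' -> q = (q' * r)%N -> b != 0 ->
    generic base (fun lam => forall x : frameT F m, frame e c lam x ->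
      b.[lam] * qform (field x h') (field x h'') ^+ q' = a.[lam]) ->
    exists a' b' : {poly k}, b' != 0 /\ generic base (fun S => forall x : frameT F m,
      frame e c (S ^+ q) x -> b'.[S] * qform (field x h') (field x h'') = a'.[S]).
  move=> qp' qr bn0 hd.
  have [|a' [b' [b'0 hb']]] := root_of q' r a b
    (fun lam d => exists x : frameT F m, frame e c lam x /\ d = qform (field x h') (field x h'')) qp' qr bn0.
    by apply: generic_sub hd => lam hl _ [x [hx ->]]; exact: hl.
  exists a', b'; split=> //; apply: generic_sub hb' => S hS x hx.
  by apply: hS; exists x.
have [A0 [B0 [B00 G0]]] := gram _ _ _ _ _ (q1 * q2)%N qp0 (esym (mulnA _ _ _)) b00 hg0.
have [A1 [B1 [B10 G1]]] :=
  gram _ _ q1 _ _ (q0 * q2)%N qp1 ltac:(rewrite /q; lia) b10 hg1.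
have [A2 [B2 [B20 G2]]] :=
  gram _ _ q2 _ _ (q0 * q1)%N qp2 ltac:(rewrite /q; lia) b20 hg2.
pose z := B0 * B1 * B2; have z0 : z != 0 by rewrite !mulf_neq0.
(* The entries are multiplied by [z], so the norm of the bracket is multiplied by [z ^ 2]. Taking
   [z * d] as the coefficient of the bracket compensates for this and leaves the factor [e = z]. *)
have [a [b [d [abd dN conic]]]] := conic_point (A0 * B1 * B2) (B0 * A1 * B2) (B0 * B1 * A2) z0.
have gabd : generic base (fun S => (a.[S], b.[S], (z * d).[S]) <> (0, 0, 0)).
  have nz (p : {poly k}) : p != 0 -> generic base (fun S => p.[S] <> 0).
    by move=> /generic_base_root; apply: generic_sub => S /eqP.
  have [a0'|a0'] := eqVneq a 0; last by apply: generic_sub (nz _ a0') => S h1 [].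
  have [b0'|b0'] := eqVneq b 0; last by apply: generic_sub (nz _ b0') => S h1 [].
  have d0 : z * d != 0.
    by rewrite mulf_neq0 //; apply: contraNneq abd => ->; rewrite a0' b0'.
  by apply: generic_sub (nz _ d0) => S h1 [].
pose N := (B0 * A1 * B2) ^+ 2 - (A0 * B1 * B2) * (B0 * B1 * A2).
have gN : generic base (fun S => (z * d).[S] = 0 \/ N.[S] != 0).
  case: dN => [->|N0]; first by apply: generic_all => S; left; rewrite mulr0 horner0.
  by apply: generic_sub (generic_base_root N0) => S h1; right.
exists q, a, b, (z * d), h; split=> //.
have := generic_and (generic_base_root z0) (generic_and gabd (generic_and gN (generic_and
  (generic_base_pow q_gt0 hw) (generic_and G0 (generic_and G1 G2))))).
apply: generic_sub => S [zS [abdS [NS [[x [hx wx]] [/(_ x hx) F0 [/(_ x hx) F1 /(_ x hx) F2]]]]]].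
exists x; split=> //; set u := field x h.1 in wx F0 F1 F2 *; set v := field x h.2 in wx F0 F1 F2 *.
have NE : N.[S] = z.[S] ^+ 2 * (qform u v ^+ 2 - qform u u * qform v v).
  by rewrite /N /z !(hornerD, hornerN, horner_exp, hornerM) -F0 -F1 -F2; ring.
have Q0 : qform (qcomb a.[S] b.[S] (z * d).[S] u v) (qcomb a.[S] b.[S] (z * d).[S] u v) = 0.
  apply: (mulfI zS); rewrite mulr0 qform_comb.
  have h2 : (2%:R : {poly k}).[S] = 2%:R := rmorph_nat (horner_eval S) 2.
  move: (2%:R : {poly k}) h2 conic => two h2; rewrite -/N => conic; clearbody N.
  have := congr1 (fun p : {poly k} => p.[S]) conic.
  rewrite !(hornerD, horner_exp, hornerM) h2 NE horner0 -F0 -F1 -F2 => <-.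
  by rewrite /z !hornerM; ring.
have [[p1 p2] hp] : exists pq : k * k, qsquare pq.1 pq.2 = qcomb a.[S] b.[S] (z * d).[S] u v.
  case: (qcomb _ _ _ _ _) Q0 => [[A B] D]; rewrite /qform /= => Q0.
  by have [|p [r pr]] := @isotropic_square k A B D; [rewrite expr2|exists (p, r)].
exists (p1, p2); split=> // pq0; case: pq0 hp => /= -> -> hp.
have wS : (a.[S], b.[S], (z * d).[S]) != (0, 0, 0) by apply/eqP.
apply: (qcomb_neq0 wx wS); last first.
  by rewrite -hp /qsquare mul0r mulr0 expr0n.
case: NS => [->|NS]; [by left|right].
by apply: contraNneq NS => E; rewrite NE E mulr0.
Qed.

End CanonicalChart.

Section ChartRelation.
Variables (k : closedFieldType) (F : poly2 k) (e : 'I_3 -> k) (s : seq k) (c : k) (m : nat).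
Hypotheses (e_inj : injective e) (m0 : (0 < m)%N) (sF : (1 < size F)%N).
Hypothesis hF : forall lam, lam \notin s -> k_rational_quot (F - lam%:P%:P).
Let base := coord_base k.
Notation field x h := (frame_field e c x h).

Variables (q0 : nat) (A B D : {poly k}) (h : wt m * wt m).
Hypothesis q0p : [pchar k].-nat q0.
Let q0_gt0 : (0 < q0)%N. Proof. by case/andP: q0p. Qed.

Definition pointed_frame (S : k) (w : frameT F m * (k * k)) :=
  [/\ frame e c (S ^+ q0) w.1, w.2 <> (0, 0) &
      qsquare w.2.1 w.2.2 = qcomb A.[S] B.[S] D.[S] (field w.1 h.1) (field w.1 h.2)].

Hypothesis hpf : generic base (fun S => exists w, pointed_frame S w).

Lemma definable_pointed_frame (T : Type) {HT : Ctx k T} (S : T -> k) (w : T -> frameT F m * (k * k)) :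
  cfun S -> cfun w -> definable (fun g => pointed_frame (S g) (w g)).
Proof.
move=> hS hw; have w1 := cfun_proj1 hw; have w2 := cfun_proj2 hw.
have w21 := cfun_proj1 w2; have w22 := cfun_proj2 w2.
have E1 : @definable k T HT (fun g => frame e c (S g ^+ q0) (w g).1).
  by apply: definable_frame => //; [exact: cfun_cst|exact: cfunX].
have E2 : @definable k T HT (fun g => ~ ((w g).2.1 = 0 /\ (w g).2.2 = 0)).
  by apply: definable_not; apply: definable_and; apply: definable_eq => //; exact: cfun_cst.
have E3 : @definable k T HT (fun g => qsquare (w g).2.1 (w g).2.2 =
    qcomb A.[S g] B.[S g] D.[S g] (field (w g).1 h.1) (field (w g).1 h.2)).
  by apply: definable_qsquare_comb => //; (exact: cfun_horner || exact: cfun_frame_field).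
refine (definable_iff _ (definable_and E1 (definable_and E2 E3))) => g.
split=> [[a [b d]]|[a b d]]; do ?split=> //.
  by move=> E; apply: b; rewrite E.
by move=> [b1 b2]; apply: b; case: (w g).2 b1 b2 => /= ? ? -> ->.
Qed.

Lemma generic_prime_pow : generic base (fun S => primeA (F - (S ^+ q0)%:P%:P)).
Proof. exact: generic_base_pow q0_gt0 (generic_prime hF). Qed.

Lemma generic_slope : exists h2 : wt m, generic base (fun S => exists w, pointed_frame S w /\
  frame_slope e c w.1 h2 w.2.1 w.2.2 != 0).
Proof.
pose P h2 S := exists w, pointed_frame S w /\ frame_slope e c w.1 h2 w.2.1 w.2.2 != 0.
apply: (@generic_finite_cover _ _ _ _ _ P).
  move=> h2; apply: definable_exists; apply: definable_and.
    by apply: definable_pointed_frame; [exact: cfun_fst|exact: cfun_snd].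
  have w0 : cfun (fun g : k * (frameT F m * (k * k)) => g.2) by exact: cfun_snd.
  have w1 := cfun_proj1 w0; have w2 := cfun_proj2 w0.
  apply: definable_neq; last exact: cfun_cst.
  by apply: cfun_frame_slope => //; [exact: cfun_proj1|exact: cfun_proj2].
apply: generic_sub hpf => S [w hw]; have [hx pq _] := hw.
have pq' : (w.2.1, w.2.2) <> (0, 0) by case: (w.2) pq.
have [h2 hh] := frame_slope_exists e_inj m0 hx pq'; by exists h2, w.
Qed.

Variable h2 : wt m.
Hypothesis hsl : generic base (fun S => exists w, pointed_frame S w /\
  frame_slope e c w.1 h2 w.2.1 w.2.2 != 0).

(* [T] is the canonical affine coordinate of the point [(x, y)] of the curve
   [F = S ^ q0]. *)
Definition chart (S T x y : k) := exists wt : frameT F m * (k * k) * k,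
  (pointed_frame S wt.1 /\ frame_slope e c wt.1.1 h2 wt.1.2.1 wt.1.2.2 != 0) /\
  [/\ good (dec wt.1.1.1) x y wt.2, wt.1.2.2 * wt.2 - wt.1.2.1 != 0 &
      T = frame_coord e c wt.1.1 h2 wt.1.2.1 wt.1.2.2 wt.2].

Lemma definable_chart (X : Type) {HX : Ctx k X} (S T x y : X -> k) :
  cfun S -> cfun T -> cfun x -> cfun y -> definable (fun g => chart (S g) (T g) (x g) (y g)).
Proof.
move=> hS hT hx hy; pose W := (frameT F m * (k * k) * k)%type.
have f0 : cfun (fun g : X * W => g.1) by exact: cfun_fst.
have w0 : cfun (fun g : X * W => g.2) by exact: cfun_snd.
have {}hS : cfun (fun g : X * W => S g.1) by exact: cfun_on_fst.
have {}hT : cfun (fun g : X * W => T g.1) by exact: cfun_on_fst.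
have {}hx : cfun (fun g : X * W => x g.1) by exact: cfun_on_fst.
have {}hy : cfun (fun g : X * W => y g.1) by exact: cfun_on_fst.
have w1 := cfun_proj1 w0; have w2 := cfun_proj2 w0.
have w11 := cfun_proj1 w1; have w12 := cfun_proj2 w1.
have w121 := cfun_proj1 w12; have w122 := cfun_proj2 w12; have w111 := cfun_proj1 w11.
apply: definable_exists; apply: definable_and.
  apply: definable_and; first exact: definable_pointed_frame.
  by apply: definable_neq; [exact: cfun_frame_slope|exact: cfun_cst].
have E1 : @definable k (X * W) _ (fun g => good (dec g.2.1.1.1) (x g.1) (y g.1) g.2.2).
  exact: definable_good.
have E2 : @definable k (X * W) _ (fun g => g.2.1.2.2 * g.2.2 - g.2.1.2.1 != 0).
  by apply: definable_neq; [apply: cfunD; [exact: cfunM|exact: cfunN]|exact: cfun_cst].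
have E3 : @definable k (X * W) _ (fun g => T g.1 = frame_coord e c g.2.1.1 h2 g.2.1.2.1 g.2.1.2.2 g.2.2).
  by apply: definable_eq => //; exact: cfun_frame_coord.
refine (definable_iff _ (definable_and E1 (definable_and E2 E3))) => g.
by split=> [[? [? ?]]|[? ? ?]].
Qed.

Lemma chart_level S T x y : chart S T x y -> ev2 x y F = S ^+ q0.
Proof. by move=> [w [[[[hu _ _ _] _ _] _] [g _ _]]]; exact: good_level g. Qed.

Lemma chart_inj S T x y x' y' : primeA (F - (S ^+ q0)%:P%:P) ->
  chart S T x y -> chart S T x' y' -> x = x' /\ y = y'.
Proof.
move=> fP [[[w [p q]] t] /= [[[hx pq E] sl] [g n ->]]].
move=> [[[w' [p' q']] t'] /= [[[hx' pq' E'] sl'] [g' n' ET]]].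
exact (frame_coord_inj sF fP hx hx' E E' pq' g g' n n' sl' ET).
Qed.

(** [S] is recovered from [F (x, y) = S ^ q0] because Frobenius is injective; after that both frames
    lie over the same level. *)
Lemma chart_coord S T S' T' x y : primeA (F - (S ^+ q0)%:P%:P) ->
  chart S T x y -> chart S' T' x y -> S = S' /\ T = T'.
Proof.
move=> fP h1 h1'; have SS : S = S'.
  by apply: (pchar_exp_inj q0p); rewrite -(chart_level h1) -(chart_level h1').
subst S'; split=> //; move: h1 h1'.
move=> [[[w [p q]] t] /= [[[hx pq E] sl] [g n ->]]].
move=> [[[w' [p' q']] t'] /= [[[hx' pq' E'] sl'] [g' n' ->]]].
exact (frame_coord_point sF fP h2 hx hx' E E' pq' g g' n n').
Qed.

(** The relation is dominant on both sides. [S] is chosen first, then a parameter [t] on that level: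
    [(x, y)] avoids [r] since the level does not divide [r], and [T] avoids the roots of [r' (S, _)]
    since the slope is nonzero. *)
Lemma chart_dense (r r' : poly2 k) : r != 0 -> r' != 0 ->
  exists S T x y, [/\ chart S T x y, ev2 S T r' != 0 & ev2 x y r != 0].
Proof.
move=> r0 r'0; have [q q_n0 hq] := generic_line (@generic_neq0 _ _ _ (plane k) r' r'0).
have := generic_and (generic_base_root q_n0) (generic_and generic_prime_pow
  (generic_and hsl (generic_base_pow q0_gt0 (generic_ndvd sF hF r0)))).
case/generic_ex => S [/hq[rS rS0 hrS] [fP [[[x [p v]] /= [hw sl]] nd]]].
have [hx pq E] := hw; have [hu _ _ _] := hx.
have [g1 g10 hg1] := par_generic fP sF hu nd; have [g2 g20 hg2] := par_generic fP sF hu (pQ_ndvd hu).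
set tn := tnum (frame_line e c) (frame_pts x) (dec x.1) h2 p v.
set td := tden (frame_line e c) (frame_pts x) (dec x.1) h2 p v.
have lin0 a b : (a != 0) || (b != 0) -> a *: 'X - b%:P != 0 :> {poly k}.
  move=> ab; apply: contraTneq ab => ab0; rewrite negb_or !negbK.
  have c0 := congr1 (fun f : {poly k} => f`_0) ab0; have c1 := congr1 (fun f : {poly k} => f`_1) ab0.
  rewrite /= coefB coefZ coefX coefC coef0 /= mulr0 sub0r in c0.
  rewrite /= coefB coefZ coefX coefC coef0 /= mulr1 subr0 in c1.
  by rewrite c1 eqxx -oppr_eq0 c0 eqxx.
have pv0 : v *: 'X - p%:P != 0.
  by apply: lin0; rewrite -negb_and; apply/negP => /andP[/eqP v0 /eqP p0]; apply: pq; rewrite v0 p0.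
pose R : {poly k} := rS; have R0 : R != 0 := rS0.
have [l hl] := closed_field_poly_normal R.
have lr z : (z \in l) = (R.[z] == 0).
  by rewrite hl hornerZ mulf_eq0 lead_coef_eq0 (negbTE R0) /= -/(root _ z) root_prod_XsubC.
(* The factor at [z] vanishes at [t] exactly when [T = z]; were it zero, the slope would be zero. *)
have prod0 : \prod_(z <- l) ((tn - z * v) *: 'X - (td - z * p)%:P) != 0.
  rewrite prodf_seq_neq0; apply/allP => z _; apply: lin0; rewrite -negb_and; apply/negP.
  move=> /andP[/eqP e1 /eqP e2]; case/eqP: sl; rewrite /frame_slope slopeE -/tn -/td.
  by move/eqP: e1; rewrite subr_eq0 => /eqP ->; move/eqP: e2; rewrite subr_eq0 => /eqP ->; ring.
have /closed_nonrootP[t] : g1 * g2 * (v *: 'X - p%:P) * \prod_(z <- l) ((tn - z * v) *: 'X - (td - z * p)%:P) != 0.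
  by rewrite !mulf_neq0.
rewrite /root !hornerM !mulf_eq0 !negb_or => /andP[/andP[/andP[/hg1[tdf rt] /hg2[_ Qt]] nt] prt].
rewrite !hornerE in nt.
exists S, (frame_coord e c x h2 p v t), (pX (dec x.1) t), (pY (dec x.1) t); split=> //.
  exists (x, (p, v), t); split=> //=; split=> //; have [ct dt] := tdf.
  by split=> //; rewrite /pX /pY divfK.
rewrite -cev_plane; apply: hrS; rewrite -[cev _ _ _]/(R.[_]) -lr.
apply/negP => zl; move: prt; rewrite horner_prod prodf_seq_neq0 => /allP/(_ _ zl) /=.
rewrite !hornerE /frame_coord tcoordE // -/tn -/td.
apply/negP; rewrite negbK; apply/eqP; field; exact: nt.
Qed.

(** The domain is definable, so it is generic unless its complement is, which [chart_dense]
    excludes. The image is treated in the same way below. *)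
Lemma generic_chart_dom : generic (plane k) (fun g => exists x y, chart g.1 g.2 x y).
Proof.
have d : @definable k (k * k) _ (fun g => exists x : k, exists y, chart g.1 g.2 x y).
  apply: definable_exists; apply: definable_exists.
  have h0 : cfun (fun g : k * k * k * k => g.1) by exact: cfun_fst.
  have h1 := cfun_proj1 h0; have h1' := cfun_proj2 h0.
  by apply: definable_chart => //; [exact: cfun_proj1|exact: cfun_proj2|exact: cfun_snd].
case: (generic_dec (plane k) d) => // -[r r0 hr].
have [S [T [x [y [h1 h3 _]]]]] := chart_dense (oner_neq0 _) r0.
by case: (hr (S, T)); [rewrite cev_plane|exists x, y].
Qed.

Lemma generic_chart_img (P : k * k -> Prop) : generic (plane k) P ->
  generic (plane k) (fun g => exists S T, [/\ chart S T g.1 g.2, P (S, T) & primeA (F - (S ^+ q0)%:P%:P)]).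
Proof.
move=> [r r0 hr]; have [p p0 hp] := generic_prime_pow.
pose r' : poly2 k := r * p%:P; have r'0 : r' != 0 by rewrite mulf_neq0 ?polyC_eq0.
have r'E S T : ev2 S T r' != 0 -> P (S, T) /\ primeA (F - (S ^+ q0)%:P%:P).
  by rewrite ev2M ev2_polyC mulf_eq0 negb_or -cev_plane => /andP[/hr h1 /hp h3].
have d : @definable k (k * k) _ (fun g => exists S : k, exists T, chart S T g.1 g.2 /\ ev2 S T r' != 0).
  apply: definable_exists; apply: definable_exists.
  have h0 : cfun (fun g : k * k * k * k => g.1) by exact: cfun_fst.
  have h1 := cfun_proj1 h0; have h1' := cfun_proj2 h0.
  have h3 : cfun (fun g : k * k * k * k => g.2) by exact: cfun_snd.
  apply: definable_and; last by apply: definable_neq; [exact: cfun_ev2|exact: cfun_cst].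
  by apply: definable_chart => //; [exact: cfun_proj1|exact: cfun_proj2].
case: (generic_dec (plane k) d) => [|[t t0 ht]].
  by apply: generic_sub => -[x y] /= [S [T [hc /r'E[h1 h3]]]]; exists S, T.
have [S [T [x [y [h1 h3 h4]]]]] := chart_dense t0 r'0.
by case: (ht (x, y)); [rewrite cev_plane|exists S, T].
Qed.

(** Three uses of [generic_function]: [chart_inj] gives uniqueness of [x] and of [y] over [(S, T)],
    and [chart_coord] that of [T] over [(x, y)]. *)
Lemma chart_equations : exists q1 q2 q3 (a1 b1 a2 b2 a3 b3 : poly2 k),
  [/\ [pchar k].-nat q1, [pchar k].-nat q2 & [pchar k].-nat q3] /\
  generic (plane k) (fun g => exists S T,
   [/\ S ^+ q0 = ev2 g.1 g.2 F,
     ev2 g.1 g.2 b3 != 0 /\ ev2 g.1 g.2 b3 * T ^+ q3 = ev2 g.1 g.2 a3,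
     ev2 S T b1 != 0 /\ ev2 S T b1 * g.1 ^+ q1 = ev2 S T a1 &
     ev2 S T b2 != 0 /\ ev2 S T b2 * g.2 ^+ q2 = ev2 S T a2]).
Proof.
have [pr pr0 hpr] := generic_prime_pow.
have gpr : generic (plane k) (fun g => primeA (F - (g.1 ^+ q0)%:P%:P)).
  exists pr%:P; first by rewrite polyC_eq0.
  by move=> [S T]; rewrite cev_plane ev2_polyC => /hpr.
have f0 : cfun (fun g : k * k * k * k => g.1) by exact: cfun_fst.
have f1 := cfun_proj1 f0; have f2 := cfun_proj2 f0.
have f11 := cfun_proj1 f1; have f12 := cfun_proj2 f1.
have f3 : cfun (fun g : k * k * k * k => g.2) by exact: cfun_snd.
have d1 : @definable k (k * k * k) _ (fun ge => exists y, chart ge.1.1 ge.1.2 ge.2 y).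
  by apply: definable_exists; exact: definable_chart.
have d2 : @definable k (k * k * k) _ (fun ge => exists x, chart ge.1.1 ge.1.2 x ge.2).
  by apply: definable_exists; exact: definable_chart.
have d3 : @definable k (k * k * k) _ (fun ge => exists S, chart S ge.2 ge.1.1 ge.1.2).
  by apply: definable_exists; exact: definable_chart.
have [|q1 [a1 [b1 [q1p b10 g1]]]] := @generic_function _ _ _ (plane k) (fun g x => exists y, chart g.1 g.2 x y) d1.
  apply: generic_sub (generic_and gpr generic_chart_dom) => -[S T] /= [fP [x [y hc]]].
  by exists x => [|x' [y' hc']]; [exists y|have [] := chart_inj fP hc' hc].
have [|q2 [a2 [b2 [q2p b20 g2]]]] := @generic_function _ _ _ (plane k) (fun g y => exists x, chart g.1 g.2 x y) d2.
  apply: generic_sub (generic_and gpr generic_chart_dom) => -[S T] /= [fP [x [y hc]]].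
  by exists y => [|y' [x' hc']]; [exists x|have [] := chart_inj fP hc' hc].
have [|q3 [a3 [b3 [q3p b30 g3]]]] := @generic_function _ _ _ (plane k) (fun g T => exists S, chart S T g.1 g.2) d3.
  apply: generic_sub (generic_chart_img (generic_all _ (fun _ => I))) => -[x y] /= [S [T [hc _ fP]]].
  exists T => [|T' [S' hc']]; first by exists S.
  by have [_ ->] := chart_coord fP hc hc'.
exists q1, q2, q3, a1, b1, a2, b2, a3, b3; split=> //.
have := generic_and (generic_and (generic_neq0 b30) g3) (generic_chart_img (generic_and
  (generic_and (generic_neq0 b10) g1) (generic_and (generic_neq0 b20) g2))).
apply: generic_sub => -[x y] [[n3 e3] [S [T [hc [[n1 e1] [n2 e2]] _]]]]; move: n1 n2 n3 e1 e2 e3.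
rewrite !cev_plane => n1 n2 n3 e1 e2 e3; exists S, T; split.
- by rewrite (chart_level hc).
- by split=> //; apply: e3; exists S.
- by split=> //; apply: e1; exists y.
by split=> //; apply: e2; exists x.
Qed.

End ChartRelation.

(** * From the coordinate to a pseudo generator *)

Section GeneratedSubfield.
Variables (k : closedFieldType) (L : fieldType) (iota : {rmorphism k -> L}) (u v : L).

Definition in_kuv (z : L) := exists P Q : poly2 k,
  evm iota u v Q != 0 /\ z = evm iota u v P / evm iota u v Q.

Lemma in_kuv_evm P : in_kuv (evm iota u v P).
Proof. by exists P, 1; rewrite rmorph1 oner_neq0 divr1. Qed.

Lemma in_kuv_gen : in_kuv u /\ in_kuv v.
Proof. by split; [rewrite -[X in in_kuv X](evmX iota u v)|rewrite -[X in in_kuv X](evmY iota u v)]; exact: in_kuv_evm. Qed.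

Lemma in_kuv_const x : in_kuv (iota x).
Proof. by rewrite -(evmC iota u v x); exact: in_kuv_evm. Qed.

Lemma in_kuv_add z z' : in_kuv z -> in_kuv z' -> in_kuv (z + z').
Proof.
move=> [P [Q [Q0 ->]]] [P' [Q' [Q0' ->]]]; exists (P * Q' + P' * Q), (Q * Q').
by rewrite rmorphM mulf_neq0 // rmorphD !rmorphM addf_div.
Qed.

Lemma in_kuv_mul z z' : in_kuv z -> in_kuv z' -> in_kuv (z * z').
Proof.
move=> [P [Q [Q0 ->]]] [P' [Q' [Q0' ->]]]; exists (P * P'), (Q * Q').
by rewrite rmorphM mulf_neq0 // rmorphM mulf_div.
Qed.

Lemma in_kuv_inv z : in_kuv z -> in_kuv z^-1.
Proof.
move=> [P [Q [Q0 ->]]]; have [->|P0] := eqVneq (evm iota u v P) 0.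
  by rewrite mul0r invr0 -(rmorph0 iota); exact: in_kuv_const.
by exists Q, P; rewrite invf_div.
Qed.

Lemma in_kuv_exp z n : in_kuv z -> in_kuv (z ^+ n).
Proof.
move=> hz; elim: n => [|n IH]; last by rewrite exprS; exact: in_kuv_mul.
by rewrite expr0 -(rmorph1 iota); exact: in_kuv_const.
Qed.

Lemma in_kuv_trans x y P : in_kuv x -> in_kuv y -> in_kuv (evm iota x y P).
Proof.
move=> hx hy; rewrite (evm_sum iota x y (leqnn _) (sizeY_bound P)).
have sumK (n : nat) (f : 'I_n -> L) : (forall i, in_kuv (f i)) -> in_kuv (\sum_i f i).
  move=> hf; apply: (big_ind in_kuv) => //; last exact: in_kuv_add.
  by rewrite -(rmorph0 iota); exact: in_kuv_const.
apply: (sumK) => j; apply: (sumK) => i; apply: in_kuv_mul; last exact: in_kuv_exp.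
by apply: in_kuv_mul; [exact: in_kuv_const|exact: in_kuv_exp].
Qed.

Lemma in_kuv_pchar_exp (phi : {rmorphism poly2 k -> L}) N : [pchar k].-nat N ->
  (forall c, phi c%:P%:P = iota c) -> in_kuv (phi 'X%:P ^+ N) -> in_kuv (phi 'X ^+ N) ->
  forall P, in_kuv (phi P ^+ N).
Proof.
move=> Np phiC hx hy; have N0 : (0 < N)%N by case/andP: Np.
have Np' : [pchar L].-nat N by rewrite (eq_pnat _ (fmorph_pchar iota)).
have h0 : in_kuv 0 by rewrite -(rmorph0 iota); exact: in_kuv_const.
elim/poly_ind => [|P p IH]; first by rewrite rmorph0 expr0n gtn_eqF.
rewrite rmorphD rmorphM exprDn_pchar // exprMn; apply: in_kuv_add; first exact: in_kuv_mul.
elim/poly_ind: p => [|p z IHp]; first by rewrite polyC0 rmorph0 expr0n gtn_eqF.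
rewrite polyCD polyCM rmorphD rmorphM exprDn_pchar // exprMn; apply: in_kuv_add; first exact: in_kuv_mul.
by rewrite phiC; apply: in_kuv_exp; exact: in_kuv_const.
Qed.

End GeneratedSubfield.

Lemma rmorph_pchar_nat (R S : nzRingType) (f : {rmorphism R -> S}) N :
  [pchar R].-nat N -> [pchar S].-nat N.
Proof. by apply: sub_in_pnat => p _; exact: rmorph_pchar. Qed.

(** The same [P'] serves in every ring over [k], so that relations between points and relations in
    the function field can be compared. *)
Lemma evm_pchar_twist (k : closedFieldType) N (P : poly2 k) : [pchar k].-nat N ->
  exists P' : poly2 k, forall (R : comNzRingType) (iota : {rmorphism k -> R}) x y,
    evm iota x y P ^+ N = evm iota (x ^+ N) (y ^+ N) P'.
Proof.
move=> Np; have N0 : (0 < N)%N by case/andP: Np.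
elim/poly_ind: P => [|P p [P' hP]].
  by exists 0 => R iota x y; rewrite (rmorph0 (evm iota x y)) (rmorph0 (evm iota _ _)) expr0n gtn_eqF.
have [p' hp] : exists p' : {poly k}, forall (R : comNzRingType) (iota : {rmorphism k -> R}) x,
    (map_poly iota p).[x] ^+ N = (map_poly iota p').[x ^+ N].
  elim/poly_ind: p => [|p z [p' hp]].
    by exists 0 => R iota x; rewrite (rmorph0 (map_poly iota)) !horner0 expr0n gtn_eqF.
  have hM (R : comNzRingType) (iota : {rmorphism k -> R}) (f : {poly k}) c x :
      (map_poly iota (f * 'X + c%:P)).[x] = (map_poly iota f).[x] * x + iota c.
    by rewrite (rmorphD (map_poly iota)) (rmorphM (map_poly iota)) /= map_polyX map_polyC hornerD hornerMX hornerC.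
  exists (p' * 'X + (z ^+ N)%:P) => R iota x; have NR := rmorph_pchar_nat iota Np.
  by rewrite !hM exprDn_pchar // exprMn hp (rmorphXn iota).
have hM (R : comNzRingType) (iota : {rmorphism k -> R}) (f : poly2 k) g x y :
    evm iota x y (f * 'X + g%:P) = evm iota x y f * y + (map_poly iota g).[x].
  by rewrite (rmorphD (evm iota x y)) (rmorphM (evm iota x y)) evmY evm_polyC.
exists (P' * 'X + p'%:P) => R iota x y; have NR := rmorph_pchar_nat iota Np.
by rewrite !hM exprDn_pchar // exprMn hP hp.
Qed.

Section FunctionsOfChart.
Variables (k : closedFieldType) (F : poly2 k) (q0 q3 : nat) (a3 b3 : poly2 k).
Hypotheses (q0p : [pchar k].-nat q0) (q3p : [pchar k].-nat q3).
Variables (L : fieldType) (iota : {rmorphism k -> L}) (phi : {rmorphism poly2 k -> L}).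
Hypotheses (phiC : forall c, phi c%:P%:P = iota c) (phi_inj : forall P, phi P = 0 -> P = 0).

(** The power [N = q0 q3] turns [S] into [F ^ q3] and [T] into [(a3 / b3) ^ q0], eliminating the
    point [(S, T)]. With denominators cleared, the relation is a polynomial identity on an open set
    of the plane, hence everywhere. *)
Lemma pchar_extract (z : poly2 k) q1 (a1 b1 : poly2 k) :
  generic (plane k) (fun g => exists S T, [/\ S ^+ q0 = ev2 g.1 g.2 F,
    ev2 g.1 g.2 b3 != 0 /\ ev2 g.1 g.2 b3 * T ^+ q3 = ev2 g.1 g.2 a3 &
    ev2 S T b1 != 0 /\ ev2 S T b1 * ev2 g.1 g.2 z ^+ q1 = ev2 S T a1]) ->
  in_kuv iota (phi F) (phi a3 / phi b3) (phi z ^+ (q1 * (q0 * q3))).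
Proof.
move=> [r r0 hr]; set N := (q0 * q3)%N.
have Np : [pchar k].-nat N by rewrite pnatM q0p q3p.
have [A hA'] := evm_pchar_twist a1 Np; have [B hB'] := evm_pchar_twist b1 Np.
have hA := hA' k idfun; have hB := hB' k idfun.
pose I := (sizeY A + sizeY B)%N; pose J := (size A + size B)%N.
pose cc : {rmorphism k -> poly2 k} := polyC \o polyC.
pose h P := bihom cc P I J (F ^+ q3) 1 (a3 ^+ q0) (b3 ^+ q0).
have sJA : (size A <= J.+1)%N by rewrite /J; move: (size A) => n; lia.
have sJB : (size B <= J.+1)%N by rewrite /J; move: (size A) (size B) => n n'; lia.
have sIA j : (size (A`_j)%R <= I.+1)%N by apply: leq_trans (sizeY_bound A j) _; rewrite /I; lia.
have sIB j : (size (B`_j)%R <= I.+1)%N by apply: leq_trans (sizeY_bound B j) _; rewrite /I; lia.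
have key x y : ev2 x y r != 0 -> ev2 x y (h B * z ^+ (q1 * N)) = ev2 x y (h A) /\ ev2 x y (h B) != 0
  /\ ev2 x y b3 != 0.
  rewrite -cev_plane => /hr[S [T /= [SF [b30 bT] [b10 bz]]]].
  have hE (P : poly2 k) : (size P <= J.+1)%N -> (forall j, size (P`_j)%R <= I.+1)%N ->
      ev2 x y (h P) = ev2 x y b3 ^+ (q0 * J) * ev2 (S ^+ N) (T ^+ N) P.
    move=> sJ sI; rewrite /ev2 /h (@bihom_morph _ _ _ _ (idfun : {rmorphism k -> k})) => [|c]; last exact: ev2_const.
    rewrite -/(ev2 x y) rmorph1 !ev2_exp bihom_frac ?oner_neq0 ?expf_neq0 // -/(ev2 _ _ _).
    rewrite expr1n mul1r divr1 -exprM; congr (_ * ev2 _ _ _).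
      by rewrite -SF -exprM.
    by rewrite -expr_div_n -bT mulrAC mulfV // mul1r -exprM mulnC.
  rewrite ev2M ev2_exp !hE // /ev2 -hA -hB -!/(ev2 _ _ _); split; last by rewrite mulf_neq0 ?expf_neq0.
  by rewrite -mulrA [_ ^+ (q1 * N)]exprM -exprMn bz.
have eqA : h B * z ^+ (q1 * N) = h A.
  apply/eqP; rewrite -subr_eq0; apply/eqP.
  apply: (mulfI r0); rewrite mulr0; apply: ev2_eq0 => x y; rewrite ev2M ev2B.
  have [->|/key[-> _]] := eqVneq (ev2 x y r) 0; first by rewrite mul0r.
  by rewrite subrr mulr0.
have [x [y /key[_ [hB0 b30]]]] := ev2_inf r0.
have nz P : ev2 x y P != 0 -> phi P != 0.
  by apply: contraNneq => /phi_inj ->; rewrite ev2_0.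
have phB := nz _ hB0; have {nz} phb := nz _ b30.
have {eqA} := congr1 phi eqA; rewrite rmorphM rmorphXn => eqL.
have -> : phi z ^+ (q1 * N) = phi (h A) / phi (h B) by rewrite -eqL mulrAC mulfV ?mul1r.
have hE (P : poly2 k) : (size P <= J.+1)%N -> (forall j, size (P`_j)%R <= I.+1)%N ->
    phi (h P) = phi b3 ^+ (q0 * J) * evm iota (phi F ^+ q3) ((phi a3 / phi b3) ^+ q0) P.
  move=> sJ sI; rewrite /h (@bihom_morph _ _ _ _ iota) => [|c]; last exact: phiC.
  rewrite rmorph1 !rmorphXn bihom_frac ?oner_neq0 ?expf_neq0 //.
  by rewrite expr1n mul1r divr1 -exprM expr_div_n.
move: phB; rewrite !hE // mulf_eq0 negb_or => /andP[b0 B0].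
rewrite -mulf_div mulfV // mul1r; apply: in_kuv_mul; last apply: in_kuv_inv.
  by apply: in_kuv_trans; apply: in_kuv_exp; have [] := in_kuv_gen iota (phi F) (phi a3 / phi b3).
by apply: in_kuv_trans; apply: in_kuv_exp; have [] := in_kuv_gen iota (phi F) (phi a3 / phi b3).
Qed.

End FunctionsOfChart.

Section GenericallyRationalImpliesGenerator.
Variables (k : closedFieldType).
Implicit Types F : poly2 k.
Local Notation fr := (@FracField.tofrac (poly2 k)).

Definition kAm : {rmorphism k -> fracA k} := fr \o (polyC \o polyC).

Lemma in_k2E u v z : in_k2 u v z <-> in_kuv kAm u v z.
Proof.
have E P : eval2 (@kA_emb k) P u v = evm kAm u v P := eval2E kAm P u v.
by split=> -[P [Q hz]]; exists P, Q; move: hz; rewrite !E.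
Qed.

Lemma pchar_nat_power (R : nzRingType) M : [pchar R].-nat M ->
  M = 1%N \/ exists p e : nat, p \in [pchar R] /\ M = (p ^ e)%N.
Proof.
move=> Mp; have M0 : (0 < M)%N by case/andP: Mp.
have [->|M1] := eqVneq M 1%N; [by left|right].
have M2 : (1 < M)%N by rewrite ltn_neqAle eq_sym M1.
have pM : pdiv M \in [pchar R].
  by move/pnatP: Mp => /(_ M0 _ (pdiv_prime M2)); apply; exact: pdiv_dvd.
exists (pdiv M), (logn (pdiv M) M); split=> //.
rewrite -[LHS](part_pnat_id (pi := pdiv M)) ?p_part //.
by rewrite (eq_pnat _ (pcharf_eq pM)) in Mp.
Qed.

Lemma purely_insep_gens F (G : fracA k) M : [pchar k].-nat M ->
  in_kuv kAm (fr F) G (fr 'X%:P ^+ M) ->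
  in_kuv kAm (fr F) G (fr 'X ^+ M) ->
  pseudo_field_generator F.
Proof.
move=> Mp hX hY; exists G => z; exists M; split; last exact: pchar_nat_power.
have [n [d [d0 ->]]] := fraction_numden z; apply/in_k2E.
have h := @in_kuv_pchar_exp k _ kAm _ _ fr M Mp (fun c => erefl) hX hY.
rewrite expr_div_n; exact (in_kuv_mul (h n) (in_kuv_inv (h d))).
Qed.

Lemma pseudo_generator_of_deg_pos F (s : seq k) : (1 < size F)%N ->
  (forall lam, lam \notin s -> k_rational_quot (F - lam%:P%:P)) -> pseudo_field_generator F.
Proof.
move=> sF hF.
have [z] : exists z : k, z \notin [:: 0; 1].
  by have [z hz] := generic_ex (generic_notin [:: 0; 1 : k]); exists z.
rewrite !inE negb_or => /andP[z0 z1].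
pose es : seq k := [:: 0; 1; z]; pose e (i : 'I_3) := es`_i.
have ues : uniq es by rewrite /= !inE !negb_or eq_sym oner_neq0 eq_sym z0 eq_sym z1.
have e_inj : injective e by move=> i j /eqP; rewrite nth_uniq // => /eqP /val_inj.
have [c [m [m0 hfr]]] := generic_frame e sF hF.
have [q0 [A [B [D [h [q0p hpf]]]]]] := generic_isotropic e_inj m0 sF hF hfr.
have hpf' : generic (coord_base k) (fun S => exists w, pointed_frame (F := F) e c q0 A B D h S w).
  by apply: generic_sub hpf => S [x [hx [pq [n E]]]]; exists (x, pq).
have [h2 hsl] := generic_slope e_inj m0 hpf'.
have [q1 [q2 [q3 [a1 [b1 [a2 [b2 [a3 [b3 [[q1p q2p q3p] heq]]]]]]]]]] := chart_equations sF hF q0p hsl.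
have inj P : fr P = 0 -> P = 0 by move/eqP; rewrite tofrac_eq0 => /eqP.
have hX := @pchar_extract k F q0 q3 a3 b3 q0p q3p _ kAm fr (fun c => erefl) inj 'X%:P q1 a1 b1.
have hY := @pchar_extract k F q0 q3 a3 b3 q0p q3p _ kAm fr (fun c => erefl) inj 'X q2 a2 b2.
apply: (@purely_insep_gens F (fr a3 / fr b3) (q1 * (q0 * q3) * q2)).
- by rewrite !pnatM q1p q0p q3p q2p.
- rewrite exprM; apply: in_kuv_exp; apply: hX; apply: generic_sub heq => g [S [T [? ? ? _]]].
  by exists S, T; rewrite ev2_X.
have -> : (q1 * (q0 * q3) * q2)%N = (q2 * (q0 * q3) * q1)%N by rewrite mulnAC [RHS]mulnAC [(q1 * q2)%N]mulnC.
rewrite exprM; apply: in_kuv_exp; apply: hY; apply: generic_sub heq => g [S [T [? ? _ ?]]].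
by exists S, T; rewrite ev2_Y.
Qed.

(** Without [Y], an irreducible level is a polynomial of degree one in [X], so [F] and [Y] already
    generate the field. *)
Lemma pseudo_generator_of_deg_0 F (lam : k) : (size F <= 1)%N ->
  k_rational_quot (F - lam%:P%:P) -> pseudo_field_generator F.
Proof.
move=> /size1_polyC; set p := F`_0 => FE [[f0 [fu fi]] _]; rewrite FE -!polyCB in f0 fu fi *.
have sp : size p = 2.
  have sE : size (p - lam%:P) = 2.
    have unitC (a : {poly k}) : (a%:P : poly2 k) \is a GRing.unit -> size a = 1%N.
      by rewrite poly_unitE size_polyC => /andP[_]; rewrite coefC /= poly_unitE => /andP[/eqP].
    have Cunit (a : {poly k}) : size a = 1%N -> (a%:P : poly2 k) \is a GRing.unit.
      move=> sa; rewrite poly_unitE coefC /= size_polyC -size_poly_eq0 sa /= poly_unitE sa /=.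
      by rewrite unitfE -[_`_0]/(a`_(1.-1)) -sa -/(lead_coef a) lead_coef_eq0 -size_poly_eq0 sa.
    have sn1 : size (p - lam%:P) != 1%N by apply/eqP => /Cunit U; rewrite U in fu.
    have sn0 : size (p - lam%:P) != 0%N by rewrite size_poly_eq0; apply: contraNneq f0 => ->.
    have [x /factor_theorem[w wE]] := closed_rootP _ sn1.
    have := fi w%:P ('X - x%:P)%:P; rewrite -polyCM -wE => /(_ erefl)[/unitC sw|/unitC]; last first.
      by rewrite size_XsubC.
    by rewrite wE size_Mmonic ?monicXsubC -?size_poly_gt0 ?sw // size_XsubC.
  have := size_polyDl (p := p - lam%:P) (q := lam%:P); rewrite subrK => ->; rewrite sE //.
  by rewrite ltnS size_polyC_leq1.
have pE : p = p`_1 *: 'X + (p`_0)%:P.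
  apply/polyP => -[|[|i]]; rewrite coefD coefZ coefX coefC /= ?mulr0 ?mulr1 ?add0r ?addr0 //.
  by rewrite nth_default // sp.
have p1 : p`_1 != 0 by have -> : p`_1 = lead_coef p; [rewrite /lead_coef sp|rewrite lead_coef_eq0 -size_poly_eq0 sp].
apply: (@purely_insep_gens p%:P (fr 'X) 1) => //; rewrite expr1; last first.
  by have [] := in_kuv_gen kAm (fr p%:P) (fr 'X).
set K := in_kuv _ _ _; have [KF _] := in_kuv_gen kAm (fr p%:P) (fr 'X).
have -> : fr 'X%:P = kAm (p`_1)^-1 * (fr p%:P + kAm (- p`_0)).
  rewrite -[kAm (p`_1)^-1]/(fr ((p`_1)^-1)%:P%:P) -[kAm (- p`_0)]/(fr (- p`_0)%:P%:P).
  rewrite -rmorphD -rmorphM /=; congr (fr _).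
  have E : p + (- p`_0)%:P = p`_1 *: 'X by rewrite {1}pE polyCN addrK.
  by rewrite -polyCD -polyCM E mul_polyC scalerA mulVf // scale1r.
by apply: in_kuv_mul; [|apply: in_kuv_add] => //; exact: in_kuv_const.
Qed.

(** With [mu ^ p = lam], the level of [a ^ p] would be [(a - mu) ^ p], never irreducible. *)
Lemma generally_rational_not_power F p : generally_rational F -> p \in [pchar k] ->
  ~ in_pth_powers (k := k) p F.
Proof.
move=> [s hF] pk [a FE]; have [lam /hF[[f0 [fu fi]] _]] := generic_ex (generic_notin s).
have p0 : (0 < p)%N by apply: prime_gt0; exact: pcharf_prime pk.
have [mu mE] := closed_root_exists lam p0.
have pk2 : p \in [pchar (poly2 k)] by rewrite !pchar_poly.
have E : F - lam%:P%:P = (a - mu%:P%:P) ^+ p.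
  rewrite FE -mE !polyC_exp -!(pFrobenius_autE pk2); exact: esym (pFrobenius_autB_comm _ (mulrC _ _)).
have := fi (a - mu%:P%:P) ((a - mu%:P%:P) ^+ p.-1); rewrite -exprS prednK // => /(_ E).
move: fu; rewrite E => fu [U|U]; first by case/negP: fu; exact: unitrX.
case/negP: fu; have [p1|p1] := posnP p.-1.
  by have := prime_gt1 (pcharf_prime pk); move: p1 p0; case: (p) => [|[|]].
by move: U; rewrite unitrX_pos // => U; exact: unitrX.
Qed.

Lemma generally_rational_generator F : generally_rational F -> pseudo_field_generator F.
Proof.
move=> [s hF]; have [sF|sF] := leqP (size F) 1; last exact: pseudo_generator_of_deg_pos hF.
have [lam ls] := generic_ex (generic_notin s).
by apply: (pseudo_generator_of_deg_0 sF (hF lam ls)).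
Qed.

End GenericallyRationalImpliesGenerator.

(** * Divisibility by almost all F - lambda *)

Section CancelY.
Variables (k : closedFieldType) (F Z : poly2 k).
Hypotheses (sF : (1 < size F)%N) (Z0 : Z != 0).

Lemma fiber_zero_dvd (W : poly2 k) a : map_poly (horner_eval a) W = 0 ->
  exists W', W = W' * ('X - a%:P)%:P.
Proof.
move=> Wa; have dv i : exists w, W`_i = w * ('X - a%:P).
  by apply/factor_theorem/eqP; rewrite -[_.[_]]/(horner_eval a _) -coef_map Wa coef0.
have /fin_all_exists[w hw] := fun i : 'I_(size W) => dv i.
exists (\sum_i (w i)%:P * 'X^i); rewrite mulr_suml -[LHS]coefK poly_def.
by apply: eq_bigr => i _; rewrite hw -[LHS]mul_polyC [X in X * _]polyCM mulrAC.
Qed.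

Lemma dvdA_cancel_linear (f P : poly2 k) a : map_poly (horner_eval a) f != 0 ->
  dvdA f (P * ('X - a%:P)%:P) -> dvdA f P.
Proof.
move=> fa [W hW]; have Xa0 : ('X - a%:P)%:P != 0 :> poly2 k by rewrite polyC_eq0 polyXsubC_eq0.
have [|W' W'E] := @fiber_zero_dvd W a.
  apply: (mulIf fa); rewrite mul0r -rmorphM -hW rmorphM /= map_polyC /=.
  by rewrite [horner_eval a _](_ : _ = 0) ?mulr0 //; apply/eqP/factor_theorem; exists 1; rewrite mul1r.
exists W'; apply: (mulIf Xa0); rewrite hW W'E; ring.
Qed.

Lemma dvdA_cancel_X (f P : poly2 k) (rho : {poly k}) : (forall a, map_poly (horner_eval a) f != 0) ->
  rho != 0 -> dvdA f (P * rho%:P) -> dvdA f P.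
Proof.
move=> fa rho0; have [l ->] := closed_field_poly_normal rho.
have lc0 : lead_coef rho != 0 by rewrite lead_coef_eq0.
rewrite -mul_polyC polyCM mulrCA => /(dvdA_mull (lead_coef rho)^-1%:P%:P).
have -> : ((lead_coef rho)^-1)%:P%:P * ((lead_coef rho)%:P%:P * (P * (\prod_(z <- l) ('X - z%:P))%:P)) =
    P * (\prod_(z <- l) ('X - z%:P))%:P.
  by rewrite mulrA -!rmorphM /= mulVf // mul1r.
 elim: l => [|a l IH]; first by rewrite big_nil mulr1.
rewrite big_cons polyCM mulrA mulrAC => /(dvdA_cancel_linear (fa a)); exact: IH.
Qed.

(** The fibre over [a] vanishes only if [a] is a root of the leading coefficient, which does not
    involve [lam], and [lam] is the constant term of [F] at [a]: finitely many values. *)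
Lemma generic_fiber : generic (coord_base k) (fun lam =>
  forall a, map_poly (horner_eval a) (F - lam%:P%:P) != 0).
Proof.
have lF : lead_coef F != 0 by rewrite lead_coef_eq0 -size_poly_gt0 ltnW.
have [l hl] := closed_field_poly_normal (lead_coef F).
apply: generic_sub (generic_notin [seq (F`_0).[a] | a <- l]) => lam nl a.
apply: contraNneq nl => fa0; apply/mapP; exists a.
  have := congr1 (fun g : {poly k} => g`_(size F).-1) fa0.
  rewrite /= coef_map coef0 coefB coefC -[_ == 0%N]/(_) gtn_eqF ?subr0; last by rewrite -subn1 subn_gt0.
  rewrite /= /horner_eval -/(lead_coef F) hl hornerZ => /eqP; rewrite mulf_eq0 lead_coef_eq0.
  by rewrite (negbTE lF) /= -/(root _ a) root_prod_XsubC.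
have := congr1 (fun g : {poly k} => g`_0) fa0.
by rewrite /= coef_map coef0 coefB coefC /= /horner_eval hornerD hornerN hornerC => /eqP; rewrite subr_eq0 => /eqP.
Qed.

(* The powers of [F] are dependent over [k[X]] modulo [Z], so that
   [W Z = rho (X) + V (F - lam)] with [rho] nonzero for almost all [lam]. *)
Lemma generic_cancel_Y : generic (coord_base k) (fun lam => forall P,
  dvdA (F - lam%:P%:P) (P * Z) -> dvdA (F - lam%:P%:P) P).
Proof.
have sZ : (size Z <= (size Z).-1.+1)%N by exact: leqSpred.
have [b [i0 bi0] [W hW]] := dep_mod (fun i : 'I_(size Z).-1.+1 => F ^+ i) Z0 sZ.
have [l bl] : exists l, (b i0)`_l != 0.
  by exists (size (b i0)).-1; rewrite -/(lead_coef _) lead_coef_eq0.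
(* The coefficient of degree [l] of [rho], seen as a polynomial in [lam]; where it is nonzero, so is
   [rho]. *)
pose el := \poly_(i < (size Z).-1.+1) (b (inord i))`_l.
have el0 : el != 0.
  by apply: contraNneq bl => E; have := coef0 k i0; rewrite -E coef_poly ltn_ord inord_val => ->.
apply: generic_sub (generic_and generic_fiber (generic_base_root el0)) => lam [fib el_lam] P.
pose rho := \sum_i b i * (lam ^+ i)%:P.
have rho0 : rho != 0.
  apply: contraNneq el_lam => E; apply/eqP.
  transitivity rho`_l; last by rewrite E coef0.
  by rewrite horner_poly coef_sum; apply: eq_bigr => i _; rewrite coefMC inord_val.
have [V hV] : exists V, W * Z = rho%:P + V * (F - lam%:P%:P).
  have step i : exists V, F ^+ i = (lam ^+ i)%:P%:P + V * (F - lam%:P%:P).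
    exists (\sum_(j < i) F ^+ (i.-1 - j) * lam%:P%:P ^+ j).
    by rewrite mulrC -subrXX !polyC_exp addrC subrK.
  have /fin_all_exists[V0 hV0] := fun i : 'I_(size Z).-1.+1 => step i.
  exists (\sum_i (b i)%:P * V0 i); rewrite -hW rmorph_sum mulr_suml -big_split /=.
  by apply: eq_bigr => i _; rewrite hV0 -mul_polyC polyCM; ring.
move=> /(dvdA_mull W) h; apply: (dvdA_cancel_X fib rho0).
have -> : P * rho%:P = W * (P * Z) - P * V * (F - lam%:P%:P).
  by rewrite mulrCA hV; ring.
by apply: dvdA_add => //; apply/dvdA_opp/dvdA_mull/dvdA_refl.
Qed.

End CancelY.

Section Cancel.
Variable k : closedFieldType.
Implicit Types F P Z : poly2 k.

Lemma dvdA_swap F P : dvdA F P -> dvdA (swapXY F) (swapXY P).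
Proof. by move=> [Q ->]; exists (swapXY Q); rewrite rmorphM. Qed.

Lemma swapXY_level F lam : swapXY (F - lam%:P%:P) = swapXY F - lam%:P%:P.
Proof. by rewrite rmorphB /= swapXY_polyC map_polyC. Qed.

Lemma generic_cancel F Z : (forall c, F <> c%:P%:P) -> Z != 0 ->
  generic (coord_base k) (fun lam => forall P, dvdA (F - lam%:P%:P) (P * Z) -> dvdA (F - lam%:P%:P) P).
Proof.
move=> nF Z0; have [sF|sF] := ltnP 1 (size F); first exact: generic_cancel_Y.
have FE := size1_polyC sF; have sp : (1 < size (F`_0)%R)%N.
  by rewrite ltnNge; apply/negP => /size1_polyC E; apply: (nF ((F`_0)`_0)); rewrite -E.
have sF' : (1 < size (swapXY F))%N by rewrite FE swapXY_polyC size_map_polyC.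
have Z0' : swapXY Z != 0 by rewrite swapXY_eq0.
apply: generic_sub (generic_cancel_Y sF' Z0') => lam h P /dvdA_swap.
rewrite rmorphM /= swapXY_level => /h /dvdA_swap.
by rewrite rmorphB /= !swapXYK swapXY_polyC map_polyC.
Qed.

End Cancel.

Section PthPowers.
Variable p : nat.

Lemma coef_deriv0 (D : idomainType) (f : {poly D}) i : p \in [pchar D] -> f^`() = 0 ->
  ~~ (p %| i)%N -> f`_i = 0.
Proof.
move=> pD f'0; case: i => [|j] ndv; first by rewrite dvdn0 in ndv.
have := coef0 D j; rewrite -f'0 coef_deriv => /eqP; rewrite -mulr_natr mulf_eq0.
by rewrite -(dvdn_pcharf pD) (negbTE ndv) orbF => /eqP.
Qed.

Lemma pth_power_of_deriv0 (D : idomainType) (f : {poly D}) : p \in [pchar D] -> f^`() = 0 ->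
  (forall i, exists c, f`_i = c ^+ p) -> exists g, f = g ^+ p.
Proof.
move=> pD f'0 hf; have pr := pcharf_prime pD; have p0 := prime_gt0 pr.
have pD' : [pchar {poly D}].-nat p by rewrite (eq_pnat _ (pchar_poly D)) pnatE.
rewrite -[f]coefK poly_def.
apply: (big_ind (fun x => exists g, x = g ^+ p)).
- by exists 0; rewrite expr0n gtn_eqF.
- by move=> x y [g ->] [h ->]; exists (g + h); rewrite exprDn_pchar.
move=> i _; case: (boolP (p %| i)%N) => [/dvdnP[j ->]|ndv].
  by have [c ->] := hf (j * p)%N; exists (c *: 'X^j); rewrite exprZn -exprM.
by exists 0; rewrite expr0n gtn_eqF // (coef_deriv0 pD f'0 ndv) scale0r.
Qed.

Lemma comp_pth_of_deriv0 (D : idomainType) (f : {poly D}) : p \in [pchar D] -> f^`() = 0 ->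
  exists g, f = g \Po 'X^p.
Proof.
move=> pD f'0; rewrite -[f]coefK poly_def.
apply: (big_ind (fun x => exists g, x = g \Po 'X^p)).
- by exists 0; rewrite comp_poly0.
- by move=> x y [g ->] [h ->]; exists (g + h); rewrite comp_polyD.
move=> i _; case: (boolP (p %| i)%N) => [/dvdnP[j ->]|ndv].
  by exists (f`_(j * p) *: 'X^j); rewrite comp_polyZ comp_Xn_poly -exprM mulnC.
by exists 0; rewrite comp_poly0 (coef_deriv0 pD f'0 ndv) scale0r.
Qed.

Variable k : closedFieldType.
Hypothesis pk : p \in [pchar k].
Implicit Types F P W : poly2 k.

Let p0 : (0 < p)%N. Proof. by rewrite prime_gt0 // (pcharf_prime pk). Qed.

Lemma pth_power_poly2 W : W^`() = 0 -> (swapXY W)^`() = 0 -> exists c, W = c ^+ p.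
Proof.
move=> WY WX; apply: pth_power_of_deriv0 => // [|i]; first by rewrite pchar_poly.
apply: pth_power_of_deriv0 => // [|l]; last first.
  by have [y <-] := closed_root_exists (W`_i)`_l p0; exists y.
apply/polyP => l; rewrite coef_deriv coef0 -coef_swapXY.
have := congr1 (fun g : poly2 k => g`_l`_i) WX.
by rewrite coef_deriv coefMn !coef0.
Qed.

(* Differentiating [P ^ p = (F - lam) ^ j W] shows that [F - lam] divides [W] as
   long as [0 < j < p]. *)
Lemma generic_pth_multiple F : F^`() != 0 -> (forall c, F <> c%:P%:P) ->
  generic (coord_base k) (fun lam => forall P, dvdA (F - lam%:P%:P) (P ^+ p) ->
    exists W, P ^+ p = (F - lam%:P%:P) ^+ p * W).
Proof.
move=> F'0 nF; apply: generic_sub (generic_cancel nF F'0) => lam can P fP.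
set f := F - lam%:P%:P in can fP *.
have f'E : f^`() = F^`() by rewrite derivB derivC subr0.
have pA : p \in [pchar (poly2 k)] by rewrite !pchar_poly.
have Pp' : (P ^+ p)^`() = 0 by rewrite deriv_exp -mulrnAr -mulr_natr (pcharf0 pA) !mulr0.
have main j : (0 < j <= p)%N -> exists W, P ^+ p = f ^+ j * W.
  elim: j => // j IH /andP[_ jp]; have [j0|j0] := posnP j.
    by have [W hW] := fP; exists W; rewrite j0 expr1 mulrC.
  have [|W hW] := IH _; first by rewrite j0 ltnW.
  have f0 : f != 0.
    by apply: contraNneq F'0 => f0; rewrite -f'E f0 deriv0.
  have E : f ^+ j.-1 * (F^`() * W *+ j + f * W^`()) = 0.
    have fj : f ^+ j = f * f ^+ j.-1 by rewrite -exprS prednK.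
    rewrite -Pp' hW derivM deriv_exp f'E fj -[X in X * W + _]mulr_natr -[F^`() * W *+ j]mulr_natr.
    by move: (j%:R : poly2 k) (f ^+ j.-1) => c g; ring.
  have {}E : F^`() * W *+ j + f * W^`() = 0.
    by apply: (mulfI (expf_neq0 j.-1 f0)); rewrite mulr0.
  have jk : j%:R != 0 :> k by rewrite -(dvdn_pcharf pk) gtnNdvd.
  have [|W' W'E] := can W; last by exists W'; rewrite hW W'E mulrA mulrAC -exprSr.
  exists (- (W^`() * (j%:R^-1)%:P%:P)); rewrite mulNr.
  have hE : F^`() * W = - (j%:R^-1)%:P%:P * (f * W^`()).
    apply: (mulfI (x := (j%:R)%:P%:P)); first by rewrite !polyC_eq0.
    have cc : (j%:R)%:P%:P * (j%:R^-1)%:P%:P = 1 :> poly2 k by rewrite -!rmorphM /= mulfV.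
    rewrite mulNr mulrN [in RHS]mulrA cc mul1r !rmorph_nat; apply/eqP; rewrite -addr_eq0.
    by rewrite mulr_natl E.
  by rewrite mulrC hE; ring.
by apply: main; rewrite p0 leqnn.
Qed.

End PthPowers.

(** * From a pseudo generator to rational level curves *)

Section Radical.
Variable k : closedFieldType.
Implicit Types F P : poly2 k.

(** Some partial derivative of [F] is nonzero, whence [P ^ p = f ^ p W]. Both partial derivatives of
    [W] then vanish, so [W] is a [p]-th power and Frobenius can be undone. *)
Lemma generic_radical_pchar F p : p \in [pchar k] -> (forall c, F <> c%:P%:P) -> ~ in_pth_powers p F ->
  generic (coord_base k) (fun lam => forall P, dvdA (F - lam%:P%:P) (P ^+ p) -> dvdA (F - lam%:P%:P) P).
Proof.
move=> pk nF npF; have p0 : (0 < p)%N by rewrite prime_gt0 // (pcharf_prime pk).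
have pA : p \in [pchar (poly2 k)] by rewrite !pchar_poly.
have pth0 (g : poly2 k) : (g ^+ p)^`() = 0 by rewrite deriv_exp -mulr_natr (pcharf0 pA) mulr0.
have nF' c : swapXY F <> c%:P%:P.
  by move=> E; apply: (nF c); rewrite -[F]swapXYK E swapXY_polyC map_polyC.
have gen : generic (coord_base k) (fun lam => forall P, dvdA (F - lam%:P%:P) (P ^+ p) ->
    exists W, P ^+ p = (F - lam%:P%:P) ^+ p * W).
  have [F0|] := eqVneq F^`() 0; last by move=> F0; exact: generic_pth_multiple pk _ F0 nF.
  have [F1|F1] := eqVneq (swapXY F)^`() 0.
    by case: npF; have [c] := pth_power_poly2 pk F0 F1; exists c.
  apply: generic_sub (generic_pth_multiple pk F1 nF') => lam h P /dvdA_swap.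
  rewrite rmorphXn /= swapXY_level => /h[W hW]; exists (swapXY W).
  have := congr1 (@swapXY k) hW; rewrite rmorphM !rmorphXn /= !swapXYK => ->.
  by rewrite rmorphB /= swapXYK swapXY_polyC map_polyC.
apply: generic_sub gen => lam h P /h[W hW]; set f := F - _ in hW *.
have f0 : f != 0 by rewrite subr_eq0; apply/eqP; exact: nF.
have W1 : W^`() = 0.
  have := congr1 (@deriv _) hW; rewrite derivM !pth0 mul0r add0r => /esym/eqP.
  by rewrite mulf_eq0 expf_eq0 (negbTE f0) andbF => /eqP.
have W2 : (swapXY W)^`() = 0.
  have := congr1 (fun g => (swapXY g)^`()) hW; rewrite rmorphM !rmorphXn /= derivM !pth0 mul0r add0r.
  by move/esym/eqP; rewrite mulf_eq0 expf_eq0 swapXY_eq0 (negbTE f0) andbF => /eqP.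
have [c Wc] := pth_power_poly2 pk W1 W2; exists c; rewrite mulrC.
apply: (pchar_exp_inj (q := p)); last by rewrite hW Wc exprMn.
by rewrite pnatE // (pcharf_prime pk).
Qed.

Lemma generic_radical F q : [pchar k].-nat q -> (forall c, F <> c%:P%:P) ->
  (forall p, p \in [pchar k] -> ~ in_pth_powers p F) ->
  generic (coord_base k) (fun lam => forall P, dvdA (F - lam%:P%:P) (P ^+ q) -> dvdA (F - lam%:P%:P) P).
Proof.
move=> qp nF npF; have [->|[p [e [pk ->]]]] := pchar_nat_power qp.
  by apply: generic_all => lam P; rewrite expr1.
apply: generic_sub (generic_radical_pchar pk nF (npF p pk)) => lam h P.
elim: e => [|e IH]; first by rewrite expn0 expr1.
by rewrite expnSr exprM => /h.
Qed.

End Radical.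

Section Independence.
Variable k : closedFieldType.

Lemma sparse_eq0 (D : nzRingType) q n (b : 'I_n -> D) : (0 < q)%N ->
  \sum_i (b i)%:P * 'X ^+ (q * i) = 0 -> forall i, b i = 0.
Proof.
move=> q0 E i; have := congr1 (fun g : {poly D} => g`_(q * i)) E.
rewrite /= coef0 coef_sum (bigD1 i) //= coefCM coefXn eqxx mulr1 big1 ?addr0 // => j ji.
by rewrite coefCM coefXn eqn_pmul2l // eq_sym -[_ == _ :> nat]/(j == i) (negbTE ji) mulr0.
Qed.

(* The outer variable is eliminated between [f = 0] and [y B = A]. *)
Lemma eliminate (L : fieldType) (ev : {rmorphism poly2 k -> L}) (f A B : poly2 k) (y : L) :
  f != 0 -> ev f = 0 -> ev B != 0 -> y * ev B = ev A ->
  exists n (b : 'I_n -> {poly k}), (exists i, b i != 0) /\ \sum_i ev (b i)%:P * y ^+ i = 0.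
Proof.
move=> f0 evf B0 hy; set n := (size f).-1.
have [b hb [W hW]] := dep_mod (fun i : 'I_n.+1 => A ^+ i * B ^+ (n - i)) f0 (leqSpred _).
exists n.+1, b; split=> //; apply: (mulIf (expf_neq0 n B0)); rewrite mul0r mulr_suml.
transitivity (ev (\sum_i b i *: (A ^+ i * B ^+ (n - i)))); last by rewrite hW rmorphM evf mulr0.
rewrite rmorph_sum; apply: eq_bigr => i _; rewrite -mul_polyC !rmorphM !rmorphXn -hy exprMn -!mulrA.
by congr (_ * (_ * _)); rewrite -exprD subnKC // -ltnS ltn_ord.
Qed.

Variables (L : fieldType) (iota : {rmorphism k -> L}) (phi : {rmorphism poly2 k -> L}).
Hypotheses (phiC : forall c, phi c%:P%:P = iota c) (phi_inj : forall P, phi P = 0 -> P = 0).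
Variables (F P1 P2 Q : poly2 k) (v : L) (q : nat).
Let u := phi F.
Hypotheses (q0 : (0 < q)%N) (Q0 : evm iota u v Q != 0).
Hypotheses (hX : phi 'X%:P ^+ q * evm iota u v Q = evm iota u v P1)
  (hY : phi 'X ^+ q * evm iota u v Q = evm iota u v P2).

Let cc : {rmorphism k -> poly2 k} := polyC \o polyC.

Lemma phi_evm x y P : phi (evm cc x y P) = evm iota (phi x) (phi y) P.
Proof. by apply: evm_morph => c; exact: phiC. Qed.

Lemma evm_id (P : poly2 k) : evm cc 'X%:P 'X P = P.
Proof.
apply/eqP; rewrite -subr_eq0; apply/eqP/ev2_eq0 => x y; rewrite ev2B /ev2.
rewrite (@evm_morph _ _ _ _ (idfun : {rmorphism k -> k})) => [|c]; last exact: ev2_const.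
by rewrite evmX evmY subrr.
Qed.

Lemma phi_polyC (b : {poly k}) : phi b%:P = (map_poly iota b).[phi 'X%:P].
Proof. by rewrite -[b%:P]evm_id phi_evm evm_polyC. Qed.

(** If [F] were constant, [X ^ q] and [Y ^ q] would both be rational functions of [v] alone;
    eliminating [v] makes [X] and [Y] algebraically dependent. In [f] the inner variable stands for
    [X] and the outer one for [v]. *)
Lemma generator_nonconstant c : F <> c%:P%:P.
Proof.
move=> Fc; have uc : u = iota c by rewrite /u Fc phiC.
pose sp := evm cc c%:P%:P 'X; pose ev := evm iota (phi 'X%:P) v.
have ev_sp P : ev (sp P) = evm iota u v P.
  rewrite /ev /sp (@evm_morph _ _ _ _ iota) => [|z]; last exact: evmC.
  by rewrite evmC evmY uc.
have pt x t P : ev2 x t (sp P) = ev2 c t P.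
  transitivity (evm (idfun : {rmorphism k -> k}) (ev2 x t c%:P%:P) (ev2 x t 'X) P).
    by apply: evm_morph => z; exact: ev2_const.
  by rewrite ev2_const ev2_Y.
pose f := sp P1 - 'X%:P ^+ q * sp Q.
have f0 : f != 0.
  have spQ : sp Q != 0 by apply: contraNneq Q0 => E; rewrite -ev_sp E rmorph0.
  have [x [t]] := ev2_inf spQ; rewrite pt; apply: contraNneq => f0.
  (* Comparing [z = 0] with [z = 1] gives [Q (c, t) = 0], against the choice of [t]. *)
  have h z : ev2 c t P1 = z ^+ q * ev2 c t Q.
    have := congr1 (ev2 z t) f0; rewrite ev2B ev2M ev2_exp ev2_X !pt ev2_0.
    by move/eqP; rewrite subr_eq0 => /eqP.
  by have := h 1; rewrite (h 0) expr0n gtn_eqF // mul0r expr1n mul1r => <-.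
have evf : ev f = 0 by rewrite rmorphB rmorphM rmorphXn !ev_sp /ev evmX hX subrr.
have [||n [b [[i bi] E]]] := @eliminate _ ev f (sp P2) (sp Q) (phi 'X ^+ q) f0 evf.
- by rewrite ev_sp.
- by rewrite !ev_sp.
case/eqP: bi; apply: (sparse_eq0 q0 _ i); apply: phi_inj; rewrite -[RHS]E rmorph_sum.
apply: eq_bigr => j _; rewrite -exprM -rmorphXn.
have -> : ev (b j)%:P = phi (b j)%:P by rewrite phi_polyC /ev; exact: evm_polyC.
exact: rmorphM.
Qed.

(** A relation between [u] and [v] would, after eliminating [v], make each of [X] and [Y] algebraic
    over [k(F)]. If [F] involves [Y] this is absurd for [X]; otherwise [F] is a nonconstant
    polynomial in [X] and it is absurd for [Y]. *)
Lemma generator_independent R : evm iota u v R = 0 -> R = 0.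
Proof.
move=> RE; apply/eqP/negPn/negP => R0.
pose bF (b : {poly k}) := (map_poly cc b).[F].
have evF b : evm iota u v b%:P = phi (bF b).
  by rewrite evm_polyC /bF -(evm_polyC cc F 0) phi_evm evm_polyC.
have rel y z : y ^+ q * evm iota u v Q = evm iota u v z -> exists n (b : 'I_n -> {poly k}),
    (exists i, b i != 0) /\ \sum_i phi (bF (b i)) * y ^+ (q * i) = 0.
  move=> hy; have [n [b [hb E]]] := @eliminate _ (evm iota u v) R z Q _ R0 RE Q0 hy.
  by exists n, b; split=> //; rewrite -[RHS]E; apply: eq_bigr => i _; rewrite evF exprM.
have [sF|sF] := ltnP 1 (size F).
  have [n [b [[i bi] E]]] := rel _ _ hX; case/eqP: bi; apply: (sparse_eq0 q0 _ i).
  pose G := \sum_i map_poly polyC (b i) * 'X%:P ^+ (q * i).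
  have G0 : G = 0.
    apply/eqP; rewrite -(comp_poly_eq0 G sF); apply/eqP/phi_inj; rewrite -[RHS]E /G !rmorph_sum.
    apply: eq_bigr => j _; rewrite !rmorphM !rmorphXn /= comp_polyC; congr (phi _ * _).
    by rewrite /comp_poly /bF -map_poly_comp.
  transitivity (swapXY G); last by rewrite G0 rmorph0.
  rewrite rmorph_sum; apply: eq_bigr => j _.
  by rewrite rmorphM rmorphXn /= swapXY_map_polyC swapXY_polyC map_polyX.
have FE := size1_polyC sF; have sp : (1 < size (F`_0)%R)%N.
  rewrite ltnNge; apply/negP => /size1_polyC E; apply: (@generator_nonconstant ((F`_0)`_0)).
  by rewrite -E.
have [n [b [[i bi] E]]] := rel _ _ hY; case/eqP: bi.
apply/eqP; rewrite -(comp_poly_eq0 (b i) sp); apply/eqP.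
apply: (sparse_eq0 (b := fun i => b i \Po F`_0) q0 _ i); apply: phi_inj; rewrite -[RHS]E rmorph_sum.
apply: eq_bigr => j _; rewrite rmorphM rmorphXn; congr (phi _ * _).
by rewrite /bF {2}FE /comp_poly -horner_map -map_poly_comp.
Qed.

End Independence.

(** * Descending from [t ^ q] to [t] *)

Section SimpleRoot.
Variables (L : fieldType) (K : L -> Prop).
Hypotheses (K0 : K 0) (K1 : K 1) (KD : forall x y, K x -> K y -> K (x + y))
  (KN : forall x, K x -> K (- x)) (KM : forall x y, K x -> K y -> K (x * y))
  (KV : forall x, K x -> K x^-1).

Definition coefs_in (f : {poly L}) := forall i, K f`_i.

Lemma coefs_in_division m f : m != 0 -> coefs_in m -> coefs_in f ->
  exists Q R, [/\ f = Q * m + R, coefs_in R & (size R < size m)%N].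
Proof.
move=> m0 hm; have lm0 : lead_coef m != 0 by rewrite lead_coef_eq0.
have sm : (0 < size m)%N by rewrite size_poly_gt0.
have [n] := ubnP (size f); elim: n f => // n IH f; rewrite ltnS => sf hf.
have [fm|mf] := ltnP n (size m).
  have [nm|nm] := ltnP (size f) (size m); first by exists 0, f; rewrite mul0r add0r.
  have nE : n = (size m).-1.+1 by lia.
  by exfalso; move: fm nm sf; move: (size f) => z; lia.
have hc : K (f`_n.-1 / lead_coef m) by apply: KM => //; apply: KV; exact: hm.
set c := f`_n.-1 / _ in hc; set d := (n - size m)%N.
pose f' := f - (c *: 'X^d) * m.
have f'E j : f'`_j = f`_j - (if (j < d)%N then 0 else c * m`_(j - d)).
  by rewrite coefB -scalerAl coefZ coefXnM; case: ifP; rewrite ?mulr0.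
have [||Q [R [E hR sR]]] := IH f'; last 1 first.
- by exists (Q + c *: 'X^d), R; split=> //; rewrite mulrDl addrAC -E /f' subrK.
- have n0 : (0 < n)%N by apply: leq_trans mf.
  rewrite -[X in (_ < X)%N](prednK n0) ltnS; apply/leq_sizeP => j nj; rewrite f'E.
  have jd : (j < d)%N = false by rewrite /d; move: (size m) sm mf => z; lia.
  rewrite jd; have [->|jn] := eqVneq j n.-1.
    have -> : (n.-1 - d = (size m).-1)%N by rewrite /d; move: (size m) sm mf => z; lia.
    by rewrite -/(lead_coef m) /c divfK // subrr.
  rewrite (nth_default 0 (s := f)); last by apply: leq_trans sf _; lia.
  rewrite (nth_default 0 (s := m)) ?mulr0 ?subr0 //.
  by rewrite /d; move: (size m) sm mf => z; lia.
move=> i; rewrite f'E; apply: KD; first exact: hf.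
by apply: KN; case: ifP => // _; apply: KM => //; exact: hm.
Qed.

(* The minimal polynomial of [t] over [K] divides both [('X - t) ^ q] and [f]. *)
Lemma simple_root_in f t q : coefs_in f -> f.[t] = 0 -> f^`().[t] != 0 ->
  [pchar L].-nat q -> K (t ^+ q) -> K t.
Proof.
move=> hf ft f't qp Kt; have q0 : (0 < q)%N by case/andP: qp.
pose good m := [/\ m != 0, coefs_in m & m.[t] = 0].
have gf : good f by split=> //; apply: contraNneq f't => ->; rewrite deriv0 horner0.
have [m [[m0 hm mt] minm]] : exists m, good m /\ forall m', good m' -> (size m <= size m')%N.
  have [n] := ubnP (size f); elim: n f gf {hf ft f't} => // n IH f gf sf.
  have [[g [gg sg]]|ng] := classic (exists g, good g /\ (size g < size f)%N).
    by apply: IH gg _; exact: leq_trans sg _.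
  exists f; split=> // g gg; rewrite leqNgt; apply/negP => sg; apply: ng; by exists g.
have dv g : coefs_in g -> g.[t] = 0 -> m %| g.
  move=> hg gt; have [Q [R [E hR sR]]] := coefs_in_division m0 hm hg.
  have R0 : R = 0.
    apply/eqP/negPn/negP => R0; have := minm R; rewrite leqNgt sR => X; suff: false by [].
    apply: X; split=> //; have := congr1 (horner^~ t) E.
    by rewrite gt hornerD hornerM mt mulr0 add0r => <-.
  by rewrite E R0 addr0 dvdp_mull.
have pE : ('X - t%:P) ^+ q = 'X^q - (t ^+ q)%:P.
  have qp' : [pchar {poly L}].-nat q by rewrite (eq_pnat _ (pchar_poly L)).
  by rewrite exprDn_pchar // exprNn_pchar // polyC_exp.
have /dvdp_exp_XsubCP[j [jq mE]] : m %| ('X - t%:P) ^+ q.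
  apply: dv; last by rewrite horner_exp hornerXsubC subrr expr0n gtn_eqF.
  move=> i; rewrite pE coefB coefXn coefC; apply: KD; first by case: eqP.
  by apply: KN; case: eqP.
have [Q E] := dvdpP _ _ (dv f hf ft).
have m't : m^`().[t] != 0.
  by apply: contraNneq f't => E0; rewrite E derivM hornerD !hornerM mt E0 !mulr0 addr0.
have {}mE := eqpfP mE; move: (lead_coef m / _) mE => c mE.
have c0 : c != 0 by apply: contraNneq m0 => E0; rewrite mE E0 scale0r.
have j1 : j = 1%N.
  case: j mE {jq} => [|[|j]] // mE.
    by move: mt; rewrite mE expr0 hornerZ hornerC mulr1 => E0; rewrite E0 eqxx in c0.
  by move: m't; rewrite mE derivZ deriv_exp hornerZ hornerMn hornerM horner_exp hornerXsubC subrr exprS mul0r mulr0 mul0rn mulr0 eqxx.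
have m1 : m`_1 = c by rewrite mE j1 coefZ coefB coefX coefC subr0 mulr1.
have m00 : m`_0 = - (c * t) by rewrite mE j1 coefZ coefB coefX coefC sub0r mulrN.
have -> : t = - (m`_0 / m`_1) by rewrite m1 m00 mulNr opprK mulrC mulKf.
by apply: KN; apply: KM; [|apply: KV]; exact: hm.
Qed.

End SimpleRoot.

Section Separation.
Variables (k : closedFieldType) (p : nat) (L : fieldType) (fr : {rmorphism {poly k} -> L}).
Hypotheses (pk : p \in [pchar k]) (fr_inj : forall a, fr a = 0 -> a = 0).
Hypothesis fr_surj : forall z, exists a c, [/\ c != 0, coprimep a c & z = fr a / fr c].
Let iota : {rmorphism k -> L} := fr \o polyC.
Let s : {poly k} := 'X^p.

Let p0 : (0 < p)%N. Proof. by rewrite prime_gt0 // (pcharf_prime pk). Qed.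

Let fr_neq0 a : a != 0 -> fr a != 0.
Proof. by apply: contraNneq => /fr_inj/eqP. Qed.

Lemma comp_s_inj a : a \Po s = 0 -> a = 0.
Proof. by move/eqP; rewrite comp_poly_eq0 ?size_polyXn // => /eqP. Qed.

Lemma evm_comp_s a c b d P : c != 0 -> d != 0 -> exists N D, [/\ D != 0,
  evm iota (fr a / fr c) (fr b / fr d) P = fr N / fr D &
  evm iota (fr (a \Po s) / fr (c \Po s)) (fr (b \Po s) / fr (d \Po s)) P = fr (N \Po s) / fr (D \Po s)].
Proof.
move=> c0 d0; have cs : c \Po s != 0 by apply: contraNneq c0 => /comp_s_inj ->.
have ds : d \Po s != 0 by apply: contraNneq d0 => /comp_s_inj ->.
have key a' c' b' d' : c' != 0 -> d' != 0 -> evm iota (fr a' / fr c') (fr b' / fr d') P =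
    fr (bihom polyC P (sizeY P) (size P) a' c' b' d') / fr (c' ^+ sizeY P * d' ^+ size P).
  move=> c'0 d'0; have cd0 : fr (c' ^+ sizeY P * d' ^+ size P) != 0.
    by rewrite fr_neq0 // mulf_neq0 ?expf_neq0.
  apply: (mulIf cd0); rewrite divfK // (@bihom_morph _ _ _ _ iota) //.
  rewrite (@bihom_frac _ _ iota) ?fr_neq0 //; last by move=> j; apply: leqW; exact: sizeY_bound.
  by rewrite mulrC rmorphM !rmorphXn.
exists (bihom polyC P (sizeY P) (size P) a c b d), (c ^+ sizeY P * d ^+ size P); split.
- by rewrite mulf_neq0 ?expf_neq0.
- exact: key.
rewrite key //; congr (fr _ / fr _); last by rewrite comp_polyM !rmorphXn.
have h := @bihom_morph k {poly k} {poly k} polyC polyC (comp_poly s) P (sizeY P) (size P) a c b d.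
by rewrite -h // => x /=; rewrite comp_polyC.
Qed.

(* If [x] and [y] have zero derivative they are functions of [t ^ p], and replacing
   [t ^ p] by [t] does not change the relations between them. *)
Lemma in_kuv_pchar_root e x y : in_kuv iota x y (fr 'X ^+ (p ^ e)) ->
  exists x' y', (forall P, evm iota x' y' P = 0 <-> evm iota x y P = 0) /\ in_kuv iota x' y' (fr 'X).
Proof.
elim: e x y => [|e IH] x y; first by rewrite expn0 expr1; exists x, y.
have pL : [pchar L].-nat (p ^ e.+1)%N.
  have pL' : p \in [pchar L] by rewrite (fmorph_pchar iota).
  by rewrite pnatX pnatE ?pL' // (pcharf_prime pk).
(* If [z = a / c] has nonzero derivative, [t] is a simple root of [a - z c], a polynomial over
   [k(x, y)]. *)
have sep z : in_kuv iota x y z -> (exists a c, [/\ c != 0, coprimep a c, z = fr a / fr c & ~ (a^`() = 0 /\ c^`() = 0)]) ->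
    in_kuv iota x y (fr 'X ^+ (p ^ e.+1)) -> in_kuv iota x y (fr 'X).
  move=> hz [a [c [c0 cop zE nd]]].
  have ev0 (g : {poly k}) : (map_poly iota g).[fr 'X] = fr g.
    rewrite /iota map_poly_comp horner_map -/(comp_poly _ _).
    by congr (fr _); exact: comp_polyXr.
  pose f := map_poly iota a - z *: map_poly iota c.
  have cin x0 : in_kuv iota x y (iota x0) by exact: in_kuv_const.
  apply: (@simple_root_in L (in_kuv iota x y) _ _ _ _ _ _ f).
  - by rewrite -(rmorph0 iota).
  - by rewrite -(rmorph1 iota).
  - exact: in_kuv_add.
  - by move=> w hw; rewrite -mulN1r -(rmorph1 iota) -rmorphN; exact: in_kuv_mul.
  - exact: in_kuv_mul.
  - exact: in_kuv_inv.
  - move=> i; rewrite coefB coefZ !coef_map; apply: in_kuv_add; first exact: cin.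
    rewrite -mulrN -rmorphN; apply: in_kuv_mul => //; exact: cin.
  - by rewrite hornerD hornerN hornerZ !ev0 zE divfK ?subrr ?fr_neq0.
  - rewrite derivB derivZ !deriv_map hornerD hornerN hornerZ !ev0; apply/eqP => E; apply: nd.
    (* Coprimality makes [c] divide its own derivative, which is shorter, so the derivative is zero;
       then so is that of [a]. *)
    have {}E : a^`() * c = a * c^`().
      apply/eqP; rewrite -subr_eq0; apply/eqP/fr_inj; rewrite rmorphB !rmorphM.
      move/eqP: E; rewrite subr_eq0 => /eqP ->; rewrite zE mulrAC divfK ?subrr ?fr_neq0 //.
    have c'0 : c^`() = 0.
      have : c %| a * c^`() by rewrite -E dvdp_mull.
      rewrite Gauss_dvdpr 1?coprimep_sym // => cd; move: cd.
      apply: contraTeq => c'0; apply/negP => /(dvdp_leq c'0); rewrite leqNgt lt_size_deriv //.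
    split=> //; apply: (mulIf c0); by rewrite E c'0 mulr0 mul0r.
  exact: pL.
have [a [c [c0 copx xE]]] := fr_surj x; have [b [d [d0 copy yE]]] := fr_surj y.
move=> hK; have [hx hy] := in_kuv_gen iota x y.
have [[a'0 c'0]|nx] := classic (a^`() = 0 /\ c^`() = 0); last first.
  by exists x, y; split=> //; apply: sep hx _ hK; exists a, c.
have [[b'0 d'0]|ny] := classic (b^`() = 0 /\ d^`() = 0); last first.
  by exists x, y; split=> //; apply: sep hy _ hK; exists b, d.
have [a1 aE] := comp_pth_of_deriv0 pk a'0; have [c1 cE] := comp_pth_of_deriv0 pk c'0.
have [b1 bE] := comp_pth_of_deriv0 pk b'0; have [d1 dE] := comp_pth_of_deriv0 pk d'0.
have c10 : c1 != 0 by apply: contraNneq c0 => E; rewrite cE E comp_poly0.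
have d10 : d1 != 0 by apply: contraNneq d0 => E; rewrite dE E comp_poly0.
pose x1 := fr a1 / fr c1; pose y1 := fr b1 / fr d1.
have com P : exists N D, [/\ D != 0, evm iota x1 y1 P = fr N / fr D & evm iota x y P = fr (N \Po s) / fr (D \Po s)].
  by rewrite xE yE aE bE cE dE; exact: evm_comp_s.
have nz D : D != 0 -> fr (D \Po s) != 0 by move=> D0; apply: fr_neq0; apply: contraNneq D0 => /comp_s_inj ->.
have ker P : evm iota x1 y1 P = 0 <-> evm iota x y P = 0.
  have [N [D [D0 -> ->]]] := com P; split=> /eqP; rewrite mulf_eq0 invr_eq0.
    rewrite (negbTE (fr_neq0 D0)) orbF => /eqP/fr_inj ->.
    by rewrite comp_poly0 rmorph0 mul0r.
  rewrite (negbTE (nz _ D0)) orbF => /eqP/fr_inj/comp_s_inj ->.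
  by rewrite rmorph0 mul0r.
have [|x' [y' [ker' hX]]] := IH x1 y1; last by exists x', y'; split=> // P; rewrite ker'.
have [P [Q [Q0 E]]] := hK; exists P, Q.
have Q1 : evm iota x1 y1 Q != 0 by apply: contraNneq Q0 => /ker ->.
split=> //; apply: (mulIf Q1); rewrite divfK //.
have {}E : fr 'X ^+ (p ^ e.+1) * evm iota x y Q = evm iota x y P by rewrite E divfK.
have [N [D [D0 -> EP]]] := com P; have [N' [D' [D'0 -> EQ]]] := com Q.
rewrite EP EQ in E.
have Xs : fr 'X ^+ (p ^ e.+1) = fr ('X^(p ^ e) \Po s).
  by rewrite comp_Xn_poly -exprM -expnS rmorphXn.
apply/eqP; rewrite mulrA eqr_div ?fr_neq0 // -rmorphXn -!rmorphM; apply/eqP; congr (fr _).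
apply/eqP; rewrite -subr_eq0; apply/eqP/comp_s_inj/fr_inj; rewrite rmorphB rmorphB.
move/eqP: E; rewrite Xs mulrA eqr_div ?nz // -!rmorphM => /eqP E.
by rewrite E subrr.
Qed.

End Separation.

(** * Specialising the generators to a level curve *)

Section Specialization.
Variables (k : closedFieldType) (L : fieldType) (iota : {rmorphism k -> L}) (phi : {rmorphism poly2 k -> L}).
Hypotheses (phiC : forall c, phi c%:P%:P = iota c) (phi_inj : forall P, phi P = 0 -> P = 0).
Variables (F P1 P2 Q g h : poly2 k) (q : nat).
Let u := phi F.
Let v := phi g / phi h.
Hypotheses (qp : [pchar k].-nat q) (h0 : h != 0) (Q0 : evm iota u v Q != 0).
Hypotheses (hX : phi 'X%:P ^+ q * evm iota u v Q = evm iota u v P1)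
  (hY : phi 'X ^+ q * evm iota u v Q = evm iota u v P2).
Hypothesis npF : forall p, p \in [pchar k] -> ~ in_pth_powers p F.

Let cc : {rmorphism k -> poly2 k} := polyC \o polyC.
Let q0 : (0 < q)%N. Proof. by case/andP: qp. Qed.
Let phih0 : phi h != 0. Proof. by apply: contraNneq h0 => /phi_inj/eqP. Qed.
Let nF c : F <> c%:P%:P. Proof. exact (generator_nonconstant phiC phi_inj q0 Q0 hX hY (c:=c)). Qed.
Let ind R : evm iota u v R = 0 -> R = 0.
Proof. exact (generator_independent phiC phi_inj q0 Q0 hX hY (R:=R)). Qed.

(* [P'] being [P] with [q]-th powers of coefficients, [sharp P'] is the
   polynomial with [sharp P' (F, G) = Q (F, G) ^ (I + J) * P ^ q]. *)
Definition sharp P' I J : poly2 k := bihom cc P' I J P1 Q P2 Q.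

Definition twist_of P P' := forall (R : comNzRingType) (kappa : {rmorphism k -> R}) x y,
  evm kappa x y P ^+ q = evm kappa (x ^+ q) (y ^+ q) P'.

Definition in_box (P : poly2 k) I J := (size P <= J.+1)%N /\ forall j, (size (P`_j)%R <= I.+1)%N.

Lemma in_box_ex (P P' : poly2 k) : exists I J, in_box P I J /\ in_box P' I J.
Proof.
exists (sizeY P + sizeY P')%N, (size P + size P')%N; split; split.
- by apply: leqW; exact: leq_addr.
- by move=> j; apply: leqW; apply: leq_trans (sizeY_bound P j) (leq_addr _ _).
- by apply: leqW; exact: leq_addl.
by move=> j; apply: leqW; apply: leq_trans (sizeY_bound P' j) (leq_addl _ _).
Qed.

Lemma evm_sharp P P' I J : twist_of P P' -> in_box P' I J ->
  evm iota u v (sharp P' I J) = evm iota u v Q ^+ (I + J) * phi P ^+ q.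
Proof.
move=> tw [sJ sI]; rewrite /sharp (@bihom_morph _ _ _ _ iota) => [|c]; last exact: evmC.
rewrite bihom_frac // -hX -hY !mulfK // exprD; congr (_ * _).
by rewrite -[P in RHS]evm_id (phi_evm phiC) tw.
Qed.

Lemma evm_Xn (R : comNzRingType) (kappa : {rmorphism k -> R}) x y n :
  evm kappa x y ('X ^+ n)%:P = x ^+ n.
Proof. by rewrite evm_polyC map_polyXn hornerXn. Qed.

Section Fiber.
Variable lam : k.
Variables (M : fieldType) (fr : {rmorphism {poly k} -> M}).
Hypothesis fr_inj : forall a, fr a = 0 -> a = 0.
Let kt : {rmorphism k -> M} := fr \o polyC.

(** The first generator goes to [lam] and the second to [t ^ q]; with this exponent every value is a
    [q]-th power, since [k] is perfect. *)
Definition spec : {rmorphism poly2 k -> {poly k}} := evm (polyC : {rmorphism k -> {poly k}}) lam%:P 'X^q.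

Lemma specE R : spec R = map_poly (horner_eval lam) R \Po 'X^q.
Proof.
rewrite /spec evmE /comp_poly -map_poly_comp; congr (_.[_]); apply: eq_map_poly => a /=.
by rewrite /horner_eval -[X in _ = X](horner_map polyC).
Qed.

Lemma spec_root R : exists r, r ^+ q = spec R.
Proof.
rewrite specE; have [r hr] := pchar_root_poly 1 (map_poly (horner_eval lam) R) qp.
by exists r; rewrite hr muln1.
Qed.

Lemma spec_eq0 R : spec R = 0 -> exists R', R = R' * ('X - lam%:P)%:P.
Proof.
move/eqP; rewrite specE comp_poly_eq0 ?size_polyXn // => /eqP; exact: fiber_zero_dvd.
Qed.

Hypothesis Q_lam : spec Q != 0.
Variables (a b d : {poly k}).
Hypotheses (ha : a ^+ q = spec P1) (hb : b ^+ q = spec P2) (hd : d ^+ q = spec Q).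
Let x := fr a / fr d.
Let y := fr b / fr d.

Let frd0 : fr d != 0.
Proof.
by apply: contraNneq Q_lam => /fr_inj d0; rewrite -hd d0 expr0n gtn_eqF.
Qed.

Lemma spec_sharp P P' I J : twist_of P P' -> in_box P' I J ->
  fr (spec (sharp P' I J)) = (fr d ^+ q) ^+ (I + J) * evm kt x y P ^+ q.
Proof.
move=> tw [sJ sI]; rewrite /sharp (@bihom_morph _ _ _ _ polyC) => [|c]; last exact: evmC.
rewrite -ha -hb -hd (@bihom_morph _ _ _ _ kt) // !rmorphXn.
by rewrite bihom_frac ?expf_neq0 // -exprD -!expr_div_n tw.
Qed.

Let pchM : [pchar M].-nat q. Proof. exact: rmorph_pchar_nat kt _ qp. Qed.

Let dM n : (fr d ^+ q) ^+ n != 0. Proof. by rewrite !expf_neq0. Qed.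

(** The [q]-th power of the tautology [F (X, Y) = u] is a relation between [u] and [v]. As these are
    independent, it is a polynomial identity, and so it may be specialised before the [q]-th root is
    taken again. *)
Lemma spec_level : evm kt x y F = kt lam.
Proof.
have [F' tw] := evm_pchar_twist F qp; have [I [J [bx _]]] := in_box_ex F' F'.
have E : sharp F' I J = Q ^+ (I + J) * ('X ^+ q)%:P.
  apply/eqP; rewrite -subr_eq0; apply/eqP/ind; rewrite rmorphB (evm_sharp tw bx).
  by rewrite rmorphM rmorphXn evm_Xn subrr.
apply: (pchar_exp_inj pchM); apply: (mulfI (dM (I + J))).
have e1 : spec ('X ^+ q)%:P = (lam ^+ q)%:P by rewrite /spec evm_Xn polyC_exp.
rewrite -(spec_sharp tw bx) E (rmorphM spec) (rmorphXn spec) e1 -hd (rmorphM fr) !(rmorphXn fr).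
by rewrite -(rmorphXn kt).
Qed.

Lemma spec_coordinate : evm kt x y g = fr 'X ^+ q * evm kt x y h.
Proof.
have [g' twg] := evm_pchar_twist g qp; have [h' twh] := evm_pchar_twist h qp.
have [I [J [bg bh]]] := in_box_ex g' h'.
have E : sharp g' I J = 'X ^+ q * sharp h' I J.
  apply/eqP; rewrite -subr_eq0; apply/eqP/ind; rewrite rmorphB (evm_sharp twg bg).
  rewrite rmorphM rmorphXn (evm_sharp twh bh) evmY /v expr_div_n mulrCA.
  by rewrite divfK ?subrr // expf_neq0.
apply: (pchar_exp_inj pchM); apply: (mulfI (dM (I + J))).
rewrite -(spec_sharp twg bg) E rmorphM rmorphXn rmorphM exprMn (spec_sharp twh bh) mulrCA.
by congr (_ * _); rewrite /spec evmY !rmorphXn.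
Qed.

Hypothesis cancel_h : forall P, dvdA (F - lam%:P%:P) (P * h) -> dvdA (F - lam%:P%:P) P.
Let Z : poly2 k := bihom cc Q (sizeY Q) (size Q) F 1 g h.
Hypothesis cancel_Z : forall P, dvdA (F - lam%:P%:P) (P * Z) -> dvdA (F - lam%:P%:P) P.
Hypothesis radical : forall P, dvdA (F - lam%:P%:P) (P ^+ q) -> dvdA (F - lam%:P%:P) P.

Lemma phi_bihom R I J : in_box R I J ->
  phi (bihom cc R I J F 1 g h) = phi h ^+ J * evm iota u v R.
Proof.
move=> [sJ sI]; rewrite (@bihom_morph _ _ _ _ iota) => [|c]; last exact: phiC.
by rewrite rmorph1 bihom_frac ?oner_neq0 // expr1n mul1r divr1.
Qed.

(** If [P] vanishes at [(x, y)], then [X - lam] divides [sharp P']. Substituting [(F, g / h)] and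
    clearing denominators makes [F - lam] divide [P ^ q] times powers of [h] and of [Z], the
    numerator of [Q (u, v)]. *)
Lemma spec_kernel P : evm kt x y P = 0 <-> dvdA (F - lam%:P%:P) P.
Proof.
split=> [P0|[W ->]]; last first.
  by rewrite rmorphM rmorphB spec_level evmC subrr mulr0.
have [P' tw] := evm_pchar_twist P qp; have [I [J [bx _]]] := in_box_ex P' P'.
have /spec_eq0[R RE] : spec (sharp P' I J) = 0.
  by apply: fr_inj; rewrite (spec_sharp tw bx) P0 expr0n gtn_eqF // mulr0.
have [I' [J' [bR _]]] := in_box_ex R R.
have bQ : in_box Q (sizeY Q) (size Q).
  by split; [exact: leqW|move=> j; apply: leqW; exact: sizeY_bound].
set n := (I + J)%N.
have main : P ^+ q * h ^+ J' * Z ^+ n = bihom cc R I' J' F 1 g h * h ^+ (size Q * n) * (F - lam%:P%:P).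
  apply/eqP; rewrite -subr_eq0; apply/eqP/phi_inj; rewrite rmorphB !rmorphM !rmorphXn rmorphB phiC.
  rewrite /Z !phi_bihom // exprMn -exprM -/u.
  have e2 : evm iota u v ('X - lam%:P)%:P = u - iota lam.
    by rewrite evm_polyC rmorphB /= map_polyX map_polyC hornerXsubC.
  have E := congr1 (evm iota u v) RE; rewrite (evm_sharp tw bx) (rmorphM (evm iota u v)) e2 -/n in E.
  apply/eqP; rewrite subr_eq0; apply/eqP.
  transitivity (phi h ^+ J' * phi h ^+ (size Q * n) * (evm iota u v Q ^+ n * phi P ^+ q)); first by ring.
  by rewrite E; ring.
apply: radical.
have cancel_pow (w : poly2 k) j A : (forall A, dvdA (F - lam%:P%:P) (A * w) -> dvdA (F - lam%:P%:P) A) ->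
    dvdA (F - lam%:P%:P) (A * w ^+ j) -> dvdA (F - lam%:P%:P) A.
  move=> cw; elim: j => [|j IH]; first by rewrite expr0 mulr1.
  by rewrite exprSr mulrA => /cw.
apply: (cancel_pow h J') => //; apply: (cancel_pow Z n) => //.
by rewrite main; exists (bihom cc R I' J' F 1 g h * h ^+ (size Q * n)).
Qed.

Lemma spec_generator : in_kuv kt x y (fr 'X ^+ q).
Proof.
have hxy : evm kt x y h != 0.
  apply/eqP => /spec_kernel; rewrite -[h]mul1r => /cancel_h /spec_kernel /eqP.
  by rewrite rmorph1 oner_eq0.
by exists g, h; split=> //; rewrite spec_coordinate mulfK.
Qed.

End Fiber.

Lemma generic_fiber_model (M : fieldType) (fr : {rmorphism {poly k} -> M}) :
  (forall a, fr a = 0 -> a = 0) ->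
  generic (coord_base k) (fun lam => exists x y : M,
    (forall P, evm (fr \o polyC : {rmorphism k -> M}) x y P = 0 <-> dvdA (F - lam%:P%:P) P) /\
    in_kuv (fr \o polyC : {rmorphism k -> M}) x y (fr 'X ^+ q)).
Proof.
move=> fr_inj; pose Z : poly2 k := bihom cc Q (sizeY Q) (size Q) F 1 g h.
have bQ : in_box Q (sizeY Q) (size Q).
  by split; [exact: leqW|move=> j; apply: leqW; exact: sizeY_bound].
have Z0 : Z != 0.
  have : phi Z != 0 by rewrite phi_bihom // mulf_neq0 ?expf_neq0.
  by apply: contraNneq => ->; rewrite rmorph0.
have Qn0 : Q != 0 by apply: contraNneq Q0 => ->; rewrite rmorph0.
have lQ : lead_coef Q != 0 by rewrite lead_coef_eq0.
have := generic_and (generic_base_root lQ) (generic_and (generic_cancel nF h0)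
  (generic_and (generic_cancel nF Z0) (generic_radical qp nF npF))).
apply: generic_sub => lam [Ql [ch [cZ rad]]].
have sQ : spec lam Q != 0.
  rewrite specE comp_poly_eq0 ?size_polyXn //; apply: contraNneq Ql => E.
  by rewrite -[_.[lam]]/(horner_eval lam (lead_coef Q)) /lead_coef -coef_map E coef0.
have [a ha] := spec_root lam P1; have [b hb] := spec_root lam P2; have [d hd] := spec_root lam Q.
exists (fr a / fr d), (fr b / fr d); split.
  by move=> P; apply (spec_kernel fr_inj sQ ha hb hd ch cZ rad).
apply (spec_generator fr_inj sQ ha hb hd ch cZ rad).
Qed.

End Specialization.

Lemma in_kuv_common_den (k : closedFieldType) (L : fieldType) (iota : {rmorphism k -> L}) (u v z w : L) :
  in_kuv iota u v z -> in_kuv iota u v w -> exists P P' Q : poly2 k,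
    [/\ evm iota u v Q != 0, z * evm iota u v Q = evm iota u v P & w * evm iota u v Q = evm iota u v P'].
Proof.
move=> [P [Q [Q0 ->]]] [P' [Q' [Q0' ->]]]; exists (P * Q'), (P' * Q), (Q * Q').
rewrite !(rmorphM (evm iota u v)); split; first by rewrite mulf_neq0.
  by rewrite mulrA divfK.
by rewrite mulrCA divfK // mulrC.
Qed.

Section GeneratorImpliesGenericallyRational.
Variable k : closedFieldType.
Local Notation fr := (@FracField.tofrac {poly k}).
Local Notation frA := (@FracField.tofrac (poly2 k)).
Implicit Types F : poly2 k.

Lemma generic_cofinite (P : k -> Prop) : generic (coord_base k) P ->
  exists s : seq k, forall lam, lam \notin s -> P lam.
Proof.
move=> [r r0 hr]; pose R : {poly k} := r; have R0 : R != 0 := r0.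
have [s hs] := closed_field_poly_normal R; exists s => lam ls; apply: hr.
rewrite -[cev _ _ _]/(R.[lam]) hs hornerZ mulf_neq0 ?lead_coef_eq0 //.
by rewrite -/(root _ lam) root_prod_XsubC.
Qed.

Lemma rational_of_model F lam (x y : ratfun k) : F - lam%:P%:P != 0 ->
  (forall P, evm (ktm k) x y P = 0 <-> dvdA (F - lam%:P%:P) P) -> in_kuv (ktm k) x y (fr 'X) ->
  k_rational_quot (F - lam%:P%:P).
Proof.
move=> f0 ker hX; set f := F - _ in f0 ker *.
have n1 : ~ dvdA f 1 by move/ker/eqP; rewrite rmorph1 oner_eq0.
split.
  split=> //; split.
    by apply/negP => fu; apply: n1; exists f^-1; rewrite mulVr.
  move=> a b fab; have : evm (ktm k) x y a * evm (ktm k) x y b = 0.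
    by rewrite -rmorphM -fab; apply/ker/dvdA_refl.
  move/eqP; rewrite mulf_eq0 => /orP[] /eqP/ker[c E]; [right|left]; apply/unitrPr; exists c.
    by apply: (mulIf f0); rewrite mul1r -mulrA -E mulrC -fab.
  by apply: (mulIf f0); rewrite mul1r -mulrA -E -fab.
exists x, y; split=> [P|z]; first by rewrite eval2_kt; exact: ker.
have hP (a : {poly k}) : in_kuv (ktm k) x y (fr a).
  have -> : fr a = evm (ktm k) (fr 'X) 0 a%:P.
    rewrite evm_polyC map_poly_comp horner_map; congr (fr _).
    by rewrite -[LHS]comp_polyXr.
  by apply: in_kuv_trans => //; rewrite -(rmorph0 (ktm k)); exact: in_kuv_const.
have [a [c [c0 ->]]] := fraction_numden z.
have [P [Q [Q0 E]]] := in_kuv_mul (hP a) (in_kuv_inv (hP c)).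
by exists P, Q; rewrite !eval2_kt.
Qed.

Lemma generator_generally_rational F : pseudo_field_generator F ->
  (forall p, p \in [pchar k] -> ~ in_pth_powers (k := k) p F) -> generally_rational F.
Proof.
move=> [G hG] npF.
have pn z : exists q, [pchar k].-nat q /\ in_kuv (kAm k) (frA F) G (z ^+ q).
  have [q [/in_k2E hq [q1|[p [e [pk qE]]]]]] := hG z; exists q; split=> //; first by rewrite q1.
  by rewrite qE pnatX pnatE ?pk // (pcharf_prime pk).
have [qx [qxp hx]] := pn (frA 'X%:P); have [qy [qyp hy]] := pn (frA 'X).
pose q := (qx * qy)%N; have qp : [pchar k].-nat q by rewrite pnatM qxp qyp.
have hX1 : in_kuv (kAm k) (frA F) G (frA 'X%:P ^+ q) by rewrite exprM; exact: in_kuv_exp.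
have hY1 : in_kuv (kAm k) (frA F) G (frA 'X ^+ q) by rewrite /q mulnC exprM; exact: in_kuv_exp.
have [g [h [h0 GE]]] := fraction_numden G; rewrite GE in hX1 hY1.
have [P1 [P2 [Q [Q0 hX hY]]]] := in_kuv_common_den hX1 hY1.
have inj P : frA P = 0 -> P = 0 by move/eqP; rewrite tofrac_eq0 => /eqP.
have inj' (a : {poly k}) : fr a = 0 -> a = 0 by move/eqP; rewrite tofrac_eq0 => /eqP.
have model := generic_fiber_model (iota := kAm k) (phi := frA) (fun c => erefl) inj qp h0 Q0 hX hY npF (fr := fr) inj'.
have q0 : (0 < q)%N by case/andP: qp.
have nF := @generator_nonconstant k _ (kAm k) frA (fun c => erefl) inj F _ _ _ _ q q0 Q0 hX hY.
have [s hs] := generic_cofinite model; exists s => lam /hs[x [y [ker hK]]].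
have f0 : F - lam%:P%:P != 0 by rewrite subr_eq0; apply/eqP; exact: nF.
have surj (z : ratfun k) : exists a c, [/\ c != 0, coprimep a c & z = fr a / fr c] by exact: lowest_terms.
have [x' [y' [ker' hK']]] : exists x' y' : ratfun k,
    (forall P, evm (ktm k) x' y' P = 0 <-> evm (ktm k) x y P = 0) /\ in_kuv (ktm k) x' y' (fr 'X).
  have [q1|[p [e [pk qE]]]] := pchar_nat_power qp; first by exists x, y; move: hK; rewrite q1 expr1.
  by rewrite qE in hK; exact: (in_kuv_pchar_root pk inj' surj hK).
by apply: (@rational_of_model F lam x' y') => // P; exact: iff_trans (ker' P) (ker P).
Qed.

End GeneratorImpliesGenericallyRational.

Theorem mainTheorem1 (k : closedFieldType) (F : {poly {poly k}}) :
  generally_rational F <->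
  (pseudo_field_generator F /\
   (forall p : nat, p \in [pchar k] -> ~ in_pth_powers p F)).
Proof.
split=> [hF|[hG hp]]; last exact: generator_generally_rational.
by split=> [|p pk]; [exact: generally_rational_generator|exact: generally_rational_not_power].
Qed.
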